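(* Suppose that $\lim_{\varepsilon\to0}\frac{(d^\varepsilon)^2}{\alpha^\varepsilon}=0$, $\lim_{\varepsilon\to 0}q^\varepsilon=q\in[0,\infty]$ and $\lim_{\varepsilon\to 0}r^\varepsilon=r\in[0,\infty)$. Let $\{\lambda_k^\varepsilon\}_{k\in\mathbb{N}}$ be the sequence of eigenvalues of $\mathcal{A}^\varepsilon$ written in ascending order and repeated according to multiplicity. Then $$\sup_{k\in\mathbb{N}}\left(\limsup_{\varepsilon\to 0}\lambda_k^\varepsilon\right)\le q.$$
   Context: Let $n\ge 2$, let $\Omega\subset\mathbb{R}^n$ be a bounded Lipschitz domain with $0\in\Omega$, and let $\Gamma=\{x\in\Omega:\ x_n=0\}$. Let $\varepsilon>0$ be a small parameter, $R\in(0,1/2)$ a constant, $R^\varepsilon=R\varepsilon$, and $0<d^\varepsilon<R^\varepsilon$ with $d^\varepsilon=o(\varepsilon)$ as $\varepsilon\to0$. For $i=(i_1,\dots,i_{n-1})\in\mathbb{Z}^{n-1}$ let $x^{i,\varepsilon}=(\varepsilon i_1,\dots,\varepsilon i_{n-1},0)$ and $$D_i^\varepsilon=\{x\in\mathbb{R}^n:\ R^\varepsilon-d^\varepsilon<|x-x^{i,\varepsilon}|<R^\varepsilon\},\qquad B_i^\varepsilon=\{x\in\mathbb{R}^n:\ |x-x^{i,\varepsilon}|<R^\varepsilon-d^\varepsilon\}.$$ Let $\mathcal{I}^\varepsilon$ be the set of $i\in\mathbb{Z}^{n-1}$ with $x^{i,\varepsilon}\in\Gamma$ and $\mathrm{dist}(x^{i,\varepsilon},\partial\Omega)\ge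 \varepsilon\sqrt n/2$. Let $\alpha^\varepsilon,\beta^\varepsilon>0$ be constants. Put $a^\varepsilon=\alpha^\varepsilon$ on $\bigcup_{i\in\mathcal{I}^\varepsilon}D_i^\varepsilon$ and $a^\varepsilon=1$ on the rest of $\Omega$; $b^\varepsilon=\beta^\varepsilon$ on $\bigcup_{i\in\mathcal{I}^\varepsilon}B_i^\varepsilon$ and $b^\varepsilon=1$ on the rest of $\Omega$. Put $$q^\varepsilon=\frac{\alpha^\varepsilon n}{R\,d^\varepsilon\varepsilon\beta^\varepsilon},\qquad r^\varepsilon=R^n\varkappa_n\,\varepsilon\beta^\varepsilon,$$ where $\varkappa_n$ is the volume of the unit ball in $\mathbb{R}^n$. $\mathcal{H}^\varepsilon$ is $L^2(\Omega)$ with scalar product $(u,v)_{\mathcal{H}^\varepsilon}=\int_\Omega u\overline{v}\,b^\varepsilon\,dx$. $\mathcal{A}^\varepsilon$ (formally $-\frac1{b^\varepsilon}\mathrm{div}(a^\varepsilon\nabla)$ with Dirichlet conditions on $\partial\Omega$) is the self-adjoint operator in $\mathcal{H}^\varepsilon$ associated with the form $\eta^\varepsilon[u,v]=\int_\Omega a^\varepsilon\nabla u\cdot\nabla\overline v\,dx$, $\mathrm{dom}(\eta^\varepsilon)=H^1_0(\Omega)$. Its spectrum is purely discrete. *)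

(* Defs.v *)
From HB Require Import structures.
From mathcomp Require Import all_boot all_order all_algebra.
From mathcomp Require Import complex.
From mathcomp Require Import all_classical all_reals all_analysis.
Set Implicit Arguments.
Unset Strict Implicit.
Unset Printing Implicit Defensive.
Import Order.TTheory GRing.Theory Num.Theory numFieldNormedType.Exports.
Local Open Scope classical_set_scope.
Local Open Scope ring_scope.

(* Product (equivalently, Borel) sigma-algebra on row vectors. *)
Section measurable_rV.
Context {d} {T : measurableType d} {n : nat}.
Let coord (i : 'I_n) (x : 'rV[T]_n) : T := x 0 i.
Let rV_set0 : g_sigma_preimage coord set0.
Proof. exact: sigma_algebra0. Qed.
Let rV_setC A : g_sigma_preimage coord A -> g_sigma_preimage coord (~` A).
Proof. exact: sigma_algebraC. Qed.
Let rV_bigcup (F : (set 'rV[T]_n)^nat) : (forall i, g_sigma_preimage coord (F i)) ->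
  g_sigma_preimage coord (\bigcup_i (F i)).
Proof. exact: sigma_algebra_bigcup. Qed.
HB.instance Definition _ := @isMeasurable.Build (measure_tuple_display d)
  ('rV[T]_n) (g_sigma_preimage coord) rV_set0 rV_setC rV_bigcup.
End measurable_rV.

Lemma measurable_rV_coord d (T : measurableType d) n (i : 'I_n) :
  measurable_fun [set: 'rV[T]_n] (fun x => x 0 i).
Proof.
move=> _ Y mY; rewrite setTI; apply: sub_sigma_algebra.
rewrite -bigcup_seq/=; exists i => /=; first by rewrite mem_index_enum.
by exists Y => //; rewrite setTI.
Qed.

Lemma measurable_fun_rV d1 d2 (T1 : measurableType d1) (T2 : measurableType d2)
    n (f : T1 -> 'rV[T2]_n) :
  (forall i, measurable_fun [set: T1] (fun x => f x 0 i)) ->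
  measurable_fun [set: T1] f.
Proof.
move=> mf; apply: (measurability (\big[setU/set0]_(i < n) preimage_set_system [set: 'rV[T2]_n] (fun x => x 0 i) measurable)).
  by [].
move=> _ [B + <-]; rewrite -bigcup_seq => -[i _ [A mA <-]].
by rewrite !setTI; have := mf i measurableT A mA; rewrite setTI.
Qed.

Section lebesgue_rV.
Context {R : realType}.

Definition rV_cons n (p : R * 'rV[R]_n) : 'rV[R]_n.+1 :=
  \row_i if unlift 0 i is Some j then p.2 0 j else p.1.

Let rV_uncons n (x : 'rV[R]_n.+1) : R * 'rV[R]_n :=
  (x 0 0, \row_j x 0 (lift 0 j)).

Let rV_consE n p (i : 'I_n.+1) :
  rV_cons p 0 i = if unlift 0 i is Some j then p.2 0 j else p.1.
Proof.
by rewrite mxE.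
Qed.

Let rV_consK n : cancel (@rV_cons n) (@rV_uncons n).
Proof.
case=> a x; rewrite /rV_uncons; congr pair; first by rewrite rV_consE unlift_none.
by apply/rowP => j; rewrite mxE rV_consE liftK.
Qed.

Let rV_unconsK n : cancel (@rV_uncons n) (@rV_cons n).
Proof.
move=> x; apply/rowP => i; rewrite rV_consE /rV_uncons/=.
by case: unliftP => [j ->|->]; rewrite ?mxE.
Qed.

Lemma measurable_rV_cons n :
  measurable_fun [set: measurableTypeR R * 'rV[R]_n] (@rV_cons n).
Proof.
apply: measurable_fun_rV => i.
under eq_fun do rewrite rV_consE.
case: unliftP => [j _|_]; last exact: measurable_fst.
exact: (measurableT_comp (measurable_rV_coord j) measurable_snd).
Qed.

Let measurable_rV_uncons n :
  measurable_fun [set: 'rV[R]_n.+1]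
    (@rV_uncons n : _ -> measurableTypeR R * 'rV[R]_n)%type.
Proof.
apply: measurable_fun_pair; first exact: measurable_rV_coord.
apply: measurable_fun_rV => i.
by under eq_fun do rewrite mxE; exact: measurable_rV_coord.
Qed.

Section step.
Variables (n : nat) (mu : {sigma_finite_measure set 'rV[R]_n -> \bar R}).

Definition lebesgue_rV_step : set 'rV[R]_n.+1 -> \bar R :=
  pushforward (lebesgue_measure \x mu)%E (@rV_cons n).

HB.instance Definition _ := Measure.copy lebesgue_rV_step
  (measure_function_pushforward__canonical__measure_function_Measure
    (lebesgue_measure \x mu)%E (@measurable_rV_cons n)).

Let sigma_finite_lebesgue_rV_step : sigma_finite setT lebesgue_rV_step.
Proof.
have /sigma_finiteP[F [FT Fnd Foo]] := sigma_finiteT (@lebesgue_measure R).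
have /sigma_finiteP[G [GT Gnd Goo]] := sigma_finiteT mu.
exists (fun k => @rV_uncons n @^-1` (F k `*` G k)).
  rewrite -preimage_bigcup; apply/esym/seteqP; split => // x _.
  have [i _ Fi] : (\bigcup_k F k) (rV_uncons x).1 by rewrite -FT.
  have [j _ Gj] : (\bigcup_k G k) (rV_uncons x).2 by rewrite -GT.
  exists (maxn i j) => //; split.
  - by move: Fi; exact/subsetPset/Fnd/leq_maxl.
  - by move: Gj; exact/subsetPset/Gnd/leq_maxr.
move=> k; have [mF Fk] := Foo k; have [mG Gk] := Goo k; split.
  rewrite -[X in measurable X]setTI; apply: measurable_rV_uncons => //.
  exact: measurableX.
rewrite /lebesgue_rV_step /pushforward -comp_preimage.
rewrite (_ : _ \o _ = idfun); last by apply/funext => x /=; rewrite rV_consK.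
by rewrite preimage_id product_measure1E// lte_mul_pinfty// ge0_fin_numE.
Qed.

HB.instance Definition _ := Measure_isSigmaFinite.Build _ _ _
  lebesgue_rV_step sigma_finite_lebesgue_rV_step.

End step.

Fixpoint lebesgue_rV n : {sigma_finite_measure set 'rV[R]_n -> \bar R} :=
  if n is m.+1 then lebesgue_rV_step (lebesgue_rV m) else \d_(0 : 'rV[R]_0).

End lebesgue_rV.

Section euclidean_space.
Context {R : realType}.

Definition enorm n (x : 'rV[R]_n) : R := Num.sqrt (\sum_i x 0 i ^+ 2).

Definition boundary (T : topologicalType) (A : set T) : set T :=
  closure A `\` A°.

Definition edist n (x : 'rV[R]_n) (A : set 'rV[R]_n) : R :=
  inf [set enorm (x - y) | y in A].

(* Near each boundary point, after an orthogonal change of coordinates, the set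
   is the part of a ball lying strictly above a Lipschitz graph. *)
Definition lipschitz_boundary m (Om : set 'rV[R]_m.+1) : Prop :=
  forall x, boundary Om x ->
  exists (r : R) (U : 'M[R]_m.+1) (g : 'rV[R]_m -> R),
  [/\ 0 < r, U *m U^T = 1%:M, [lipschitz g y | y in setT]
    & forall y, enorm (y - x) < r ->
        Om y <-> g (col' ord_max (y *m U)) < (y *m U) 0 ord_max].

Definition bounded_lipschitz_domain m (Om : set 'rV[R]_m.+1) : Prop :=
  [/\ open Om, connected Om, bounded_set Om & lipschitz_boundary Om].

Definition unit_ball_volume n : R :=
  fine (lebesgue_rV n [set x : 'rV[R]_n | enorm x < 1]).

End euclidean_space.

Section function_spaces.
Context {R : realType} {n : nat}.
Local Notation fct := ('rV[R]_n -> R[i]).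
Implicit Types (Om : set 'rV[R]_n) (u v phi : fct) (g : 'I_n -> fct).

Local Notation Re := (@complex.Re R).
Local Notation Im := (@complex.Im R).

Definition sqmodulus (z : R[i]) : R := Re z ^+ 2 + Im z ^+ 2.

Definition cintegral Om u : R[i] :=
  Complex (\int[lebesgue_rV n]_(x in Om) Re (u x))
          (\int[lebesgue_rV n]_(x in Om) Im (u x)).

(* Elements of L^2 are represented by Borel functions, and are identified only
   up to almost everywhere equality (see [eq_ae_on]). *)
Definition L2 Om : set fct := [set u : fct |
  [/\ measurable_fun Om (Re \o u), measurable_fun Om (Im \o u)
    & (\int[lebesgue_rV n]_(x in Om) (sqmodulus (u x))%:E < +oo)%E]].

Definition eq_ae_on Om u v : Prop :=
  {ae lebesgue_rV n, forall x, Om x -> u x = v x}.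

Definition partial (j : 'I_n) (f : 'rV[R]_n -> R) : 'rV[R]_n -> R :=
  fun x => 'D_(delta_mx 0 j) f x.

Definition smooth (f : 'rV[R]_n -> R) : Prop :=
  forall s : seq 'I_n, let fs := foldr partial f s in
    continuous fs /\ forall j x, derivable fs x (delta_mx 0 j).

Definition test_function Om : set fct := [set phi : fct |
  [/\ smooth (Re \o phi), smooth (Im \o phi)
    & exists K : set 'rV[R]_n,
        [/\ compact K, K `<=` Om & forall x, ~ K x -> phi x = 0]]].

Definition cpartial (j : 'I_n) phi : fct :=
  fun x => Complex (partial j (Re \o phi) x) (partial j (Im \o phi) x).

Definition weak_gradient Om u g : Prop :=
  (forall j, L2 Om (g j)) /\
  forall j phi, test_function Om phi ->
    cintegral Om (fun x => u x * cpartial j phi x)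
    = - cintegral Om (fun x => g j x * phi x).

Definition H1 Om : set fct :=
  [set u : fct | L2 Om u /\ exists g, weak_gradient Om u g].

(* A representative of the gradient of [u], which is determined up to almost
   everywhere equality when [u] is in H^1. *)
Definition grad Om u : 'I_n -> fct :=
  xget (fun _ _ => 0) [set g : 'I_n -> fct | weak_gradient Om u g].

Definition H1_sqnorm Om u : \bar R :=
  (\int[lebesgue_rV n]_(x in Om) (sqmodulus (u x))%:E
   + \sum_j \int[lebesgue_rV n]_(x in Om) (sqmodulus (grad Om u j x))%:E)%E.

Definition H10 Om : set fct := [set u : fct | H1 Om u /\
  forall e : R, 0 < e -> exists2 phi, test_function Om phi &
    (H1_sqnorm Om (fun x => (u x - phi x)%R) < e%:E)%E].

End function_spaces.

Section spectrum.
Context {R : realType} {n : nat}.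
Local Notation fct := ('rV[R]_n -> R[i]).
Variable Om : set 'rV[R]_n.

(* The graph of the operator associated with the form [eta] of domain [dometa]
   in the Hilbert space [H] with scalar product [ip]. *)
Definition form_operator (dometa : set fct) (eta : fct -> fct -> R[i])
    (H : set fct) (ip : fct -> fct -> R[i]) (u f : fct) : Prop :=
  [/\ dometa u, H f & forall v, dometa v -> eta u v = ip f v].

Definition eigenfunctions (A : fct -> fct -> Prop) (mu : R) : set fct :=
  [set u : fct | A u (fun x => (mu%:C)%C * u x)].

(* Complex dimension modulo almost everywhere equality on [Om]. *)
Definition has_dimension (E : set fct) (m : nat) : Prop :=
  exists e : 'I_m -> fct,
  [/\ forall i, E (e i),
      forall c : 'I_m -> R[i],
        eq_ae_on Om (fun x => \sum_i c i * e i x) (fun=> 0) ->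
        forall i, c i = 0
    & forall u, E u -> exists c : 'I_m -> R[i],
        eq_ae_on Om u (fun x => \sum_i c i * e i x)].

(* The eigenvalues in ascending order, repeated according to multiplicity: each
   real number [mu] is listed exactly as many times as the dimension of its
   eigenspace (zero times when it is not an eigenvalue). Real values suffice
   since the operators considered are self-adjoint. *)
Definition eigenvalue_sequence (A : fct -> fct -> Prop) (lam : nat -> R) :=
  nondecreasing_seq lam /\
  forall mu : R, exists m : nat,
    has_dimension (eigenfunctions A mu) m /\ ([set k | lam k = mu] #= `I_m)%card.

End spectrum.

(* The space dimension is n = m.+1, and the last coordinate x_n is x 0 ord_max. *)
Section problem.
Context {R : realType} {m : nat}.
Implicit Types (Om : set 'rV[R]_m.+1) (eps rad d alpha beta : R)
  (a b : 'rV[R]_m.+1 -> R).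

Definition lattice_point eps (i : 'rV[int]_m) : 'rV[R]_m.+1 :=
  \row_j if unlift ord_max j is Some k then eps * (i 0 k)%:~R else 0.

Definition shell eps rad d (i : 'rV[int]_m) : set 'rV[R]_m.+1 :=
  [set x | rad * eps - d < enorm (x - lattice_point eps i) < rad * eps].

Definition core eps rad d (i : 'rV[int]_m) : set 'rV[R]_m.+1 :=
  [set x | enorm (x - lattice_point eps i) < rad * eps - d].

Definition cross_section Om : set 'rV[R]_m.+1 :=
  [set x | Om x /\ x 0 ord_max = 0].

Definition cells Om eps : set 'rV[int]_m :=
  [set i | cross_section Om (lattice_point eps i) /\
    eps * Num.sqrt (m.+1)%:R / 2 <= edist (lattice_point eps i) (boundary Om)].

Definition a_coef Om eps rad d alpha : 'rV[R]_m.+1 -> R := fun x =>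
  if x \in \bigcup_(i in cells Om eps) shell eps rad d i then alpha else 1.

Definition b_coef Om eps rad d beta : 'rV[R]_m.+1 -> R := fun x =>
  if x \in \bigcup_(i in cells Om eps) core eps rad d i then beta else 1.

Definition inner Om b (u v : 'rV[R]_m.+1 -> R[i]) : R[i] :=
  cintegral Om (fun x => u x * (v x)^* * (b x)%:C%C).

Definition energy Om a (u v : 'rV[R]_m.+1 -> R[i]) : R[i] :=
  cintegral Om
    (fun x => (a x)%:C%C * \sum_j grad Om u j x * (grad Om v j x)^*).

(* The weight b is bounded above and away from 0, so the weighted space has the
   same elements as L^2(Om). *)
Definition A_operator Om eps rad d alpha beta :=
  form_operator (H10 Om) (energy Om (a_coef Om eps rad d alpha))
    (L2 Om) (inner Om (b_coef Om eps rad d beta)).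

Definition q_coef eps rad d alpha beta : R :=
  alpha * (m.+1)%:R / (rad * d * eps * beta).

Definition r_coef eps rad beta : R :=
  rad ^+ m.+1 * unit_ball_volume m.+1 * eps * beta.

End problem.

Arguments q_coef {R} m eps rad d alpha beta.
Arguments r_coef {R} m eps rad beta.

(* Main.v *)
Require Import Defs.
From HB Require Import structures.
From mathcomp Require Import all_boot all_order all_algebra.
From mathcomp Require Import complex.
From mathcomp Require Import all_classical all_reals all_analysis.
From mathcomp Require Import measurable_realfun.
From mathcomp Require Import ring lra.
Set Implicit Arguments.
Unset Strict Implicit.
Unset Printing Implicit Defensive.
Import Order.TTheory GRing.Theory Num.Theory numFieldNormedType.Exports.
Local Open Scope classical_set_scope.
Local Open Scope ring_scope.

(** The bound is an instance of the min-max principle. Around a lattice point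
    take a function that is 1 on the core, 0 outside the ball of radius
    rho = rad * eps, and drops radially across the shell. Up to factors tending
    to 1, its energy is alpha * vol(shell) / d^2 and its squared norm at least
    beta * vol(core), with vol(shell) <= (n d / rho) vol(ball). So its Rayleigh
    quotient is at most q_coef / (1 - d / rho)^(n + 4) ([trial_function]).
    Such functions around different lattice points have disjoint supports and,
    Om being a neighbourhood of 0, at least k + 1 lattice points are available
    for small eps. Hence the eigenvalue number k obeys the same bound
    ([eigenvalue_le_q]), which tends to q because d / eps tends to 0.

    The eigenvalues are only known through the dimensions of the eigenspaces,
    so the min-max principle has to be established: k + 1 orthonormal
    eigenfunctions with eigenvalues below the bound must be exhibited
    ([eigenpairs_below]), and compared with the sequence by counting
    multiplicities ([eigenvalue_le]).

    The eigenfunctions are found one after the other by minimising the energy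
    plus a penalty on those already found ([next_eigenpair]). The compactness
    needed there is [finite_rank_inequality]: inside cubes of small side the
    oscillation of a function is a small multiple of its energy, so that, up
    to a small error, its norm is controlled by its averages over finitely
    many cubes. Along an ultrafilter of almost minimisers these averages
    converge, which with the parallelogram identity yields a minimising
    sequence that is Cauchy in the energy norm
    ([minimizing_cauchy_sequence]).

    All of this is done for real functions and for the closure [sobolev] of
    the test functions, whose elements carry their own gradient. The gradient
    of the statement is a chosen representative of the weak gradient; it is
    the same almost everywhere by the fundamental lemma of the calculus of
    variations ([du_bois_reymond]), and complex functions are split into real
    and imaginary parts ([cx_eigenfunction]). *)

(** * Lebesgue measure under affine maps *)

Section affine.
Context {R : realType}.
Local Notation leb := (@lebesgue_measure R).

Let mpush d d' (T1 : measurableType d) (T2 : measurableType d')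
    (m : {measure set T1 -> \bar R}) (f : T1 -> T2) (mf : measurable_fun setT f)
    : {measure set T2 -> \bar R} :=
  measure_function_pushforward__canonical__measure_function_Measure m mf.

Lemma measurable_affine1 (c v : R) :
  measurable_fun [set: measurableTypeR R] (fun x : R => c * x + v : measurableTypeR R).
Proof.
exact: measurable_funD.
Qed.

(** Two measures that agree on intervals; Lebesgue measure is determined by its
    values there. *)
Lemma lebesgue_affine (c v : R) (A : set R) : 0 < c -> measurable A ->
  (c%:E * leb ((fun x : R => (c * x + v)%R) @^-1` A) = leb A)%E.
Proof.
move=> c0 mA.
have c0' : 0 <= c by exact: ltW.
pose m' := mscale (NngNum c0') (mpush leb (measurable_affine1 c v)).
suff -> : leb A = m' A by [].
apply: lebesgue_measure_unique => // _ [[a b]] _ <-.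
transitivity (c%:E * leb ((fun x : R => (c * x + v)%R) @^-1` `]a, b]))%E; last by [].
have -> : (fun x : R => c * x + v) @^-1` `]a, b] = `](a - v) / c, (b - v) / c]%classic.
  apply/seteqP; split => x /=; rewrite !in_itv/=.
    by rewrite ltr_pdivrMr// ler_pdivlMr// ltrBlDr lerBrDr mulrC.
  by rewrite ltr_pdivrMr// ler_pdivlMr// ltrBlDr lerBrDr mulrC.
rewrite !lebesgue_measure_itv/= !lte_fin ltr_pM2r ?invr_gt0// ltrD2r.
case: ifPn => ab; last by rewrite mule0.
rewrite -!EFinD -EFinM; congr EFin.
by field; rewrite gt_eqF.
Qed.

Definition affine n (c : R) (v x : 'rV[R]_n) := c *: x + v.

Lemma measurable_affine n c v : measurable_fun setT (@affine n c v).
Proof.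
apply: measurable_fun_rV => i.
under eq_fun do rewrite !mxE.
apply: measurable_funD => //; apply: measurable_funM => //.
exact: measurable_rV_coord.
Qed.

(** One coordinate is peeled off at a time: on rectangles the rescaled
    pushforward has the value of the product measure, which this determines. *)
Lemma lebesgue_rV_affine n c v (A : set 'rV[R]_n) : 0 < c -> measurable A ->
  ((c ^+ n)%:E * lebesgue_rV n (affine c v @^-1` A) = lebesgue_rV n A)%E.
Proof.
move=> c0; elim: n v A => [|n IH] v A mA.
  rewrite expr0 mul1e; congr (lebesgue_rV 0 _).
  by apply/seteqP; split => x; rewrite /= (thinmx0 (affine _ _ _)) (thinmx0 x).
have c0' : 0 <= c ^+ n.+1 by exact/ltW/exprn_gt0.
pose v0 := v 0 0.
pose v' : 'rV[R]_n := \row_j v 0 (lift 0 j).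
pose TT (p : measurableTypeR R * 'rV[R]_n) : measurableTypeR R * 'rV[R]_n :=
  (c * p.1 + v0, affine c v' p.2).
have mT : measurable_fun setT TT.
  apply: measurable_fun_pair.
    exact: (measurableT_comp (measurable_affine1 c v0) measurable_fst).
  exact: (measurableT_comp (measurable_affine c v') measurable_snd).
pose m' := mscale (NngNum c0') (mpush (leb \x lebesgue_rV n)%E mT).
have E X : measurable X -> (leb \x lebesgue_rV n)%E X = m' X.
  apply: product_measure_unique => B C mB mC.
  transitivity ((c ^+ n.+1)%:E * (leb \x lebesgue_rV n) (TT @^-1` (B `*` C)))%E.
    by [].
  have -> : TT @^-1` (B `*` C) =
      ((fun x => c * x + v0) @^-1` B) `*` (affine c v' @^-1` C).
    by apply/seteqP; split => -[x y].
  rewrite product_measure1E; last 2 first.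
  - by rewrite -[X in measurable X]setTI; exact: measurable_affine1.
  - by rewrite -[X in measurable X]setTI; exact: measurable_affine.
  rewrite exprS EFinM muleACA lebesgue_affine//.
  by rewrite IH.
have TE p : rV_cons (TT p) = affine c v (rV_cons p).
  apply/rowP => i; rewrite /TT !mxE.
  by case: unliftP => [j ->|->]//=; rewrite !mxE.
rewrite /= /lebesgue_rV_step /pushforward.
rewrite [RHS]E; last first.
  by rewrite -[X in measurable X]setTI; exact: measurable_rV_cons.
congr (_ * _)%E; congr product_measure1.
by apply/funext => p; rewrite /preimage/mkset TE.
Qed.

End affine.

(** * Boxes, topology and measurability *)

Section boxes.
Context {R : realType} {n : nat}.
Implicit Types (a b x : 'rV[R]_n).

Definition obox a b : set 'rV[R]_n := [set x | forall i, a 0 i < x 0 i < b 0 i].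
Definition cbox a b : set 'rV[R]_n := [set x | forall i, a 0 i <= x 0 i <= b 0 i].
Definition cube a (h : R) : set 'rV[R]_n :=
  [set x | forall i, a 0 i <= x 0 i < a 0 i + h].

Lemma measurable_coords (A : 'I_n -> set R) : (forall i, measurable (A i)) ->
  measurable [set x : 'rV[R]_n | forall i, A i (x 0 i)].
Proof.
move=> mA.
have -> : [set x : 'rV[R]_n | forall i, A i (x 0 i)] =
    ~` \bigcup_i ~` ((fun x => x 0 i) @^-1` A i).
  apply/seteqP; split => x /=; first by move=> Ax [i _]; apply; exact: Ax.
  by move=> Ax i; apply: contrapT => nA; apply: Ax; exists i.
apply: measurableC; apply: countable_bigcupT_measurable => // i.
apply: measurableC; rewrite -[X in measurable X]setTI.
exact: measurable_rV_coord.
Qed.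

Lemma measurable_obox a b : measurable (obox a b).
Proof.
rewrite (_ : obox a b = [set x | forall i, `]a 0 i, b 0 i[%classic (x 0 i)]).
  by apply: (@measurable_coords (fun i => `]a 0 i, b 0 i[%classic)).
by apply/seteqP; split => x /= H i; have := H i; rewrite in_itv.
Qed.

Lemma measurable_cbox a b : measurable (cbox a b).
Proof.
rewrite (_ : cbox a b = [set x | forall i, `[a 0 i, b 0 i]%classic (x 0 i)]).
  by apply: (@measurable_coords (fun i => `[a 0 i, b 0 i]%classic)).
by apply/seteqP; split => x /= H i; have := H i; rewrite in_itv.
Qed.

Lemma measurable_cube a h : measurable (cube a h).
Proof.
rewrite (_ : cube a h = [set x | forall i, `[a 0 i, a 0 i + h[%classic (x 0 i)]).
  by apply: (@measurable_coords (fun i => `[a 0 i, a 0 i + h[%classic)).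
by apply/seteqP; split => x /= H i; have := H i; rewrite in_itv.
Qed.

Lemma rV_norm_ltP x (e : R) : 0 < e -> reflect (forall i, `|x 0 i| < e) (`|x| < e).
Proof.
move=> e0; rewrite [`|x|]/Num.norm/= mx_normrE; apply: (iffP (bigmax_ltP _ _ _ _)).
  by move=> [_ H] i; exact: (H (0, i)).
by move=> H; split=> // -[i j] _; rewrite /= (ord1 i).
Qed.

Lemma coord_le_norm x i : `|x 0 i| <= `|x|.
Proof.
rewrite [leRHS]/Num.norm/= mx_normrE.
exact: (@le_bigmax _ _ _ 0 (fun ij : 'I_1 * 'I_n => `|x ij.1 ij.2|) (0, i)).
Qed.

(** The corners are rational, so that countably many boxes cover an open set. *)
Lemma open_box (O : set 'rV[R]_n) x : open O -> O x ->
  exists ab : 'rV[rat]_n * 'rV[rat]_n,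
    obox (map_mx ratr ab.1) (map_mx ratr ab.2) x /\
    cbox (map_mx ratr ab.1) (map_mx ratr ab.2) `<=` O.
Proof.
move=> oO Ox.
have /nbhs_ballP[e /= e0 eO] : nbhs x O by exact: open_nbhs_nbhs.
have /choice[a Ha] (i : 'I_n) : exists q : rat, x 0 i - e < ratr q < x 0 i.
  have [|q] := @rat_in_itvoo R (x 0 i - e) (x 0 i); last by rewrite in_itv; exists q.
  by rewrite ltrBlDr ltrDl.
have /choice[b Hb] (i : 'I_n) : exists q : rat, x 0 i < ratr q < x 0 i + e.
  have [|q] := @rat_in_itvoo R (x 0 i) (x 0 i + e); last by rewrite in_itv; exists q.
  by rewrite ltrDl.
exists (\row_i a i, \row_i b i); split => [i|y Hy].
  by rewrite !mxE; have /andP[_ ->] := Ha i; have /andP[-> _] := Hb i.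
apply: eO; rewrite -ball_normE /ball_/=; apply/rV_norm_ltP => // i.
have := Hy i; rewrite !mxE => /andP[H1 H2].
have /andP[H3 H4] := Ha i; have /andP[H5 H6] := Hb i.
rewrite ltr_norml; apply/andP; split; lra.
Qed.

(** The sigma-algebra is generated by the coordinates; countable unions of boxes
    relate it to the topology. *)
Lemma open_rV_measurable (O : set 'rV[R]_n) : open O -> measurable O.
Proof.
move=> oO.
pose B (ab : 'rV[rat]_n * 'rV[rat]_n) : set 'rV[R]_n :=
  if `[< cbox (map_mx ratr ab.1) (map_mx ratr ab.2) `<=` O >]
  then obox (map_mx ratr ab.1) (map_mx ratr ab.2) else set0.
have -> : O = \bigcup_ab B ab.
  apply/seteqP; split => x.
    move=> /(open_box oO)[ab [abx abO]]; exists ab => //; rewrite /B.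
    by case: asboolP.
  move=> [ab _]; rewrite /B; case: asboolP => // abO xab; apply: abO => i.
  by have /andP[/ltW-> /ltW->] := xab i.
apply: countable_bigcupT_measurable => // ab; rewrite /B; case: ifP => // _.
exact: measurable_obox.
Qed.

Lemma continuous_rV_measurable (f : 'rV[R]_n -> R) : continuous f ->
  measurable_fun setT f.
Proof.
move=> cf; apply: (measurability _ (RGenOpens.measurableE R)) => //.
move=> _ [_ [a [b ->]] <-]; rewrite setTI; apply: open_rV_measurable.
by move/continuousP : cf; apply; exact: interval_open.
Qed.

End boxes.

Section cube_measure.
Context {R : realType}.

Lemma lebesgue_unit_cube n : lebesgue_rV n (cube (0 : 'rV[R]_n) 1) = 1%E.
Proof.
elim: n => [|n IH].
  by rewrite /= diracE mem_set// => -[].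
rewrite /= /lebesgue_rV_step /pushforward.
have -> : @rV_cons R n @^-1` (cube 0 1) = `[0, 1[ `*` cube 0 1.
  apply/seteqP; split => -[x y] /=.
    move=> H; split.
      by have := H 0; rewrite !mxE unlift_none in_itv/= add0r.
    by move=> i; have := H (lift 0 i); rewrite !mxE liftK.
  move=> [] /=; rewrite in_itv/= => Hx Hy i; rewrite !mxE.
  case: unliftP => [j _|_]; last by rewrite add0r.
  by have := Hy j; rewrite !mxE.
rewrite product_measure1E//; last exact: measurable_cube.
have E : lebesgue_measure (`[0, 1[%classic : set R) = 1%E.
  by rewrite lebesgue_measure_itv/= lte01 -EFinB subr0.
by rewrite IH mule1; exact: E.
Qed.

Lemma lebesgue_cube n (a : 'rV[R]_n) h : 0 < h ->
  lebesgue_rV n (cube a h) = (h ^+ n)%:E.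
Proof.
move=> h0; rewrite -(lebesgue_rV_affine a h0); last exact: measurable_cube.
have -> : affine h a @^-1` cube a h = cube 0 1.
  apply/seteqP; split => x /= H i; have := H i; rewrite !mxE add0r.
    by rewrite lerDr [a 0 i + h]addrC ltrD2r pmulr_rge0// -ltr_pdivlMl// mulVf// gt_eqF.
  by rewrite lerDr [a 0 i + h]addrC ltrD2r pmulr_rge0// -[X in _ -> _ && (_ < X)](mulr1 h) ltr_pM2l.
by rewrite lebesgue_unit_cube mule1.
Qed.

Lemma bounded_setP (V : normedModType R) (A : set V) : bounded_set A ->
  exists2 M, 0 < M & forall x, A x -> `|x| < M.
Proof.
move=> [M0 [_ HM]]; exists (`|M0| + 2) => [|x Ax]; first by rewrite ltr_wpDl.
rewrite (@le_lt_trans _ _ (`|M0| + 1)) ?ltrD2l ?ltr1n//; apply: HM => //.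
by rewrite (le_lt_trans (ler_norm _))// ltrDl.
Qed.

Lemma lebesgue_bounded_lty n (A : set 'rV[R]_n) : measurable A -> bounded_set A ->
  (lebesgue_rV n A < +oo)%E.
Proof.
move=> mA /bounded_setP[M M0' AM].
apply: (@le_lt_trans _ _ (lebesgue_rV n (cube (const_mx (- M)) (M *+ 2)))).
  apply: le_measure; rewrite ?inE//; first exact: measurable_cube.
  move=> x /AM /rV_norm_ltP -/(_ M0') H i; have := H i; rewrite ltr_norml mxE mulr2n.
  by rewrite addKr => /andP[/ltW -> ->].
by rewrite lebesgue_cube ?pmulrn_lgt0// ltry.
Qed.

End cube_measure.

Section change_var.
Context {R : realType} {n : nat}.
Local Notation mu := (@lebesgue_rV R n).

Lemma lebesgue_translate (v : 'rV[R]_n) (A : set 'rV[R]_n) : measurable A ->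
  mu ((fun x => x + v) @^-1` A) = mu A.
Proof.
move=> mA; rewrite -[RHS](lebesgue_rV_affine v (ltr01 : 0 < (1 : R)))//.
rewrite expr1n mul1e; congr (mu _).
by apply/funext => x; rewrite /preimage /mkset /affine scale1r.
Qed.

Lemma measurable_translate (v : 'rV[R]_n) :
  measurable_fun setT (fun x : 'rV[R]_n => x + v).
Proof.
rewrite (_ : (fun x => _) = affine 1 v); first exact: measurable_affine.
by apply/funext => x; rewrite /affine scale1r.
Qed.

Lemma ge0_integral_translate (v : 'rV[R]_n) (f : 'rV[R]_n -> \bar R) :
  measurable_fun setT f -> (forall x, 0 <= f x)%E ->
  (\int[mu]_x f ((x : 'rV[R]_n) + v)%R = \int[mu]_x f x)%E.
Proof.
move=> mf f0.
transitivity (\int[pushforward mu (fun x : 'rV[R]_n => (x + v)%R)]_x f x)%E.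
  by rewrite ge0_integral_pushforward//; exact: measurable_translate.
apply: eq_measure_integral => //=.
  exact: measurable_translate.
by move=> ? A mA _; exact: lebesgue_translate.
Qed.

Lemma integral_translate (v : 'rV[R]_n) (f : 'rV[R]_n -> \bar R) :
  measurable_fun setT f ->
  (\int[mu]_x f ((x : 'rV[R]_n) + v)%R = \int[mu]_x f x)%E.
Proof.
move=> mf; rewrite [LHS]integralE [RHS]integralE; congr (_ - _)%E.
  under eq_integral do rewrite (funepos_comp f (fun x : 'rV[R]_n => x + v))/=.
  by rewrite (@ge0_integral_translate v (f^\+)%E)//; exact: measurable_funepos.
under eq_integral do rewrite (funeneg_comp f (fun x : 'rV[R]_n => x + v))/=.
by rewrite (@ge0_integral_translate v (f^\-)%E)//; exact: measurable_funeneg.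
Qed.

End change_var.

(** * Smooth functions built from exp(-1/x) *)

(** Reduces directional derivatives to functions of one real variable. *)
Lemma is_derive_line (R : numFieldType) (V W : normedModType R) (f : V -> W) x v d :
  is_derive x v f d <-> is_derive (0 : R) 1 (fun h : R => f (h *: v + x)) d.
Proof.
have E : (fun h : R => h^-1 *: ((f \o shift x) (h *: v) - f x)) =
    (fun h : R => h^-1 *: (((fun h : R => f (h *: v + x)) \o shift 0) (h *: 1)
        - f (0 *: v + x))).
  by apply/funext => h /=; rewrite addr0 scale0r add0r [_%:A]mulr1.
by split=> -[df D]; (split; [move: df|move: D]); rewrite /derivable /derive E.
Qed.

Section flat.
Context {R : realType}.
Implicit Types (p : {poly R}) (x : R).

(** The factor p(1/x) makes this class of functions stable under derivation,
    which exp(-1/x) alone is not. *)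
Definition flat p x : R := if 0 < x then p.[x^-1] * expR (- x^-1) else 0.

(** The exponential beats all powers of 1/x. The exponent 2 is the one that gives
    a derivative at 0. *)
Lemma flat_bound p : exists2 C : R, 0 <= C & forall x, `|flat p x| <= C * x ^+ 2.
Proof.
exists (\sum_(i < size p) `|p`_i| * (i.+2)`!%:R).
  by apply: sumr_ge0 => i _; rewrite mulr_ge0.
move=> x; rewrite /flat; case: ifPn => x0; last first.
  by rewrite normr0 mulr_ge0 ?sqr_ge0// sumr_ge0// => i _; rewrite mulr_ge0.
rewrite normrM (ger0_norm (expR_ge0 _)) expRN ler_pdivrMr ?expR_gt0//.
rewrite horner_coef (le_trans (ler_norm_sum _ _ _))// mulr_suml mulr_suml.
apply: ler_sum => i _; rewrite normrM -!(mulrA `|_|) ler_wpM2l//.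
have xV0 : 0 < x^-1 by rewrite invr_gt0.
have := expR_ge1Dxn i.+1 (ltW xV0).
rewrite addrC -lerBrDr => H.
have {}H : x^-1 ^+ i.+2 / (i.+2)`!%:R <= expR x^-1.
  by apply: (le_trans H); rewrite gerBl.
rewrite ger0_norm ?exprn_ge0 ?(ltW xV0)//.
move: H; rewrite ler_pdivrMr ?ltr0n ?fact_gt0// => H.
rewrite [leLHS](_ : _ = x ^+ 2 * x^-1 ^+ i.+2); last first.
  by rewrite -(addn2 i) exprD mulrCA -exprMn mulfV ?gt_eqF// expr1n mulr1.
rewrite [leRHS](_ : _ = x ^+ 2 * (expR x^-1 * (i.+2)`!%:R)); last by ring.
by rewrite ler_wpM2l ?sqr_ge0.
Qed.

Lemma is_derive_flat p x :
  is_derive x 1 (flat p) (flat ('X ^+ 2 * (p^`() * -1 + p))%R x).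
Proof.
have [x0|x0|->] := ltgtP x 0.
- rewrite [X in is_derive _ _ _ X](_ : _ = 0); last by rewrite /flat ltNge (ltW x0).
  apply: (@near_eq_is_derive _ _ _ (cst 0)).
  have : nbhs x [set y : R | y < 0] by apply: open_nbhs_nbhs; split => //; exact: open_lt.
  by apply: filterS => y /= y0; rewrite /flat /cst ltNge (ltW y0).
- have xn0 : x != 0 by rewrite gt_eqF.
  have iv : is_derive x 1 (fun y : R => y^-1) (- x ^- 2).
    apply: DeriveDef; first exact: derivableV.
    by rewrite deriveV// derive_id scaleNr [_ *: _]mulr1.
  have e1 := is_derive1_comp (is_derive_poly p x^-1) iv.
  have e2 := @is_derive1_comp _ expR (fun y => - y^-1) _ _ _ (is_derive_expR (- x^-1)) (is_deriveN iv).
  have e3 : is_derive x 1 (fun y => p.[y^-1] * expR (- y^-1)) (flat ('X ^+ 2 * (p^`() * -1 + p)) x).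
    refine (is_derive_eq (is_deriveM e1 e2 : is_derive x 1 (fun y => p.[y^-1] * expR (- y^-1)) _) _).
    rewrite /flat x0 !hornerE /= -!exprVn.
    by rewrite /GRing.scale/=; ring.
  apply: near_eq_is_derive e3.
  have : nbhs x [set y : R | 0 < y] by apply: open_nbhs_nbhs; split => //; exact: open_gt.
  by apply: filterS => y /= y0; rewrite /flat y0.
- have [C C0 HC] := flat_bound p.
  rewrite [X in is_derive _ _ _ X](_ : _ = 0); last by rewrite /flat ltxx.
  have H : (fun h => h^-1 *: ((flat p \o shift 0) (h *: 1) - flat p 0)) @ 0^' --> (0 : R).
    apply/cvgrPdist_lt => e e0; near=> h.
    have h0 : h != 0 by near: h; exact: nbhs_dnbhs_neq.
    have f0 : flat p 0 = 0 by rewrite /flat ltxx.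
    rewrite /= addr0 f0 subr0 [_ *: 1]mulr1 sub0r normrN normrM normfV.
    rewrite ltr_pdivrMl ?normr_gt0// (le_lt_trans (HC h))//.
    rewrite -real_normK ?num_real// expr2 mulrA mulrC ltr_pM2l ?normr_gt0//.
    rewrite (@le_lt_trans _ _ ((C + 1) * `|h|)) ?ler_wpM2r ?lerDl//.
    rewrite -ltr_pdivlMl ?ltr_wpDl//.
    near: h; apply: dnbhs0_lt; rewrite mulr_gt0 ?invr_gt0 ?ltr_wpDl//.
  by apply: DeriveDef; [apply/cvg_ex; exists 0|exact/cvg_lim].
Unshelve. all: by end_near. Qed.

Definition theta : R -> R := flat 1.

Lemma theta_ge0 x : 0 <= theta x.
Proof. by rewrite /theta /flat; case: ifP => // _; rewrite hornerC mul1r expR_ge0. Qed.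

Lemma theta_le1 x : theta x <= 1.
Proof.
rewrite /theta /flat; case: ifPn => // x0.
by rewrite hornerC mul1r -expR0 ler_expR oppr_le0 invr_ge0 ltW.
Qed.

Lemma theta_eq0 x : x <= 0 -> theta x = 0.
Proof. by move=> x0; rewrite /theta /flat ltNge x0. Qed.

(** Steep copies of theta tend to the indicator of the positive half-line. *)
Lemma theta_cvg1 x : 0 < x -> theta (k.+1%:R * x) @[k --> \oo] --> (1 : R).
Proof.
move=> x0.
have E k : theta (k.+1%:R * x) = expR (- (x^-1 * k.+1%:R^-1)).
  by rewrite /theta /flat mulr_gt0// hornerC mul1r invfM mulrC.
rewrite (_ : (fun k => _) = expR \o (fun k => - (x^-1 * harmonic k))); last first.
  by apply/funext => k; exact: E.
rewrite -expR0; apply: continuous_cvg; first exact: continuous_expR.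
rewrite -oppr0 -(mulr0 x^-1); apply: cvgN; apply: cvgMr.
exact: cvg_harmonic.
Qed.

(** A class given by syntax: that all derivatives exist follows from its stability
    under derivation, without handling iterated derivatives. *)
Inductive smooth1 : (R -> R) -> Prop :=
| smooth1_flat p a b : smooth1 (fun t => flat p (a * t + b))
| smooth1_add f g : smooth1 f -> smooth1 g -> smooth1 (fun t => f t + g t)
| smooth1_mul f g : smooth1 f -> smooth1 g -> smooth1 (fun t => f t * g t)
| smooth1_cst c : smooth1 (fun=> c).

Lemma smooth1_derive f : smooth1 f ->
  exists2 g, smooth1 g & forall x, is_derive x 1 f (g x).
Proof.
elim=> {f} [p a b|f g _ [f' sf' df] _ [g' sg' dg]|f g sf [f' sf' df] sg [g' sg' dg]|c].
- exists (fun t => flat ('X ^+ 2 * (p^`() * -1 + p))%R (a * t + b) * a).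
    by apply: smooth1_mul; [exact: smooth1_flat|exact: smooth1_cst].
  move=> x.
  have h : is_derive x (1 : R) (fun t => a * t + b) a.
    refine (is_derive_eq (is_deriveD (is_deriveZ a (is_derive_id x (1 : R)))
      (is_derive_cst b x (1 : R)) : is_derive x (1 : R) (fun t => a * t + b) _) _).
    by rewrite addr0 [_ *: _]mulr1.
  exact (@is_derive1_comp R (flat p) (fun t => a * t + b) x _ _ (is_derive_flat p (a * x + b)) h).
- exists (fun t => f' t + g' t); first exact: smooth1_add.
  by move=> x; exact: is_deriveD.
- exists (fun t => f t * g' t + g t * f' t).
    by apply: smooth1_add; exact: smooth1_mul.
  by move=> x; exact: is_deriveM.
- exists (fun=> 0); first exact: smooth1_cst.
  by move=> x; exact: is_derive_cst.
Qed.

Lemma is_derive1_continuous (f : R -> R) g : (forall x, is_derive x 1 f (g x)) ->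
  continuous f.
Proof.
by move=> df x; apply/differentiable_continuous/derivable1_diffP; have [] := df x.
Qed.

Lemma smooth1_continuous f : smooth1 f -> continuous f.
Proof. by move=> /smooth1_derive[g _]; exact: is_derive1_continuous. Qed.

End flat.

Section smoothn.
Context {R : realType} {n : nat}.
Implicit Types (f g : 'rV[R]_n -> R).

(** Composition is with a primitive h of a function of [smooth1], as cutoffs are
    obtained by integrating bumps. *)
Inductive smooth_alg : ('rV[R]_n -> R) -> Prop :=
| smooth_alg_coord i : smooth_alg (fun x => x 0 i)
| smooth_alg_cst c : smooth_alg (fun=> c)
| smooth_alg_add f g : smooth_alg f -> smooth_alg g -> smooth_alg (fun x => f x + g x)
| smooth_alg_mul f g : smooth_alg f -> smooth_alg g -> smooth_alg (fun x => f x * g x)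
| smooth_alg_comp (h h' : R -> R) f : smooth1 h' -> (forall t : R, is_derive t 1 h (h' t)) ->
    smooth_alg f -> smooth_alg (fun x => h (f x)).

Lemma smooth_alg_comp1 h f : smooth1 h -> smooth_alg f -> smooth_alg (fun x => h (f x)).
Proof. by move=> /smooth1_derive[h' sh' dh] sf; exact: smooth_alg_comp dh sf. Qed.

Lemma is_derive_compn (h : R -> R) f x v a b :
  is_derive (f x) 1 h a -> is_derive x v f b -> is_derive x v (fun y => h (f y)) (a * b).
Proof.
move=> dh /is_derive_line df; apply/is_derive_line.
by apply: (is_derive1_comp (f := h) _ df); rewrite scale0r add0r.
Qed.

Lemma is_derive_coord (x : 'rV[R]_n) v i : is_derive x v (fun y : 'rV[R]_n => y 0 i) (v 0 i).
Proof.
apply/is_derive_line.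
have -> : (fun h : R => (h *: v + x) 0 i) = (fun h => v 0 i * h + x 0 i).
  by apply/funext => h; rewrite !mxE mulrC.
refine (is_derive_eq (is_deriveD (is_deriveZ (v 0 i) (is_derive_id (0 : R) (1 : R)))
  (is_derive_cst (x 0 i) (0 : R) (1 : R)) : is_derive (0 : R) (1 : R) (fun t => v 0 i * t + x 0 i) _) _).
by rewrite addr0 [_ *: _]mulr1.
Qed.

Lemma smooth_alg_derive f v : smooth_alg f ->
  exists2 g, smooth_alg g & forall x, is_derive x v f (g x).
Proof.
elim=> {f} [i|c|f g _ [f' sf' df] _ [g' sg' dg]|f g sf [f' sf' df] sg [g' sg' dg]
  |h h' f sh' dh sf [f' sf' df]].
- exists (fun=> v 0 i); first exact: smooth_alg_cst.
  by move=> x; exact: is_derive_coord.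
- exists (fun=> 0); first exact: smooth_alg_cst.
  by move=> x; exact: is_derive_cst.
- exists (fun t => f' t + g' t); first exact: smooth_alg_add.
  by move=> x; exact: is_deriveD.
- exists (fun t => f t * g' t + g t * f' t).
    by apply: smooth_alg_add; exact: smooth_alg_mul.
  by move=> x; exact: is_deriveM.
- exists (fun x => h' (f x) * f' x).
    by apply: smooth_alg_mul => //; exact: smooth_alg_comp1.
  by move=> x; exact: is_derive_compn.
Qed.

Lemma smooth_alg_continuous f : smooth_alg f -> continuous f.
Proof.
elim=> {f} [i|c|f g _ cf _ cg|f g _ cf _ cg|h h' f _ dh _ cf] x.
- exact: coord_continuous.
- exact: cst_continuous.
- exact: (cvgD (cf x) (cg x)).
- exact: (cvgM (cf x) (cg x)).
- by apply: (continuous_comp (cf x)); exact: (is_derive1_continuous dh).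
Qed.

Lemma smooth_algP f : smooth_alg f -> smooth f.
Proof.
move=> sf s /=.
suff : smooth_alg (foldr partial f s).
  move=> sg; split; first exact: smooth_alg_continuous.
  by move=> j x; have [g _ dg] := smooth_alg_derive (delta_mx 0 j) sg; have [] := dg x.
elim: s => //= j s /(smooth_alg_derive (delta_mx 0 j))[g sg dg].
suff -> : partial j (foldr partial f s) = g by [].
by apply/funext => x; have [_ <-] := dg x.
Qed.

End smoothn.

(** * Continuous functions of compact support *)

Section compactly_supported.
Context {R : realType} {n : nat}.
Local Notation mu := (@lebesgue_rV R n).
Implicit Types (f g : 'rV[R]_n -> R) (x v z : 'rV[R]_n).

Definition C0c f := continuous f /\ exists M : R, forall x, M <= `|x| -> f x = 0.

Definition C1c f := C0c f /\
  forall j, (forall x, derivable f x (delta_mx 0 j)) /\ C0c (partial j f).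

Lemma C0c_continuous f : C0c f -> continuous f. Proof. by case. Qed.

Lemma C0c_measurable f : C0c f -> measurable_fun setT f.
Proof. by move=> [cf _]; exact: continuous_rV_measurable. Qed.

Lemma C0c_bounded f : C0c f -> exists2 B : R, 0 < B & forall x, `|f x| <= B.
Proof.
move=> [cf [M fM]].
pose K : set 'rV[R]_n := [set x | `|x| <= M].
have cK : compact K.
  apply: bounded_closed_compact.
    by exists M; split; [exact: num_real|move=> y My x /= xM; exact: le_trans xM (ltW My)].
  apply: (@closed_comp _ _ (fun x : 'rV[R]_n => `|x|) [set y | y <= M]).
    by move=> x _; exact: norm_continuous.
  exact: closed_le.
have /compact_bounded/bounded_setP[B B0 fB] : compact (f @` K).
  by apply: continuous_compact => //; exact: continuous_subspaceT.
exists B => // x; have [xM|xM] := leP `|x| M.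
  by apply/ltW/fB; exists x.
by rewrite fM ?normr0; apply: ltW.
Qed.

Lemma measurable_norm_ball (M : R) : measurable [set x : 'rV[R]_n | `|x| < M].
Proof.
apply: open_rV_measurable.
apply: (@open_comp _ _ (fun x : 'rV[R]_n => `|x|) [set y | y < M]).
  by move=> x _; exact: norm_continuous.
exact: open_lt.
Qed.

Lemma lebesgue_norm_ball (M : R) : (mu [set x : 'rV[R]_n | (`|x| < M)%R] < +oo)%E.
Proof.
apply: lebesgue_bounded_lty; first exact: measurable_norm_ball.
exists M; split; [exact: num_real|move=> y My x /= xM].
by apply: ltW; exact: lt_trans xM My.
Qed.

Lemma bounded_supp_integrable f (M B : R) : measurable_fun setT f ->
  (forall x, M <= `|x| -> f x = 0) -> (forall x, `|f x| <= B) ->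
  mu.-integrable setT (EFin \o f).
Proof.
move=> mf fM fB.
have -> : EFin \o f = (EFin \o f) \_ [set x | `|x| < M].
  apply/funext => x; rewrite patchE /=; case: ifPn => //.
  by rewrite notin_setE /= => /negP; rewrite -leNgt => /fM ->.
apply: (integrable_mkcond _ (measurable_norm_ball M)).1.
apply: measurable_bounded_integrable; first exact: measurable_norm_ball.
- exact: lebesgue_norm_ball.
- exact: measurable_funTS.
- exists B; split; first exact: num_real.
  by move=> y By x _ /=; exact: le_trans (fB x) (ltW By).
Qed.

Lemma C0c_integrable f : C0c f -> mu.-integrable setT (EFin \o f).
Proof.
move=> cf; have [B _ fB] := C0c_bounded cf; have [_ [M fM]] := cf.
by apply: (bounded_supp_integrable _ fM fB); exact: C0c_measurable.
Qed.

Lemma C0cD f g : C0c f -> C0c g -> C0c (fun x => f x + g x).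
Proof.
move=> [cf [M fM]] [cg [N gN]]; split; first by move=> x; exact: (cvgD (cf x) (cg x)).
by exists (Num.max M N) => x; rewrite ge_max => /andP[/fM-> /gN->]; rewrite addr0.
Qed.

Lemma C0cMl f g : continuous f -> C0c g -> C0c (fun x => f x * g x).
Proof.
move=> cf [cg [N gN]]; split; first by move=> x; exact: (cvgM (cf x) (cg x)).
by exists N => x /gN->; rewrite mulr0.
Qed.

Lemma C0cZ (c : R) g : C0c g -> C0c (fun x => c * g x).
Proof. by move=> cg; apply: (@C0cMl (fun=> c)) cg; exact: cst_continuous. Qed.

Lemma C0c_translate v f : C0c f -> C0c (fun x => f (x + v)).
Proof.
move=> [cf [M fM]]; split.
  move=> x; apply: (@continuous_comp _ _ _ (fun x => x + v) f); last exact: cf.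
  by apply: continuousD; [exact: cvg_id|exact: cst_continuous].
exists (M + `|v|) => x xM; apply: fM.
by have := ler_normB (x + v) v; rewrite addrK; lra.
Qed.

Lemma C0cB f g : C0c f -> C0c g -> C0c (fun x => f x - g x).
Proof.
move=> cf /(C0cZ (-1)) cg; have := C0cD cf cg.
by under eq_fun do rewrite mulN1r.
Qed.

Lemma C1cM f g : C1c f -> C1c g -> C1c (fun x => f x * g x) /\
  forall j x, partial j (fun x => f x * g x) x = f x * partial j g x + g x * partial j f x.
Proof.
move=> [cf df] [cg dg].
have E j x : partial j (fun x => f x * g x) x = f x * partial j g x + g x * partial j f x.
  by rewrite /partial (@deriveM _ _ f g)//; [exact: (df j).1|exact: (dg j).1].
split=> //; split; first by apply: C0cMl => //; exact: cf.1.
move=> j; split.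
  by move=> x; apply: (@derivableM _ _ f g); [exact: (df j).1|exact: (dg j).1].
rewrite (_ : partial j _ = fun x => f x * partial j g x + g x * partial j f x); last first.
  by apply/funext => x.
by apply: C0cD; apply: C0cMl; [exact: cf.1|exact: (dg j).2|exact: cg.1|exact: (df j).2].
Qed.

End compactly_supported.

(** * Calculus along lines *)

Section line.
Context {R : realType} {n : nat}.
Local Notation mu := (@lebesgue_rV R n).
Local Notation leb := (@lebesgue_measure R).
Implicit Types (f g : 'rV[R]_n -> R) (x v z : 'rV[R]_n).

Lemma measurable_shift (v : 'rV[R]_n) :
  measurable_fun setT (fun p : measurableTypeR R * 'rV[R]_n => (p.1 : R) *: v + p.2).
Proof.
apply: measurable_fun_rV => i.
under eq_fun do rewrite !mxE.
apply: measurable_funD.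
  by apply: measurable_funM; [exact: measurable_fst|exact: measurable_cst].
exact: (measurableT_comp (measurable_rV_coord i) measurable_snd).
Qed.

Let shiftF t v (h : 'rV[R]_n -> \bar R) (p : measurableTypeR R * 'rV[R]_n) : \bar R :=
  ((\1_(`[0, t]%classic : set R) (p.1 : R))%:E * h ((p.1 : R) *: v + p.2)%R)%E.

Let measurable_shiftF t v h : measurable_fun setT h -> measurable_fun setT (shiftF t v h).
Proof.
move=> mh; apply: emeasurable_funM.
  apply/measurable_EFinP.
  have m1 : measurable_fun [set: measurableTypeR R] (\1_(`[0, t]%classic : set R) : R -> R).
    exact: measurable_indic.
  exact: (measurableT_comp m1 measurable_fst).
exact: (measurableT_comp mh (measurable_shift v)).
Qed.

Let shiftF_ge0 t v h p : (forall x, 0 <= h x)%E -> (0 <= shiftF t v h p)%E.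
Proof. by move=> h0; rewrite mule_ge0// lee_fin. Qed.

Let shiftFE t v h x :
  (\int[leb]_(s in `[0%R, t]) h (s *: v + x)%R = \int[leb]_s shiftF t v h (s, x))%E.
Proof.
rewrite integral_mkcond; apply: eq_integral => s _.
by rewrite /shiftF patchE indicE; case: ifP => _; rewrite ?mul1e ?mul0e.
Qed.

Lemma measurable_line_integral t v (h : 'rV[R]_n -> \bar R) :
  measurable_fun setT h -> (forall x, 0 <= h x)%E ->
  measurable_fun setT (fun x => \int[leb]_(s in `[0%R, t]) h (s *: v + x)%R)%E.
Proof.
move=> mh h0; under eq_fun do rewrite shiftFE.
by apply: measurable_fun_fubini_tonelli_G; [exact: measurable_shiftF|move=> p; exact: shiftF_ge0].
Qed.

(** All translates of h have the same integral, so averaging them over a segment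
    of length t multiplies the integral by t. *)
Lemma tonelli_line t v (h : 'rV[R]_n -> \bar R) : 0 < t ->
  measurable_fun setT h -> (forall x, 0 <= h x)%E ->
  (\int[mu]_x \int[leb]_(s in `[0%R, t]) h (s *: v + x)%R = t%:E * \int[mu]_x h x)%E.
Proof.
move=> t0 mh h0; under eq_integral do rewrite shiftFE.
rewrite -(fubini_tonelli (m1 := leb) (m2 := mu) (shiftF t v h)); last 2 first.
- exact: measurable_shiftF.
- by move=> p; exact: shiftF_ge0.
transitivity (\int[leb]_s ((\1_(`[0, t]%classic : set R) s)%:E * \int[mu]_x h x))%E.
  apply: eq_integral => s _; rewrite /shiftF /= ge0_integralZl//.
  - congr (_ * _)%E; rewrite -[RHS](ge0_integral_translate (s *: v))//.
    by apply: eq_integral => x _; rewrite addrC.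
  - have -> : (fun x : 'rV[R]_n => h (s *: v + x)) = h \o (fun x => x + s *: v).
      by apply/funext => x; rewrite /= addrC.
    exact: (measurableT_comp mh (measurable_translate _)).
rewrite ge0_integralZr//; last exact: integral_ge0.
  rewrite integral_indic// setIT; congr (_ * _)%E.
  have : leb (`[0, t]%classic : set R) = t%:E.
    by rewrite lebesgue_measure_itv/= lte_fin t0 -EFinB subr0.
  by [].
by apply/measurable_EFinP; exact: measurable_indic.
Qed.

End line.

(** A quadratic polynomial in c without sign change. If V = 0 the linear term
    must vanish, as the value at c = (S + 1) / I shows. *)
Lemma discriminant_le (R : realFieldType) (S I V : R) :
  (forall c, 0 <= S - 2 * c * I + c ^+ 2 * V) -> 0 <= V -> I ^+ 2 <= V * S.
Proof.
move=> H; rewrite le_eqVlt => /predU1P[V0|V0].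
  rewrite -V0 mul0r; have [->|I0] := eqVneq I 0; first by rewrite expr0n.
  have S0 := H 0; have := H ((S + 1) / I); rewrite -V0 !mulr0 !addr0.
  rewrite (_ : S - _ = S - 2 * (S + 1)); last by field.
  by move: S0; rewrite !mulr0 mul0r subr0 expr0n mul0r addr0; lra.
have := H (I / V); rewrite (_ : S - _ + _ = S - I ^+ 2 / V); last by field; lra.
by rewrite subr_ge0 ler_pdivrMr// mulrC.
Qed.

Lemma sqr_sum_le (R : realFieldType) n (a : 'I_n -> R) :
  (\sum_j a j) ^+ 2 <= n%:R * \sum_j a j ^+ 2.
Proof.
apply: discriminant_le => // c.
have -> : \sum_j a j ^+ 2 - 2 * c * \sum_j a j + c ^+ 2 * n%:R = \sum_j (a j - c) ^+ 2.
  transitivity (\sum_j (a j ^+ 2 - 2 * c * a j + c ^+ 2)); last first.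
    by apply: eq_bigr => j _; ring.
  by rewrite big_split/= sumrB -mulr_sumr sumr_const card_ord mulr_natr.
by apply: sumr_ge0 => j _; exact: sqr_ge0.
Qed.

Section jensen.
Context d (T : measurableType d) (R : realType) (mu : {measure set T -> \bar R}).
Variables (D : set T) (mD : measurable D) (g : T -> R).
Hypothesis finD : (mu D < +oo)%E.
Hypothesis ig : mu.-integrable D (EFin \o g).
Hypothesis ig2 : mu.-integrable D (EFin \o (fun x => g x ^+ 2)).

Let integrable_linear c : mu.-integrable D (EFin \o (fun x => g x ^+ 2 - 2 * c * g x)).
Proof.
have i2 := integrableZl mD (2 * c) ig.
by have := integrableB mD ig2 i2; apply: eq_integrable.
Qed.

Lemma integrable_cst (c : R) : mu.-integrable D (EFin \o (fun=> c)).
Proof.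
apply: measurable_bounded_integrable => //.
by exists `|c|; split; [exact: num_real|move=> y /ltW cy z _].
Qed.

Lemma integrable_sqrB (c : R) : mu.-integrable D (EFin \o (fun x => (g x - c) ^+ 2)).
Proof.
have := integrableD mD (integrable_linear c) (integrable_cst (c ^+ 2)).
by apply: eq_integrable => // x _; congr EFin; rewrite /=; ring.
Qed.

Lemma Rintegral_sqrB (c : R) : \int[mu]_(x in D) (g x - c) ^+ 2 =
  \int[mu]_(x in D) (g x ^+ 2) - 2 * c * \int[mu]_(x in D) g x + c ^+ 2 * fine (mu D).
Proof.
have i2 : mu.-integrable D (EFin \o (fun x => 2 * c * g x)).
  by have := integrableZl mD (2 * c) ig; apply: eq_integrable.
rewrite -RintegralZl// -RintegralB// -Rintegral_cst// -RintegralD//; last exact: integrable_cst.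
by apply: eq_Rintegral => x _; ring.
Qed.

Lemma sqr_Rintegral_le :
  (\int[mu]_(x in D) g x) ^+ 2 <= fine (mu D) * \int[mu]_(x in D) (g x ^+ 2).
Proof.
apply: discriminant_le; last exact: fine_ge0.
by move=> c; rewrite -Rintegral_sqrB; apply: Rintegral_ge0 => x _; exact: sqr_ge0.
Qed.

End jensen.

Section integrals.
Context {dT : measure_display} {T : measurableType dT} {R : realType}.
Variables (mu : {measure set T -> \bar R}) (D : set T) (mD : measurable D).

Lemma Rintegral_eq0 (f : T -> R) : (forall x, D x -> f x = 0) -> \int[mu]_(x in D) f x = 0.
Proof.
move=> f0; rewrite (@eq_Rintegral _ _ _ mu D (fun=> 0)) ?Rintegral_cst ?mul0r// => x.
by rewrite inE => /f0.
Qed.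

Lemma Rintegral_sum (I : Type) (s : seq I) (F : I -> T -> R) :
  (forall i, mu.-integrable D (EFin \o F i)) ->
  mu.-integrable D (EFin \o (fun x => \sum_(i <- s) F i x)) /\
  \int[mu]_(x in D) (\sum_(i <- s) F i x) = \sum_(i <- s) \int[mu]_(x in D) F i x.
Proof.
move=> iF; elim: s => [|i s [IH1 IH2]].
  under [X in EFin \o X]eq_fun do rewrite big_nil.
  under eq_Rintegral do rewrite big_nil.
  by rewrite big_nil Rintegral_cst// mul0r; split=> //; exact: integrable0.
under [X in EFin \o X]eq_fun do rewrite big_cons.
under eq_Rintegral do rewrite big_cons.
split; first by have := integrableD mD (iF i) IH1; apply: eq_integrable.
by rewrite RintegralD// IH2 big_cons.
Qed.

Lemma Rintegral_indic (c : R) (A : set T) : measurable A -> A `<=` D -> (mu A < +oo)%E ->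
  mu.-integrable D (EFin \o (fun x => c * \1_A x)) /\
  \int[mu]_(x in D) (c * \1_A x) = c * fine (mu A).
Proof.
move=> mA AD foo.
have i1 : mu.-integrable D (EFin \o (fun x => \1_A x)).
  apply/integrableP; split; first exact/measurable_EFinP/measurable_indic.
  under eq_integral do rewrite /= ger0_norm//.
  by rewrite integral_indic// setIidl.
split; first by have := integrableZl mD c i1; apply: eq_integrable.
by rewrite RintegralZl// /Rintegral integral_indic// setIidl.
Qed.

End integrals.

Section line_calculus.
Context {R : realType} {n : nat}.
Local Notation mu := (@lebesgue_rV R n).
Local Notation leb := (@lebesgue_measure R).
Implicit Types (f g : 'rV[R]_n -> R) (x v z : 'rV[R]_n).

Lemma line_continuous v x : continuous (fun s : R => s *: v + x).
Proof.
move=> s; apply: (@continuousD _ _ _ (fun s : R => s *: v) (fun=> x)); last exact: cst_continuous.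
exact: scalel_continuous.
Qed.

Lemma continuous_on_line g v x : continuous g -> continuous (fun s : R => g (s *: v + x)).
Proof.
move=> cg s; apply: (@continuous_comp _ _ _ (fun s : R => s *: v + x) g).
  exact: line_continuous.
exact: cg.
Qed.

Lemma is_derive_on_line f g v x : (forall x, is_derive x v f (g x)) ->
  forall s : R, is_derive s (1 : R) (fun s : R => f (s *: v + x)) (g (s *: v + x)).
Proof.
move=> df s; apply/is_derive_line.
have /is_derive_line := df (s *: v + x).
rewrite (_ : (fun h : R => f (h *: v + (s *: v + x))) =
  (fun h : R => f ((h *: 1 + s) *: v + x)))//.
by apply/funext => h; rewrite [h *: 1]mulr1 scalerDl addrA.
Qed.

Lemma ftc_line f g v x t : 0 < t -> (forall x, is_derive x v f (g x)) ->
  continuous g ->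
  (\int[leb]_(s in `[0%R, t]) (g (s *: v + x)%R)%:E = (f (t *: v + x) - f x)%R%:E)%E.
Proof.
move=> t0 df cg.
have dF := is_derive_on_line x df.
have cF := is_derive1_continuous dF.
rewrite (@continuous_FTC2 _ (fun s => g (s *: v + x)) (fun s => f (s *: v + x)))//.
- by rewrite scale0r add0r -EFinB.
- by apply: continuous_subspaceT; exact: continuous_on_line.
- split; first by move=> s _; have [] := dF s.
  + exact: cvg_at_right_filter (cF 0).
  + exact: cvg_at_left_filter (cF t).
- by move=> s _; rewrite derive1E; have [_ ->] := dF s.
Qed.

(** The fundamental theorem of calculus, then Cauchy-Schwarz on the segment. *)
Lemma line_sqr_le f g v x t : 0 < t -> (forall x, is_derive x v f (g x)) ->
  continuous g ->
  (((f (t *: v + x) - f x) ^+ 2)%:E <=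
   t%:E * \int[leb]_(s in `[0%R, t]) (g (s *: v + x)%R ^+ 2)%:E)%E.
Proof.
move=> t0 df cg.
have cgx : continuous (fun s : R => g (s *: v + x)).
  exact: continuous_on_line.
have cgx2 : continuous (fun s : R => g (s *: v + x) ^+ 2).
  by move=> s; exact: (cvgM (cgx s) (cgx s)).
have mt : leb (`[0, t]%classic : set R) = t%:E.
  by rewrite lebesgue_measure_itv/= lte_fin t0 -EFinB subr0.
have ig : leb.-integrable (`[0, t]%classic : set R) (EFin \o (fun s : R => g (s *: v + x))).
  by apply: continuous_compact_integrable; [exact: segment_compact|exact: continuous_subspaceT].
have ig2 : leb.-integrable (`[0, t]%classic : set R) (EFin \o (fun s : R => g (s *: v + x) ^+ 2)).
  by apply: continuous_compact_integrable; [exact: segment_compact|exact: continuous_subspaceT].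
have fD : (leb (`[0%R, t]%classic : set R) < +oo)%E by rewrite mt ltry.
have H := @sqr_Rintegral_le _ _ _ leb `[0, t]%classic (measurable_itv _) _ fD ig ig2.
have E1 : \int[leb]_(s in `[0, t]) g (s *: v + x) = f (t *: v + x) - f x.
  by rewrite /Rintegral (ftc_line _ t0 df cg).
rewrite E1 in H.
rewrite (_ : fine _ = t) in H; last exact: (congr1 fine mt).
by rewrite -(fineK (integrable_fin_num _ ig2)).
Qed.

End line_calculus.

(** * Integration by parts and translations *)

Section translations.
Context {R : realType} {n : nat}.
Local Notation mu := (@lebesgue_rV R n).
Local Notation leb := (@lebesgue_measure R).
Local Notation e_ j := (delta_mx 0 j : 'rV[R]_n).
Implicit Types (f g : 'rV[R]_n -> R) (x v z : 'rV[R]_n).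

Lemma C1c_is_derive f j : C1c f -> forall x, is_derive x (e_ j) f (partial j f x).
Proof. by move=> [_ df] x; apply: derivableP; exact: (df j).1. Qed.

Lemma C0c_sqr f : C0c f -> C0c (fun x => f x ^+ 2).
Proof. by move=> cf; exact: C0cMl (C0c_continuous cf) cf. Qed.

Lemma C0c_EFin_Rintegral f : C0c f ->
  (\int[mu]_x (f x)%:E = (\int[mu]_x f x)%:E)%E.
Proof. by move=> /C0c_integrable/integrable_fin_num/fineK <-. Qed.

Lemma Rintegral_translate v f : C0c f -> \int[mu]_x f (x + v) = \int[mu]_x f x.
Proof.
move=> cf; rewrite /Rintegral.
rewrite -(integral_translate v (f := EFin \o f))//.
by apply/measurable_EFinP; exact: C0c_measurable.
Qed.

(** The increment f (x + e_j) - f x has integral 0 by translation invariance, and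
    it is the integral of the partial derivative along a segment. Tonelli then
    applies to the positive and negative parts. *)
Lemma Rintegral_partial_eq0 f j : C1c f -> \int[mu]_x partial j f x = 0.
Proof.
move=> cf; have [cf0 /(_ j)[_ cg]] := cf.
pose g := partial j f.
pose G x := (g x)%:E.
have mG : measurable_fun setT G by apply/measurable_EFinP; exact: C0c_measurable.
have iG : mu.-integrable setT G by exact: C0c_integrable.
pose A h x := (\int[leb]_(s in `[0%R, 1%R]) h (s *: e_ j + x)%R)%E.
have AE x : ((f (x + e_ j) - f x)%:E = A (G^\+)%E x - A (G^\-)%E x)%E.
  have := ftc_line x ltr01 (C1c_is_derive j cf) (C0c_continuous cg).
  rewrite scale1r (addrC (e_ j) x) => <-; rewrite integralE /A.
  by congr (_ - _)%E; apply: eq_integral => s _; rewrite ?funeposE ?funenegE.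
have Apos : (\int[mu]_x A (G^\+)%E x = \int[mu]_x (G^\+)%E x)%E.
  by rewrite tonelli_line// ?mul1e//; exact: measurable_funepos.
have Aneg : (\int[mu]_x A (G^\-)%E x = \int[mu]_x (G^\-)%E x)%E.
  by rewrite tonelli_line// ?mul1e//; exact: measurable_funeneg.
have H0 : (\int[mu]_x (f (x + e_ j) - f x)%:E = 0)%E.
  rewrite C0c_EFin_Rintegral; last by apply: C0cB => //; exact: C0c_translate.
  rewrite RintegralB//; [|exact/C0c_integrable/C0c_translate|exact: C0c_integrable].
  by rewrite Rintegral_translate// subrr.
change (fine (\int[mu]_x G x)%E = 0); rewrite integralE -Apos -Aneg.
rewrite -integralB//.
- rewrite -[RHS]/(fine 0%E) -H0; congr fine.
  by apply: eq_integral => x _; rewrite AE.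
- apply/integrableP; split.
    by apply: measurable_line_integral => //; exact: measurable_funepos.
  under eq_integral do rewrite gee0_abs ?integral_ge0//.
  by rewrite Apos; exact: integrable_lty (integrable_funepos _ iG).
- apply/integrableP; split.
    by apply: measurable_line_integral => //; exact: measurable_funeneg.
  under eq_integral do rewrite gee0_abs ?integral_ge0//.
  by rewrite Aneg; exact: integrable_lty (integrable_funeneg _ iG).
Qed.

(** The integral of the partial derivative of f * g vanishes. *)
Lemma integration_by_parts_rV f g j : C1c f -> C1c g ->
  \int[mu]_x (f x * partial j g x) = - \int[mu]_x (g x * partial j f x).
Proof.
move=> cf cg; have [cfg E] := C1cM cf cg.
have := Rintegral_partial_eq0 j cfg.
under eq_Rintegral do rewrite E.
rewrite RintegralD//; first by move/eqP; rewrite addr_eq0 => /eqP.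
- by apply: C0c_integrable; apply: C0cMl; [exact: C0c_continuous cf.1|exact: (cg.2 j).2].
- by apply: C0c_integrable; apply: C0cMl; [exact: C0c_continuous cg.1|exact: (cf.2 j).2].
Qed.

Let translate_pos f j t : C1c f -> 0 < t ->
  \int[mu]_x (f (x + t *: e_ j) - f x) ^+ 2 <= t ^+ 2 * \int[mu]_x (partial j f x ^+ 2).
Proof.
move=> cf t0; have [cf0 /(_ j)[_ cg]] := cf.
have c1 : C0c (fun x => (f (x + t *: e_ j) - f x) ^+ 2).
  by apply: C0c_sqr; apply: C0cB => //; exact: C0c_translate.
rewrite -lee_fin EFinM -!C0c_EFin_Rintegral//; last exact: C0c_sqr.
have mg : measurable_fun setT (fun x => (partial j f x ^+ 2)%:E).
  by apply/measurable_EFinP; exact: (C0c_measurable (C0c_sqr cg)).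
have g0 x : (0 <= (partial j f x ^+ 2)%:E)%E by rewrite lee_fin sqr_ge0.
rewrite expr2 EFinM -muleA -(tonelli_line (e_ j) t0 mg)//.
rewrite -ge0_integralZl//.
- apply: ge0_le_integral => //.
  + by move=> x _; rewrite lee_fin sqr_ge0.
  + by apply/measurable_EFinP; exact: (C0c_measurable c1).
  + by apply: measurable_funeM; exact: (measurable_line_integral t (e_ j) mg g0).
  + move=> x _.
    have := line_sqr_le x t0 (C1c_is_derive j cf) (C0c_continuous cg).
    by rewrite (addrC (t *: e_ j) x).
- exact: (measurable_line_integral t (e_ j) mg g0).
- by move=> x _; exact: integral_ge0.
- by rewrite lee_fin ltW.
Qed.

Lemma translate_dir f j t : C1c f ->
  \int[mu]_x (f (x + t *: e_ j) - f x) ^+ 2 <= t ^+ 2 * \int[mu]_x (partial j f x ^+ 2).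
Proof.
move=> cf; have [t0|t0|->] := ltgtP t 0; [|exact: translate_pos|].
- have c1 : C0c (fun x => (f (x + t *: e_ j) - f x) ^+ 2).
    apply: C0c_sqr; apply: C0cB; last exact: cf.1.
    by apply: C0c_translate; exact: cf.1.
  rewrite -(Rintegral_translate (- t *: e_ j) c1).
  have -> : \int[mu]_x (f (x + - t *: e_ j + t *: e_ j) - f (x + - t *: e_ j)) ^+ 2 =
      \int[mu]_x (f (x + - t *: e_ j) - f x) ^+ 2.
    apply: eq_Rintegral => x _.
    by rewrite scaleNr addrNK -sqrrN opprB.
  by rewrite -(sqrrN t); apply: translate_pos; rewrite ?oppr_gt0.
- by rewrite expr0n mul0r Rintegral_eq0// => x _; rewrite scale0r addr0 subrr expr0n.
Qed.

Lemma C0c_sum (I : Type) (s : seq I) (F : I -> 'rV[R]_n -> R) :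
  (forall i, C0c (F i)) -> C0c (fun x => \sum_(i <- s) F i x).
Proof.
move=> cF; elim: s => [|i s IH].
  under eq_fun do rewrite big_nil.
  by split; [exact: cst_continuous|exists 0].
by under eq_fun do rewrite big_cons; exact: C0cD.
Qed.

(** The increment along z is a sum of n increments along the axes, each of them
    controlled by one partial derivative; squaring the sum costs the factor n. *)
Lemma translation_estimate f z : C1c f ->
  \int[mu]_x (f (x + z) - f x) ^+ 2 <=
  n%:R * \sum_j z 0 j ^+ 2 * \int[mu]_x (partial j f x ^+ 2).
Proof.
move=> cf; have cf0 := cf.1.
(* p k keeps the first k coordinates of z: a path from 0 to z along the axes *)
pose p (k : nat) : 'rV[R]_n := \row_i if (i < k)%N then z 0 i else 0.
have pS (j : 'I_n) : p j.+1 = p j + z 0 j *: e_ j.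
  apply/rowP => i; rewrite !mxE eqxx/= ltnS leq_eqVlt.
  case: (ltngtP i j) => [ij|ij|/ord_inj ->].
  - have -> : (i == j) = false by apply/negbTE; rewrite -val_eqE/= neq_ltn ij.
    by rewrite mulr0 addr0.
  - have -> : (i == j) = false by apply/negbTE; rewrite -val_eqE/= neq_ltn ij orbT.
    by rewrite mulr0 addr0.
  - by rewrite eqxx mulr1 add0r.
have tele x : f (x + z) - f x = \sum_(j < n) (f (x + p j.+1) - f (x + p j)).
  rewrite -(big_mkord xpredT (fun j => f (x + p j.+1) - f (x + p j))).
  rewrite telescope_sumr//; congr (f _ - f _).
    by congr (_ + _); apply/rowP => i; rewrite mxE ltn_ord.
  by rewrite (_ : p 0%N = 0) ?addr0//; apply/rowP => i; rewrite !mxE.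
have cd (j : 'I_n) : C0c (fun x => (f (x + p j.+1) - f (x + p j)) ^+ 2).
  by apply: C0c_sqr; apply: C0cB; exact: C0c_translate.
apply: (@le_trans _ _ (\int[mu]_x (n%:R * \sum_(j < n) (f (x + p j.+1) - f (x + p j)) ^+ 2))).
  apply: le_Rintegral => //.
  - by apply: C0c_integrable; apply: C0c_sqr; apply: C0cB => //; exact: C0c_translate.
  - by apply: C0c_integrable; apply: C0cZ; exact: C0c_sum.
  - by move=> x _; rewrite tele; exact: sqr_sum_le.
rewrite RintegralZl//; last by apply: C0c_integrable; exact: C0c_sum.
rewrite ler_wpM2l// (Rintegral_sum measurableT _ (fun j => C0c_integrable (cd j))).2.
apply: ler_sum => j _.
apply: le_trans (translate_dir j (z 0 j) cf).
have c1 : C0c (fun x => (f (x + z 0 j *: e_ j) - f x) ^+ 2).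
  by apply: C0c_sqr; apply: C0cB => //; exact: C0c_translate.
rewrite -(Rintegral_translate (p j) c1) le_eqVlt; apply/orP; left; apply/eqP.
by apply: eq_Rintegral => x _; rewrite pS addrA.
Qed.

End translations.

(** * Compactness through averages over small cubes *)

Section cube_averages.
Context {R : realType} {n : nat}.
Local Notation mu := (@lebesgue_rV R n).
Implicit Types (f g : 'rV[R]_n -> R) (x y z a : 'rV[R]_n).

(** The differences of two points of a cube of side h lie in this set. *)
Let C (h : R) : set 'rV[R]_n := cube (const_mx (- h)) (h *+ 2).

Let F f h (p : 'rV[R]_n * 'rV[R]_n) : \bar R :=
  (\1_(C h) p.2 * (f (p.1 + p.2) - f p.1) ^+ 2)%:E.

Let measurable_F f h : continuous f -> measurable_fun setT (F f h).
Proof.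
move=> cf; apply/measurable_EFinP; apply: measurable_funM.
  have m1 : measurable_fun setT (\1_(C h) : 'rV[R]_n -> R).
    apply: measurable_indic; exact: measurable_cube.
  exact: (measurableT_comp m1 measurable_snd).
apply: measurable_funX; apply: measurable_funB.
  have ma : measurable_fun setT (fun p : 'rV[R]_n * 'rV[R]_n => p.1 + p.2).
    apply: measurable_fun_rV => i; under eq_fun do rewrite !mxE.
    apply: (@measurable_funD _ _ _ _ (fun p : 'rV[R]_n * 'rV[R]_n => p.1 0 i)
      (fun p => p.2 0 i)).
      exact: (measurableT_comp (measurable_rV_coord i) measurable_fst).
    exact: (measurableT_comp (measurable_rV_coord i) measurable_snd).
  exact: (measurableT_comp (continuous_rV_measurable cf) ma).
exact: (measurableT_comp (continuous_rV_measurable cf) measurable_fst).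
Qed.

Let F_ge0 f h p : (0 <= F f h p)%E.
Proof. by rewrite lee_fin mulr_ge0// sqr_ge0. Qed.

(** The squared increments of f at x over all z in C h: this dominates their
    integral over any cube of side h that contains x. *)
Let G f h x : \bar R := (\int[mu]_z F f h (x, z))%E.

Let measurable_G f h : continuous f -> measurable_fun setT (G f h).
Proof. by move=> cf; apply: measurable_fun_fubini_tonelli_F => //; exact: measurable_F. Qed.

Let G_ge0 f h x : (0 <= G f h x)%E. Proof. exact: integral_ge0. Qed.

(** By Fubini this is an integral of squared norms of increments along z, with
    coordinates of z at most h. *)
Let total_oscillation f h : 0 < h -> C1c f ->
  (\int[mu]_x G f h x <=
   ((h *+ 2) ^+ n * (n%:R * h ^+ 2 * \sum_j \int[mu]_x (partial j f x ^+ 2)))%:E)%E.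
Proof.
move=> h0 cf; have cf0 := cf.1; have cfc := C0c_continuous cf0.
set T := \sum_j _.
have T0 : 0 <= T by apply: sumr_ge0 => j _; apply: Rintegral_ge0 => x _; exact: sqr_ge0.
rewrite (fubini_tonelli (m1 := mu) (m2 := mu) (F f h))//; last exact: measurable_F.
apply: (@le_trans _ _ (\int[mu]_z ((n%:R * h ^+ 2 * T) * \1_(C h) z)%:E)%E).
  apply: ge0_le_integral => //.
  - by move=> z _; exact: integral_ge0.
  - by apply: measurable_fun_fubini_tonelli_G => //; exact: measurable_F.
  - apply/measurable_EFinP; apply: measurable_funM => //.
    apply: measurable_indic; exact: measurable_cube.
  - move=> z _; rewrite /F /= indicE; case: (boolP (z \in C h)) => [|_]; last first.
      by rewrite mulr0; under eq_integral do rewrite mul0r; rewrite integral0.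
    rewrite inE mulr1 => Cz; under eq_integral do rewrite mul1r.
    have c1 : C0c (fun x => (f (x + z) - f x) ^+ 2).
      by apply: C0c_sqr; apply: C0cB => //; exact: C0c_translate.
    rewrite (C0c_EFin_Rintegral c1) lee_fin (le_trans (translation_estimate z cf))//.
    rewrite -mulrA ler_wpM2l// mulr_sumr ler_sum// => j _.
    rewrite ler_wpM2r//; first by apply: Rintegral_ge0 => x _; exact: sqr_ge0.
    rewrite -(real_normK (num_real (z 0 j))) lerXn2r ?nnegrE ?(ltW h0)//.
    have /andP[H1 H2] := Cz j; rewrite mxE in H1 H2.
    by rewrite ler_norml H1/=; move: H2; rewrite mulr2n addKr => /ltW.
under eq_integral do rewrite EFinM.
rewrite ge0_integralZl_EFin//.
- rewrite integral_indic ?setIT//; last exact: measurable_cube.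
  rewrite [X in (_ * X)%E](_ : _ = ((h *+ 2) ^+ n)%:E); last first.
    by apply: lebesgue_cube; rewrite pmulrn_lgt0.
  by rewrite -EFinM mulrC.
- by apply/measurable_EFinP; apply: measurable_indic; exact: measurable_cube.
- by rewrite !mulr_ge0// ltW.
Qed.

(** The left side is the integral of (f y - f x)^2 over all pairs of points of
    the cube. *)
Let cube_oscillation f h a : 0 < h -> C0c f ->
  ((2 * (h ^+ n * \int[mu]_(x in cube a h) (f x ^+ 2)
     - (\int[mu]_(x in cube a h) f x) ^+ 2))%:E <= \int[mu]_(x in cube a h) G f h x)%E.
Proof.
move=> h0 cf; have cfc := C0c_continuous cf.
set Q := cube a h; have mQ : measurable Q by exact: measurable_cube.
have muQ : mu Q = (h ^+ n)%:E by exact: lebesgue_cube.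
have Qlty : (mu Q < +oo)%E by rewrite muQ ltry.
have iQ g : C0c g -> mu.-integrable Q (EFin \o g).
  by move=> /C0c_integrable; apply: integrableS.
have i1 := iQ _ cf; have i2 := iQ _ (C0c_sqr cf).
set S := \int[mu]_(x in Q) (f x ^+ 2); set I := \int[mu]_(x in Q) f x.
have fmuQ : fine (mu Q) = h ^+ n by rewrite muQ.
have sqE c : \int[mu]_(x in Q) (f x - c) ^+ 2 = S - 2 * c * I + c ^+ 2 * h ^+ n.
  rewrite (Rintegral_sqrB mQ Qlty i1 i2); congr (_ + _ * _); exact: fmuQ.
have key x : Q x -> ((S - 2 * f x * I + f x ^+ 2 * h ^+ n)%:E <= G f h x)%E.
  move=> Qx.
  rewrite -sqE.
  have iB := integrable_sqrB mQ Qlty i1 i2 (f x).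
  rewrite [X in (X <= _)%E](_ : _ = \int[mu]_(y in Q) ((f y - f x) ^+ 2)%:E)%E; last first.
    by rewrite /Rintegral fineK//; exact: integrable_fin_num.
  pose H y := (\1_Q y * (f y - f x) ^+ 2)%:E.
  have mH : measurable_fun setT H.
    apply/measurable_EFinP; apply: measurable_funM; first exact: measurable_indic.
    by apply: measurable_funX; apply: measurable_funB => //; exact: C0c_measurable.
  rewrite [X in (X <= _)%E](_ : _ = \int[mu]_y H y)%E; last first.
    rewrite integral_mkcond; apply: eq_integral => y _.
    by rewrite /H patchE indicE; case: ifP; rewrite ?mul1r ?mul0r.
  rewrite -(integral_translate x mH); apply: ge0_le_integral => //.
  - by move=> z _; rewrite lee_fin mulr_ge0// sqr_ge0.
  - exact: (measurableT_comp mH (measurable_translate x)).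
  - exact: (measurableT_comp (measurable_F h cfc) (pair1_measurable x)).
  - move=> z _; rewrite lee_fin [z + x]addrC ler_wpM2r ?sqr_ge0// !indicE.
    rewrite ler_nat; case: (boolP (x + z \in Q)) => //; rewrite inE => Qxz.
    rewrite lt0b mem_set// => i; rewrite mxE mulr2n addKr.
    have := Qx i; have := Qxz i; rewrite mxE => /andP[? ?] /andP[? ?].
    by apply/andP; split; lra.
have iI : mu.-integrable Q (EFin \o (fun x => 2 * I * f x)).
  by have := integrableZl mQ (2 * I) i1; apply: eq_integrable.
have iSS : mu.-integrable Q (EFin \o (fun x => h ^+ n * f x ^+ 2)).
  by have := integrableZl mQ (h ^+ n) i2; apply: eq_integrable.
have iS := integrable_cst mQ Qlty S.
have iB : mu.-integrable Q (EFin \o (fun x => S - 2 * I * f x)).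
  by have := integrableB mQ iS iI; apply: eq_integrable.
have -> : 2 * (h ^+ n * S - I ^+ 2) =
    \int[mu]_(x in Q) (S - 2 * f x * I + f x ^+ 2 * h ^+ n).
  transitivity (\int[mu]_(x in Q) ((S - 2 * I * f x) + h ^+ n * f x ^+ 2)); last first.
    by apply: eq_Rintegral => x _; ring.
  rewrite RintegralD// RintegralB// !RintegralZl// Rintegral_cst//.
  rewrite (_ : fine _ = h ^+ n); last exact: fmuQ.
  by rewrite -/S -/I; ring.
have i0 : mu.-integrable Q (EFin \o (fun x => S - 2 * f x * I + f x ^+ 2 * h ^+ n)).
  have := integrableD mQ iB iSS; apply: eq_integrable => // x _; congr EFin.
  by rewrite /=; ring.
rewrite [X in (X <= _)%E](_ : _ = \int[mu]_(x in Q) (S - 2 * f x * I + f x ^+ 2 * h ^+ n)%:E)%E; last first.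
  by rewrite /Rintegral fineK//; exact: integrable_fin_num.
apply: ge0_le_integral => //.
- move=> x Qx; rewrite lee_fin.
  rewrite -sqE.
  by apply: Rintegral_ge0 => y _; exact: sqr_ge0.
- exact: (measurable_int _ i0).
- by apply: measurable_funTS; exact: measurable_G.
Qed.

(** A form of the Rellich compactness theorem. The support is cut into cubes so
    small that the oscillation within them costs at most delta times the energy;
    the rest of the squared norm of f is that of its averages over the cubes. *)
Lemma finite_rank_inequality (M delta : R) : 0 < M -> 0 < delta ->
  exists (I : finType) (Q : I -> set 'rV[R]_n) (c : R),
  [/\ 0 <= c, forall i, measurable (Q i), forall i, (mu (Q i) < +oo)%E &
    forall f, C1c f -> (forall x, M <= `|x| -> f x = 0) ->
      \int[mu]_x (f x ^+ 2) <= delta * \sum_j \int[mu]_x (partial j f x ^+ 2)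
        + \sum_i c * (\int[mu]_(x in Q i) f x) ^+ 2].
Proof.
move=> M0 d0.
(* N.+1 cubes in each direction, of side h below *)
have [N HN] : exists N : nat, 2 ^+ n * n%:R * (2 * M / N.+1%:R) ^+ 2 <= delta.
  pose D := 2 ^+ n * n%:R * (2 * M) ^+ 2 / delta.
  have D0 : 0 <= D.
    apply: divr_ge0; last exact: ltW.
    by apply: mulr_ge0; [rewrite mulr_ge0 ?exprn_ge0|exact: sqr_ge0].
  exists (Num.truncn D); set N := (Num.truncn D).+1%:R : R.
  have N1 : 1 <= N by rewrite ler1n.
  have DN : D <= N by apply: ltW; exact: truncnS_gt.
  have N0 : 0 < N by exact: lt_le_trans N1.
  rewrite expr_div_n mulrA ler_pdivrMr ?exprn_gt0// [leRHS]mulrC -ler_pdivrMr//.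
  by rewrite (le_trans DN)// expr2 ler_peMr// ltW.
set h := 2 * M / N.+1%:R.
have h0 : 0 < h by rewrite divr_gt0// mulr_gt0.
pose a (k : {ffun 'I_n -> 'I_N.+1}) : 'rV[R]_n := \row_i (- M + h * (k i)%:R).
pose Q k := cube (a k) h.
have mQ k : measurable (Q k) by exact: measurable_cube.
have muQ k : mu (Q k) = (h ^+ n)%:E by exact: lebesgue_cube.
(* the index of the cube that contains x is read off the coordinates of x *)
have Qk k x : Q k x -> forall i, Num.truncn ((x 0 i + M) / h) = k i.
  move=> Qx i; apply: truncn_def; have := Qx i; rewrite mxE => /andP[H1 H2].
  rewrite ler_pdivlMr// ltr_pdivrMr// -natr1 mulrDl mul1r mulrC.
  by apply/andP; split; lra.
have tQ : trivIset [set` enum {ffun 'I_n -> 'I_N.+1}] Q.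
  apply/trivIsetP => k l _ _ /eqP kl; rewrite -subset0 => x [Qx Qx'].
  by apply: kl; apply/ffunP => i; apply/val_inj; rewrite /= -(Qk _ _ Qx) (Qk _ _ Qx').
have covQ x : `|x| < M -> exists k, Q k x.
  move=> /rV_norm_ltP-/(_ M0) xM.
  have b i : 0 <= (x 0 i + M) / h < N.+1%:R.
    have := xM i; rewrite ltr_norml => /andP[H1 H2].
    rewrite divr_ge0//=; [|lra|exact: ltW].
    rewrite ltr_pdivrMr// /h mulrC divfK ?pnatr_eq0//; lra.
  exists [ffun i => inord (Num.truncn ((x 0 i + M) / h))] => i.
  have /andP[b0 b1] := b i.
  rewrite mxE ffunE inordK ?truncn_lt_nat//.
  have /andP[] := truncn_itv b0; set t := Num.truncn _; rewrite ler_pdivlMr// ltr_pdivrMr// -natr1 mulrDl mul1r.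
  rewrite mulrC => ? ?; apply/andP; split; lra.
exists {ffun 'I_n -> 'I_N.+1}, Q, (h ^- n); split => //.
- by rewrite invr_ge0 exprn_ge0// ltW.
- by move=> k; rewrite muQ ltry.
move=> f cf fM; have cf0 := cf.1.
have part (g : 'rV[R]_n -> \bar R) : (forall x, 0 <= g x)%E -> measurable_fun setT g ->
    (\sum_k \int[mu]_(x in Q k) g x = \int[mu]_(x in \big[setU/set0]_k Q k) g x)%E.
  move=> g0 mg; rewrite -big_enum -[in RHS]big_enum ge0_integral_bigsetU//.
  - exact: enum_uniq.
  - exact: measurable_funTS.
have mU : measurable (\big[setU/set0]_k Q k) by exact: bigsetU_measurable.
set T := \sum_j _.
have hn0 : 0 < h ^+ n by exact: exprn_gt0.
have iQ k g : C0c g -> mu.-integrable (Q k) (EFin \o g).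
  by move=> /C0c_integrable; apply: integrableS.
have S_E : \int[mu]_x (f x ^+ 2) = \sum_k \int[mu]_(x in Q k) (f x ^+ 2).
  apply: EFin_inj; rewrite -C0c_EFin_Rintegral; last exact: C0c_sqr.
  rewrite -sumEFin; under eq_bigr => k _.
    rewrite /Rintegral fineK; last exact: integrable_fin_num (iQ k _ (C0c_sqr cf0)).
    over.
  rewrite part; last 2 first.
  - by move=> x; rewrite lee_fin sqr_ge0.
  - by apply/measurable_EFinP; exact: (C0c_measurable (C0c_sqr cf0)).
  rewrite [RHS]integral_mkcond; apply: eq_integral => x _; rewrite patchE.
  case: ifPn => //; rewrite notin_setE => nU.
  have [/covQ[k Qx]|/fM->] := ltP `|x| M; last by rewrite expr0n.
  by exfalso; apply: nU; rewrite -bigcup_seq; exists k => //=; rewrite mem_index_enum.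
have osc : \sum_k (2 * (h ^+ n * \int[mu]_(x in Q k) (f x ^+ 2)
     - (\int[mu]_(x in Q k) f x) ^+ 2)) <= (h *+ 2) ^+ n * (n%:R * h ^+ 2 * T).
  rewrite -lee_fin; apply: le_trans (total_oscillation h0 cf).
  rewrite -sumEFin.
  apply: (@le_trans _ _ (\sum_k \int[mu]_(x in Q k) G f h x)%E).
    by apply: lee_sum => k _; exact: cube_oscillation.
  have mG := measurable_G h (C0c_continuous cf0).
  by rewrite part//; apply: ge0_subset_integral.
rewrite -mulr_sumr sumrB -mulr_sumr -S_E in osc.
rewrite -mulr_sumr.
set S := \int[mu]_x _ in osc *; set II := \sum_k _ ^+ 2 in osc *.
have T0 : 0 <= T by apply: sumr_ge0 => j _; apply: Rintegral_ge0 => x _; exact: sqr_ge0.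
have H1 : h ^+ n * S <= h ^+ n * (2 ^+ n * n%:R * h ^+ 2 * T) + II.
  have : 0 <= h ^+ n * (2 ^+ n * n%:R * h ^+ 2 * T).
    by rewrite !mulr_ge0// ?sqr_ge0// ltW.
  move: osc; rewrite -(mulr_natr h).
  rewrite [X in _ <= X](_ : _ = h ^+ n * (2 ^+ n * n%:R * h ^+ 2 * T)); last by rewrite [(h * 2) ^+ n]exprMn; ring.
  by lra.
rewrite -(ler_pM2l hn0) mulrDr [X in _ + X]mulrA divff ?gt_eqF// mul1r (le_trans H1)// lerD2r.
by rewrite ler_pM2l// ler_wpM2r.
Qed.

End cube_averages.

(** * Minimising a quotient of quadratic forms *)

Lemma ultra_bounded_cvg (R : realType) (T : Type) (U : set_system T) (f : T -> R)
    (B : R) : UltraFilter U -> U [set x | `|f x| <= B] ->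
  exists l : R, forall e, 0 < e -> U [set x | `|f x - l| < e].
Proof.
move=> UU UB.
have [l [_ cl]] : `[- B, B]%classic `&` cluster (f @ U) !=set0.
  apply: (@segment_compact _ (- B) B (f @ U)).
  change (U (f @^-1` `[- B, B]%classic)).
  by apply: filterS UB => x /= fB; rewrite in_itv/= -ler_norml.
exists l => e e0.
have [//|UC] := in_ultra_setVsetC [set x | `|f x - l| < e] UU.
have [_ [[x xC <-] xe]] : f @` (~` [set x | `|f x - l| < e]) `&` ball l e !=set0.
  apply: cl; last exact: nbhsx_ballx.
  change (U (f @^-1` (f @` (~` [set x | `|f x - l| < e])))).
  by apply: filterS UC => x xC; exists x.
by exfalso; apply: xC; move: xe; rewrite -ball_normE /ball_/= distrC.
Qed.

Section minimization.
Context {R : realType} {V : lmodType R}.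
Variables (D : set V) (Qb QJ : V -> R).
Hypothesis DD : forall u v, D u -> D v -> D (u + v).
Hypothesis DZ : forall c u, D u -> D (c *: u).
Hypothesis Qb0 : forall u, D u -> 0 <= Qb u.
Hypothesis QJ0 : forall u, D u -> 0 <= QJ u.
Hypothesis QbZ : forall c u, D u -> Qb (c *: u) = c ^+ 2 * Qb u.
Hypothesis QJZ : forall c u, D u -> QJ (c *: u) = c ^+ 2 * QJ u.
Hypothesis Qbpar : forall u v, D u -> D v -> Qb (u + v) + Qb (u - v) = 2 * Qb u + 2 * Qb v.
Hypothesis QJpar : forall u v, D u -> D v -> QJ (u + v) + QJ (u - v) = 2 * QJ u + 2 * QJ v.
Hypothesis cpt : forall delta : R, 0 < delta ->
  exists (I : finType) (l : I -> V -> R) (C : R),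
  [/\ forall i u v, D u -> D v -> l i (u - v) = l i u - l i v,
      forall i u, D u -> l i u ^+ 2 <= C * Qb u &
      forall u, D u -> Qb u <= delta * QJ u + \sum_i l i u ^+ 2].

(** nu is the infimum of QJ on the sphere Qb = 1. In an ultrafilter of almost
    minimisers the functionals of [cpt] converge, so that it contains sets of
    small diameter for Qb. They have small diameter for QJ as well, by the
    parallelogram identity and QJ (u + v) >= nu * Qb (u + v). *)
Lemma minimizing_cauchy_sequence (v0 : V) (e : nat -> R) : D v0 -> 0 < Qb v0 ->
  (forall k, 0 < e k) ->
  exists nu, [/\ 0 <= nu, forall u, D u -> nu * Qb u <= QJ u &
    exists v : nat -> V, forall k, [/\ D (v k), Qb (v k) = 1, QJ (v k) <= nu + e k &
      forall l, (k <= l)%N -> Qb (v k - v l) <= e k /\ QJ (v k - v l) <= e k]].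
Proof.
move=> Dv0 v0gt0 e0.
pose S := [set u | D u /\ Qb u = 1].
have Snorm u : D u -> 0 < Qb u -> S ((Num.sqrt (Qb u))^-1 *: u).
  move=> Du u0; split; first exact: DZ.
  by rewrite QbZ// exprVn sqr_sqrtr ?(ltW u0)// mulVf// gt_eqF.
pose nu := inf (QJ @` S).
have hi : has_inf (QJ @` S).
  split.
    exists (QJ ((Num.sqrt (Qb v0))^-1 *: v0)).
    by exists ((Num.sqrt (Qb v0))^-1 *: v0) => //; exact: Snorm.
  by exists 0 => _ [u [Du _] <-]; exact: QJ0.
have nu0 : 0 <= nu.
  by apply: lb_le_inf; [exact: hi.1|move=> _ [u [Du _] <-]; exact: QJ0].
have nuS u : S u -> nu <= QJ u by move=> Su; apply: ge_inf; [exact: hi.2|exists u].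
have nuD u : D u -> nu * Qb u <= QJ u.
  move=> Du; have := Qb0 Du; rewrite le_eqVlt => /predU1P[<-|u0].
    by rewrite mulr0 QJ0.
  have := nuS _ (Snorm _ Du u0).
  by rewrite QJZ// exprVn sqr_sqrtr ?(ltW u0)// mulrC ler_pdivlMr.
pose B (k : nat) := [set u | S u /\ QJ u < nu + k.+1%:R^-1].
have fB : ProperFilter (filter_from setT B).
  apply: filter_from_proper; last first.
    move=> k _; have k0 : 0 < k.+1%:R^-1 :> R by rewrite invr_gt0.
    have [_ [u Su <-] Hu] := inf_adherent k0 hi.
    by exists u.
  apply: filter_from_filter; first by exists 0%N.
  move=> i j _ _; exists (maxn i j) => // u [Su Hu]; split; split=> //.
    by apply: (lt_le_trans Hu); rewrite lerD2l lef_pV2 ?posrE// ler_nat ltnS leq_maxl.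
  by apply: (lt_le_trans Hu); rewrite lerD2l lef_pV2 ?posrE// ler_nat ltnS leq_maxr.
have [U [UU BU]] := ultraFilterLemma fB.
have UB k : U (B k) by apply: BU; exists k.
have DB u v : D u -> D v -> D (u - v).
  by move=> Du Dv; rewrite -scaleN1r; apply: DD => //; exact: DZ.
have US t : 0 < t -> U [set u | S u /\ QJ u < nu + t].
  move=> t0; apply: filterS (UB (Num.truncn t^-1)) => u [Su Hu]; split=> //.
  apply: (lt_trans Hu); rewrite ltrD2l -[ltRHS]invrK ltf_pV2 ?posrE ?invr_gt0//.
  exact: truncnS_gt.
(* M bounds QJ (u - v) for almost minimisers, s the squared functionals *)
have smallb t : 0 < t -> exists2 A, U A & forall u v, A u -> A v -> Qb (u - v) < t.
  move=> t0; pose M := 4 * (nu + 1).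
  have M0 : 0 < M by rewrite mulr_gt0// ltr_wpDl.
  have [|I [l [C [lB lC Hl]]]] := @cpt (t / 2 / M); first by rewrite !divr_gt0.
  pose s := t / 2 / (#|I|.+1)%:R.
  have s0 : 0 < s by rewrite !divr_gt0.
  have /choice[L HL] i : exists L : R, forall r, 0 < r -> U [set u | `|l i u - L| < r].
    apply: (@ultra_bounded_cvg _ _ _ _ (`|C| + 1)); apply: filterS (UB 0%N) => u [[Du Qu] _] /=.
    have := lC i u Du; rewrite Qu mulr1 => H.
    rewrite -(@ler_pXn2r _ 2)// ?nnegrE ?addr_ge0// real_normK ?num_real//.
    rewrite (le_trans H)// (le_trans (ler_norm _))// sqrrD1.
    by have := sqr_ge0 `|C|; have := normr_ge0 C; lra.
  pose A := [set u | S u /\ QJ u < nu + 1] `&`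
    [set u | forall i, `|l i u - L i| < Num.sqrt s / 2].
  exists A.
    apply: filterI; first exact: US.
    by apply: filter_forall => i; apply: HL; rewrite divr_gt0// sqrtr_gt0.
  move=> u v [[[Du Qu] Ju] lu] [[[Dv Qv] Jv] lv].
  apply: (le_lt_trans (Hl _ (DB _ _ Du Dv))).
  have H1 : QJ (u - v) < M.
    by have := QJpar Du Dv; have := QJ0 (DD Du Dv); rewrite /M; lra.
  have H2 : \sum_i l i (u - v) ^+ 2 <= t / 2.
    apply: (@le_trans _ _ (\sum_(i : I) s)); last first.
      rewrite sumr_const -(mulr_natr s) /s -mulrA ler_piMr ?divr_ge0 ?(ltW t0)//.
      by rewrite ler_pdivrMl// mulr1 ler_nat.
    apply: ler_sum => i _; rewrite lB// -(real_normK (num_real _)).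
    rewrite -[leRHS](sqr_sqrtr (ltW s0)) lerXn2r ?nnegrE ?sqrtr_ge0//.
    have := lu i; have := lv i.
    by move=> h1 h2; rewrite (le_trans (ler_distD (L i) _ _))// (distrC (L i)); lra.
  have H3 : t / 2 / M * QJ (u - v) < t / 2.
    by rewrite -[ltRHS](divfK (lt0r_neq0 M0)) ltr_pM2l// !divr_gt0.
  by rewrite [ltRHS](splitr t) ltr_leD.
have small t : 0 < t -> exists2 A, U A & forall u v, A u -> A v ->
    [/\ S u, QJ u <= nu + t, Qb (u - v) <= t & QJ (u - v) <= t].
  (* Qb (u - v) <= s gives Qb (u + v) >= 4 - s, and then QJ (u - v) is at most
     4 * (nu + t / 8) - nu * (4 - s) = t / 2 + nu * s *)
  move=> t0; pose s := t / (4 * (nu + 1)).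
  have nu1 : 0 < nu + 1 by rewrite ltr_wpDl.
  have s0 : 0 < s by rewrite divr_gt0// mulr_gt0.
  have st : s <= t / 4.
    rewrite /s invfM mulrA ler_piMr ?divr_ge0 ?(ltW t0)//.
    by rewrite invf_le1// lerDr.
  have snu : nu * s <= t / 4.
    have -> : t / 4 = (nu + 1) * s by rewrite /s; field; lra.
    by rewrite ler_pM2r// lerDl.
  have [A UA HA] := smallb s s0.
  exists ([set u | S u /\ QJ u < nu + t / 8] `&` A).
    by apply: filterI => //; apply: US; rewrite divr_gt0.
  move=> u v [[[Du Qu] Ju] Au] [[[Dv Qv] Jv] Av].
  have Hb := HA u v Au Av.
  split=> //; [lra|lra|].
  have := QJpar Du Dv; have := Qbpar Du Dv; have := nuD _ (DD Du Dv).
  rewrite Qu Qv => H1 H2 H3.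
  have -> : QJ (u - v) = 2 * QJ u + 2 * QJ v - QJ (u + v) by lra.
  have E : Qb (u + v) = 4 - Qb (u - v) by lra.
  have H4 : nu * Qb (u - v) <= nu * s by rewrite ler_wpM2l// ltW.
  move: H1; rewrite E; lra.
have /choice[A HA] k : exists A, U A /\ (forall u v, A u -> A v ->
    [/\ S u, QJ u <= nu + e k, Qb (u - v) <= e k & QJ (u - v) <= e k]).
  by have [A UA HA] := small _ (e0 k); exists A.
pose A' k := [set u | forall i : 'I_k.+1, A i u].
have UA' k : U (A' k) by apply: filter_forall => i; exact: (HA i).1.
have /choice[v Hv] k : exists v, A' k v by exact: filter_ex (UA' k).
exists nu; split=> //; exists v => k.
have Ak : A k (v k) by exact: (Hv k ord_max).
have [[Du Qu] Ju _ _] := (HA k).2 _ _ Ak Ak.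
split=> // l kl.
have Al : A k (v l) by exact: (Hv l (Ordinal (kl : (k < l.+1)%N))).
by have [] := (HA k).2 _ _ Ak Al.
Qed.

End minimization.

(** * Square integrable functions *)

Section L2_space.
Context d (T : measurableType d) (R : realType) (mu : {measure set T -> \bar R}).
Variables (D : set T) (mD : measurable D).
Implicit Types f g w : T -> R.

Definition l2 f := measurable_fun D f /\ (\int[mu]_(x in D) (f x ^+ 2)%:E < +oo)%E.

Definition sqn f : R := \int[mu]_(x in D) (f x ^+ 2).

Definition ip w f g : R := \int[mu]_(x in D) (w x * (f x * g x)).

Lemma sqn_ge0 f : 0 <= sqn f.
Proof. by apply: Rintegral_ge0 => x _; exact: sqr_ge0. Qed.

Lemma l2_sqr_integrable f : l2 f -> mu.-integrable D (EFin \o (fun x => f x ^+ 2)).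
Proof.
move=> [mf foo]; apply/integrableP; split.
  by apply/measurable_EFinP; exact: measurable_funX.
by under eq_integral do rewrite /= ger0_norm ?sqr_ge0//.
Qed.

Lemma l2_sqnE f : l2 f -> (\int[mu]_(x in D) (f x ^+ 2)%:E = (sqn f)%:E)%E.
Proof. by move=> /l2_sqr_integrable/integrable_fin_num/fineK <-. Qed.

Lemma l2_mul_integrable f g : l2 f -> l2 g -> mu.-integrable D (EFin \o (fun x => f x * g x)).
Proof.
move=> lf lg.
have : mu.-integrable D (fun x => (f x ^+ 2)%:E + (g x ^+ 2)%:E)%E.
  by apply: integrableD => //; exact: l2_sqr_integrable.
apply: le_integrable => //.
  by apply/measurable_EFinP; apply: measurable_funM; [exact: lf.1|exact: lg.1].
move=> x _ /=; rewrite lee_fin [leRHS]ger0_norm ?addr_ge0 ?sqr_ge0//.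
rewrite ler_norml; apply/andP; split.
  by have := sqr_ge0 (f x + g x); have := sqr_ge0 (f x); have := sqr_ge0 (g x); rewrite sqrrD; lra.
by have := sqr_ge0 (f x - g x); have := sqr_ge0 (f x); have := sqr_ge0 (g x); rewrite sqrrB; lra.
Qed.

Lemma l2_wmul w (C : R) f : measurable_fun D w -> (forall x, D x -> `|w x| <= C) ->
  l2 f -> l2 (fun x => w x * f x) /\ sqn (fun x => w x * f x) <= C ^+ 2 * sqn f.
Proof.
move=> mw wC lf; have [mf foo] := lf.
have i1 : mu.-integrable D (EFin \o (fun x => C ^+ 2 * f x ^+ 2)).
  by have := integrableZl mD (C ^+ 2) (l2_sqr_integrable lf); apply: eq_integrable.
have mwf : measurable_fun D (fun x => w x * f x) by exact: measurable_funM.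
have le x : D x -> (w x * f x) ^+ 2 <= C ^+ 2 * f x ^+ 2.
  move=> Dx; rewrite exprMn ler_wpM2r ?sqr_ge0//.
  rewrite -(real_normK (num_real (w x))) lerXn2r ?nnegrE ?wC//.
  by rewrite (le_trans _ (wC x Dx)).
have i2 : mu.-integrable D (EFin \o (fun x => (w x * f x) ^+ 2)).
  apply: le_integrable i1 => //.
    by apply/measurable_EFinP; exact: measurable_funX.
  move=> x Dx /=; rewrite lee_fin !ger0_norm ?le//; last exact: sqr_ge0.
  by rewrite mulr_ge0// sqr_ge0.
have l2wf : l2 (fun x => w x * f x) by split=> //; exact: integrable_lty i2.
split=> //; rewrite /sqn -RintegralZl//; last exact: l2_sqr_integrable.
by apply: le_Rintegral.
Qed.

Lemma l2Z (c : R) f : l2 f -> l2 (fun x => c * f x).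
Proof. by move=> lf; apply: (@l2_wmul (fun=> c) `|c| f _ _ lf).1. Qed.

Lemma l2D f g : l2 f -> l2 g -> l2 (fun x => f x + g x).
Proof.
move=> lf lg; split; first by apply: measurable_funD; [exact: lf.1|exact: lg.1].
have i1 : mu.-integrable D (EFin \o (fun x => 2 * f x ^+ 2)).
  by have := integrableZl mD 2 (l2_sqr_integrable lf); apply: eq_integrable.
have i2 : mu.-integrable D (EFin \o (fun x => 2 * g x ^+ 2)).
  by have := integrableZl mD 2 (l2_sqr_integrable lg); apply: eq_integrable.
apply: le_lt_trans (integrable_lty mD (integrableD mD i1 i2)).
apply: ge0_le_integral => //.
- by move=> x _; rewrite lee_fin sqr_ge0.
- apply/measurable_EFinP; apply: measurable_funX.
  by apply: measurable_funD; [exact: lf.1|exact: lg.1].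
- by apply: emeasurable_funD; [exact: measurable_int i1|exact: measurable_int i2].
- move=> x _ /=; rewrite lee_fin.
  by have := sqr_ge0 (f x - g x); rewrite sqrrB sqrrD; lra.
Qed.

Lemma l2B f g : l2 f -> l2 g -> l2 (fun x => f x - g x).
Proof.
move=> lf lg; have := l2D lf (l2Z (-1) lg).
by under eq_fun do rewrite mulN1r.
Qed.

Lemma l2_0 : l2 (fun=> 0).
Proof.
by split=> //; under eq_integral do rewrite expr0n; rewrite integral0.
Qed.

Lemma l2_sum (I : Type) (s : seq I) (F : I -> T -> R) : (forall i, l2 (F i)) ->
  l2 (fun x => \sum_(i <- s) F i x).
Proof.
move=> lF; elim: s => [|i s IH].
  by under eq_fun do rewrite big_nil; exact: l2_0.
by under eq_fun do rewrite big_cons; exact: l2D.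
Qed.

Lemma sqn_sym f g : sqn (fun x => f x - g x) = sqn (fun x => g x - f x).
Proof. by apply: eq_Rintegral => x _; rewrite -sqrrN opprB. Qed.

Lemma cauchy_schwarz f g : l2 f -> l2 g ->
  (\int[mu]_(x in D) (f x * g x)) ^+ 2 <= sqn f * sqn g.
Proof.
move=> lf lg; rewrite mulrC; apply: discriminant_le; last exact: sqn_ge0.
move=> c; have := sqn_ge0 (fun x => f x + - c * g x).
have -> : sqn (fun x => f x + - c * g x) =
    sqn f - 2 * c * (\int[mu]_(x in D) (f x * g x)) + c ^+ 2 * sqn g; last by [].
have i1 := l2_sqr_integrable lf; have i2 := l2_mul_integrable lf lg.
have i3 := l2_sqr_integrable lg.
have j2 : mu.-integrable D (EFin \o (fun x => 2 * c * (f x * g x))).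
  by have := integrableZl mD (2 * c) i2; apply: eq_integrable.
have j3 : mu.-integrable D (EFin \o (fun x => c ^+ 2 * g x ^+ 2)).
  by have := integrableZl mD (c ^+ 2) i3; apply: eq_integrable.
have j4 : mu.-integrable D (EFin \o (fun x => f x ^+ 2 - 2 * c * (f x * g x))).
  by have := integrableB mD i1 j2; apply: eq_integrable.
rewrite /sqn -!RintegralZl// -RintegralB// -RintegralD//.
by apply: eq_Rintegral => x _; ring.
Qed.

Section weighted.
Variables (w : T -> R) (C : R).
Hypotheses (mw : measurable_fun D w) (wC : forall x, D x -> `|w x| <= C).

Lemma ip_integrable f g : l2 f -> l2 g ->
  mu.-integrable D (EFin \o (fun x => w x * (f x * g x))).
Proof.
move=> lf lg; have := l2_mul_integrable (l2_wmul mw wC lf).1 lg.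
by apply: eq_integrable => // x _ /=; rewrite mulrA.
Qed.

Lemma ipDl f g h : l2 f -> l2 g -> l2 h -> ip w (fun x => f x + g x) h = ip w f h + ip w g h.
Proof.
move=> lf lg lh; rewrite /ip -RintegralD//; try exact: ip_integrable.
by apply: eq_Rintegral => x _; ring.
Qed.

Lemma ipZl c f h : l2 f -> l2 h -> ip w (fun x => c * f x) h = c * ip w f h.
Proof.
move=> lf lh; rewrite /ip -RintegralZl//; try exact: ip_integrable.
by apply: eq_Rintegral => x _; ring.
Qed.

Lemma ipC f g : ip w f g = ip w g f.
Proof. by apply: eq_Rintegral => x _; rewrite (mulrC (f x)). Qed.

Lemma ip_bound f g : l2 f -> l2 g -> (ip w f g) ^+ 2 <= C ^+ 2 * sqn f * sqn g.
Proof.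
move=> lf lg; have [lwf wfC] := l2_wmul mw wC lf.
rewrite /ip; under eq_Rintegral do rewrite mulrA.
by rewrite (le_trans (cauchy_schwarz lwf lg))// ler_wpM2r// sqn_ge0.
Qed.

End weighted.

(** The series h of the squared increments with weights 4^k is integrable, hence
    finite outside a null set, and where it is finite the increments are at most
    of order 2^-k. The distance to the limit is estimated by Fatou's lemma. *)
Lemma l2_complete (f : nat -> T -> R) : (forall k, l2 (f k)) ->
  (forall k l, (k <= l)%N -> sqn (fun x => f k x - f l x) <= 8 ^- k) ->
  exists2 g, l2 g & forall k, sqn (fun x => f k x - g x) <= 8 ^- k.
Proof.
move=> lf cf.
pose dl k x := f k.+1 x - f k x.
have ldl k : l2 (dl k) by exact: l2B.
have mf k : measurable_fun D (f k) by exact: (lf k).1.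
pose t k x := (4 ^+ k * dl k x ^+ 2)%:E.
have mt k : measurable_fun D (t k).
  apply/measurable_EFinP; apply: measurable_funM => //; apply: measurable_funX.
  exact: (ldl k).1.
have t0 k x : (0 <= t k x)%E by rewrite lee_fin mulr_ge0 ?sqr_ge0// exprn_ge0.
pose h x := (\sum_(k <oo) t k x)%E.
have mh : measurable_fun D h.
  exact: (@ge0_emeasurable_sum _ _ _ D t xpredT (fun k x _ _ => t0 k x) (fun k _ => mt k)).
have h0 x : (0 <= h x)%E by exact: nneseries_ge0.
have ih : (\int[mu]_(x in D) h x < +oo)%E.
  rewrite /h integral_nneseries//.
  apply: (@le_lt_trans _ _ (\sum_(k <oo) ((2 / (2 ^ (k + 1))%:R)%:E : \bar R))%E).
    apply: lee_nneseries => k _; first by move=> _; exact: integral_ge0.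
    have -> : (\int[mu]_(x in D) t k x = (4 ^+ k * sqn (dl k))%:E)%E.
      rewrite EFinM -l2_sqnE// -ge0_integralZl_EFin//.
      - by move=> x _; rewrite lee_fin sqr_ge0.
      - by apply/measurable_EFinP; apply: measurable_funX; exact: (ldl k).1.
    rewrite lee_fin; apply: (@le_trans _ _ (4 ^+ k * 8 ^- k)).
      by rewrite ler_wpM2l ?exprn_ge0// sqn_sym; exact: cf.
    rewrite addn1 expnS natrM natrX invfM mulrA divff// mul1r.
    by rewrite (_ : 8 = 4 * 2)%R ?exprMn ?invfM ?mulrA ?divff ?mul1r ?expf_neq0//; ring.
  have := @cvg_geometric_eseries_half R 2 0; move/cvg_lim => -> //.
  by rewrite ltry.
pose N := D `&` [set x | h x = +oo%E].
have mN : measurable N by exact: (mh mD _ (emeasurable_set1 +oo%E)).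
have hi : mu.-integrable D h.
  by apply/integrableP; split=> //; under eq_integral do rewrite gee0_abs//.
have muN : mu N = 0%E.
  apply: measure_negligible => //.
  apply: negligibleS (integrable_ae mD hi) => x [Dx hx] /=.
  by move=> /(_ Dx); rewrite hx.
have fcvg x : (D `\` N) x -> cvgn (f^~ x).
  move=> [Dx nNx].
  have hfin : h x \is a fin_num.
    rewrite ge0_fin_numE// ltey; apply/eqP => hx; apply: nNx; split=> //.
  have dM k : `|dl k x| <= Num.sqrt (fine (h x)) * 2^-1 ^+ k.
    have tk : (t k x <= h x)%E.
      have := @nneseries_lim_ge _ (t^~ x) xpredT 0 k.+1 (fun n _ _ => t0 n x).
      apply: le_trans; rewrite big_nat_recr//= leeDr// sume_ge0//.
    rewrite -(@ler_pXn2r _ 2)// ?nnegrE ?mulr_ge0 ?sqrtr_ge0 ?exprn_ge0//.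
    rewrite real_normK ?num_real// exprMn sqr_sqrtr ?fine_ge0//.
    have E4 : 2^-1 ^+ 2 = 4^-1 :> R by field.
    rewrite -exprM mulnC exprM E4.
    rewrite exprVn ler_pdivlMr ?exprn_gt0// mulrC -lee_fin fineK//.
  have : cvgn (series (fun k => dl k x)).
    apply: normed_cvg; apply: series_le_cvg (is_cvg_geometric_series (a := Num.sqrt (fine (h x))) (z := 2^-1) _).
    - by move=> k; exact: normr_ge0.
    - by move=> k; rewrite /geometric/= mulr_ge0 ?sqrtr_ge0 ?exprn_ge0.
    - exact: dM.
    - by rewrite ger0_norm// invf_lt1// ltr1n.
  rewrite (_ : f^~ x = fun k => f 0%N x + series (fun k => dl k x) k).
    move=> /cvg_ex[l cs]; apply/cvg_ex; exists (f 0%N x + l).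
    exact: (cvgD (cvg_cst (f 0%N x)) cs).
  by apply/funext => k; rewrite [LHS](eq_sum_telescope (f^~ x)).
(* cutting off N makes the limit exist, hence measurable, on all of D *)
pose g x := lim ((fun k => f k x * \1_(~` N) x) @ \oo).
have gcvg x : D x -> (fun k => f k x * \1_(~` N) x) @ \oo --> g x.
  move=> Dx; rewrite /g; have [Nx|nNx] := pselect (N x).
    rewrite (_ : (fun k => _) = fun=> 0); first exact: is_cvg_cst.
    by apply/funext => k; rewrite indicE memNset ?mulr0//; apply.
  rewrite (_ : (fun k => _) = f^~ x); first exact: fcvg.
  by apply/funext => k; rewrite indicE mem_set ?mulr1.
have gcvg' x : (D `\` N) x -> (fun k => f k x) @ \oo --> g x.
  move=> [Dx Nx]; have := gcvg x Dx.
  by under eq_fun do rewrite indicE mem_set// mulr1.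
have mg : measurable_fun D g.
  apply: (measurable_fun_cvg _ gcvg) => k; apply: measurable_funM => //.
  by apply: measurable_indic; exact: measurableC.
have mfg k : measurable_fun D (fun x => ((f k x - g x) ^+ 2)%:E).
  by apply/measurable_EFinP; apply: measurable_funX; exact: measurable_funB.
have main k : (\int[mu]_(x in D) ((f k x - g x) ^+ 2)%:E <= (8 ^- k)%:E)%E.
  rewrite (@ge0_negligible_integral _ _ _ mu D N)//; last first.
    by move=> x _; rewrite lee_fin sqr_ge0.
  have mDN : measurable (D `\` N) by exact: measurableD.
  pose u l x := ((f k x - f (k + l)%N x) ^+ 2)%:E.
  have mu_ l : measurable_fun (D `\` N) (u l).
    apply: (@measurable_funS _ _ _ _ D) => //.
    by apply/measurable_EFinP; apply: measurable_funX; exact: measurable_funB.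
  have u0 l x : (0 <= u l x)%E by rewrite lee_fin sqr_ge0.
  rewrite (_ : (\int[mu]_(x in D `\` N) _)%E =
      (\int[mu]_(x in D `\` N) limn_einf (u^~ x))%E); last first.
    apply: eq_integral => x; rewrite inE => Dx.
    have ux : (u^~ x) @ \oo --> ((f k x - g x) ^+ 2)%:E.
      apply: cvg_EFin; first by near=> l.
      rewrite /u /=.
      have c1 : (fun l => f k x - f (k + l)%N x) @ \oo --> f k x - g x.
        apply: cvgB; first exact: cvg_cst.
        have := gcvg' x Dx; rewrite -(cvg_shiftn k).
        by under [X in X @ _]eq_fun do rewrite addnC.
      exact: (cvgM c1 c1).
    by rewrite (is_cvg_limn_einfE (cvgP _ ux)); apply/esym/cvg_lim.
  apply: (le_trans (fatou mu mDN mu_ _)) => //.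
  rewrite limn_einf_lim; apply: lime_le; first exact: is_cvg_einfs.
  near=> l; apply: (@le_trans _ _ (\int[mu]_(x in D `\` N) u l x)%E).
    by apply: ereal_inf_lbound; exists l => /=.
  apply: (@le_trans _ _ (\int[mu]_(x in D) u l x)%E).
    apply: ge0_subset_integral => //.
    by apply/measurable_EFinP; apply: measurable_funX; exact: measurable_funB.
  by rewrite /u l2_sqnE ?lee_fin ?cf ?leq_addr//; exact: l2B.
have lfg k : l2 (fun x => f k x - g x).
  split; first exact: measurable_funB.
  exact: le_lt_trans (main k) (ltry _).
exists g => [|k]; last by rewrite -lee_fin -l2_sqnE.
have := l2B (lf 0%N) (lfg 0%N).
by under eq_fun do rewrite subKr.
Unshelve. all: by end_near. Qed.

End L2_space.

(** * Real test functions and the fundamental lemma *)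

Section test_functions.
Context {R : realType} {n : nat}.
Local Notation mu := (@lebesgue_rV R n).
Implicit Types (f g : 'rV[R]_n -> R) (Om : set 'rV[R]_n) (a b x : 'rV[R]_n).

Definition rtest Om f := smooth f /\ exists K : set 'rV[R]_n,
  [/\ compact K, K `<=` Om & forall x, ~ K x -> f x = 0].

Lemma compact_cbox a b : compact (cbox a b).
Proof.
have -> : cbox a b = [set x : 'rV[R]_n | forall i, `[a 0 i, b 0 i]%classic (x ord0 i)].
  by apply/seteqP; split => x /= H i; have := H i; rewrite in_itv.
by apply: (@rV_compact _ _ (fun i => `[a 0 i, b 0 i]%classic)) => i; exact: segment_compact.
Qed.

(** As k grows these tend to the indicator of the open box. *)
Definition bump a b (k : nat) : 'rV[R]_n -> R := fun x =>
  \prod_i (theta (k.+1%:R * (x 0 i - a 0 i)) * theta (k.+1%:R * (b 0 i - x 0 i))).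

Lemma smooth_alg_prod (F : 'I_n -> 'rV[R]_n -> R) : (forall i, smooth_alg (F i)) ->
  smooth_alg (fun x => \prod_i F i x).
Proof.
move=> sF; elim: (index_enum 'I_n) => [|i s IH].
  by under eq_fun do rewrite big_nil; exact: smooth_alg_cst.
by under eq_fun do rewrite big_cons; exact: smooth_alg_mul.
Qed.

Lemma smooth_alg_sum (F : 'I_n -> 'rV[R]_n -> R) : (forall i, smooth_alg (F i)) ->
  smooth_alg (fun x => \sum_i F i x).
Proof.
move=> sF; elim: (index_enum 'I_n) => [|i s IH].
  by under eq_fun do rewrite big_nil; exact: smooth_alg_cst.
by under eq_fun do rewrite big_cons; exact: smooth_alg_add.
Qed.

Lemma smooth_theta_affine (c d : R) : smooth1 (fun t => theta (c * t + d)).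
Proof. exact: smooth1_flat. Qed.

Lemma smooth_bump a b k : smooth_alg (bump a b k).
Proof.
apply: smooth_alg_prod => i; apply: smooth_alg_mul.
  rewrite (_ : (fun x : 'rV[R]_n => _) =
    (fun x => (fun t => theta (k.+1%:R * t + - (k.+1%:R * a 0 i))) (x 0 i))); last first.
    by apply/funext => x; rewrite mulrBr.
  apply: (@smooth_alg_comp1 _ _ (fun t => theta (k.+1%:R * t + - (k.+1%:R * a 0 i)))).
    exact: smooth_theta_affine.
  exact: smooth_alg_coord.
rewrite (_ : (fun x : 'rV[R]_n => _) =
  (fun x => (fun t => theta ((- k.+1%:R) * t + k.+1%:R * b 0 i)) (x 0 i))); last first.
  by apply/funext => x; rewrite mulrBr addrC mulNr.
apply: (@smooth_alg_comp1 _ _ (fun t => theta ((- k.+1%:R) * t + k.+1%:R * b 0 i))).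
  exact: smooth_theta_affine.
exact: smooth_alg_coord.
Qed.

Lemma bump_supp a b k x : ~ obox a b x -> bump a b k x = 0.
Proof.
move=> nb; have [i Hi] : exists i, ~~ (a 0 i < x 0 i < b 0 i).
  by apply: contrapT => H; apply: nb => i; apply: contrapT => /negP Hi; apply: H; exists i.
rewrite /bump (bigD1 i)//=; move: Hi; rewrite negb_and -!leNgt => /orP[H|H].
  by rewrite [theta (_ * (_ - a 0 i))]theta_eq0 ?mul0r// pmulr_rle0// subr_le0.
by rewrite [theta (_ * (b 0 i - _))]theta_eq0 ?mulr0 ?mul0r// pmulr_rle0// subr_le0.
Qed.

Lemma bump_ge0 a b k x : 0 <= bump a b k x.
Proof. by apply: prodr_ge0 => i _; rewrite mulr_ge0// theta_ge0. Qed.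

Lemma bump_le1 a b k x : bump a b k x <= 1.
Proof.
apply: prodr_ile1 => i; rewrite mulr_ge0 ?theta_ge0//=.
by rewrite -[leRHS]mulr1 ler_pM ?theta_ge0 ?theta_le1.
Qed.

Lemma bump_cvg a b x : obox a b x -> bump a b k x @[k --> \oo] --> (1 : R).
Proof.
move=> abx; rewrite /bump.
elim: (index_enum 'I_n) => [|i s IH].
  by under eq_cvg do rewrite big_nil; exact: cvg_cst.
under eq_cvg do rewrite big_cons.
have /andP[H1 H2] := abx i; rewrite -subr_gt0 in H1; rewrite -subr_gt0 in H2.
have c := cvgM (cvgM (theta_cvg1 H1) (theta_cvg1 H2)) IH.
by rewrite !mulr1 in c; exact: c.
Qed.

Lemma rtest_bump Om a b k : cbox a b `<=` Om -> rtest Om (bump a b k).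
Proof.
move=> abO; split; first exact/smooth_algP/smooth_bump.
exists (cbox a b); split=> //; first exact: compact_cbox.
move=> x nx; apply: bump_supp => abx; apply: nx => i.
by have /andP[/ltW-> /ltW->] := abx i.
Qed.

Lemma obox_cbox a b : obox a b `<=` cbox a b.
Proof. by move=> x H i; have /andP[/ltW-> /ltW->] := H i. Qed.

Lemma cbox_lty a b : (mu (cbox a b) < +oo)%E.
Proof.
apply: lebesgue_bounded_lty; first exact: measurable_cbox.
exact: compact_bounded (@compact_cbox a b).
Qed.

Lemma obox_lty a b : (mu (obox a b) < +oo)%E.
Proof.
apply: le_lt_trans (cbox_lty a b); apply: le_measure; rewrite ?inE.
- exact: measurable_obox.
- exact: measurable_cbox.
- exact: obox_cbox.
Qed.

End test_functions.

Section box_sigma_algebra.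
Context {R : realType} {n : nat}.

Definition boxes : set (set 'rV[R]_n) := [set obox ab.1 ab.2 | ab in [set: 'rV[R]_n * 'rV[R]_n]].

Definition rV_max (a b : 'rV[R]_n) : 'rV[R]_n := \row_i Num.max (a 0 i) (b 0 i).
Definition rV_min (a b : 'rV[R]_n) : 'rV[R]_n := \row_i Num.min (a 0 i) (b 0 i).

Lemma oboxI a b c d : obox a b `&` obox c d = obox (rV_max a c) (rV_min b d).
Proof.
apply/seteqP; split => x /=.
  move=> [H1 H2] i; rewrite !mxE gt_max lt_min.
  by have /andP[-> ->] := H1 i; have /andP[-> ->] := H2 i.
move=> H; split => i; have := H i; rewrite !mxE gt_max lt_min.
  by move=> /andP[/andP[-> _] /andP[-> _]].
by move=> /andP[/andP[_ ->] /andP[_ ->]].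
Qed.

Lemma cboxI_sub a b c d : cbox (rV_max a c) (rV_min b d) `<=` cbox a b.
Proof.
move=> x H i; have := H i; rewrite !mxE ge_max le_min.
by move=> /andP[/andP[-> _] /andP[-> _]].
Qed.

Lemma boxesI : setI_closed boxes.
Proof.
move=> _ _ [[a b] _ <-] [[c d] _ <-] /=; rewrite oboxI.
by exists (rV_max a c, rV_min b d).
Qed.

Let gT := g_sigma_algebraType boxes.

Let coord_measurable (i : 'I_n) : measurable_fun [set: gT] (fun x : gT => (x : 'rV[R]_n) 0 i).
Proof.
apply: (measurability _ (RGenOInfty.measurableE R)) => //.
move=> _ [_ [a ->] <-]; rewrite setTI.
have -> : (fun x : gT => (x : 'rV[R]_n) 0 i) @^-1` `]a, +oo[ =
  \bigcup_k (obox (\row_j if j == i then a else - k.+1%:R) (const_mx (k.+1%:R)) : set gT).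
  apply/seteqP; split => x /=.
    rewrite in_itv/= andbT => ax; exists (Num.truncn `|x : 'rV[R]_n|) => // j.
    have H : `|(x : 'rV[R]_n) 0 j| < (Num.truncn `|x : 'rV[R]_n|).+1%:R.
      exact: le_lt_trans (coord_le_norm x j) (truncnS_gt _).
    move: H; rewrite ltr_norml !mxE => /andP[H1 ->]; rewrite andbT.
    by case: eqP => [->|].
  by move=> [k _ /(_ i)]; rewrite !mxE eqxx in_itv/= => /andP[->].
apply: bigcupT_measurable => k; apply: sub_sigma_algebra.
by exists (\row_j (if j == i then a else - k.+1%:R), const_mx (k.+1%:R)).
Qed.

(** A half-space is a countable union of boxes. *)
Lemma measurable_boxesE : @measurable _ 'rV[R]_n = <<s boxes >>.
Proof.
apply/seteqP; split.
  apply: smallest_sub; first exact: smallest_sigma_algebra.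
  move=> A; rewrite -bigcup_seq => -[i _ [B mB <-]].
  exact: (@coord_measurable i measurableT B mB).
apply: smallest_sub; first exact: sigma_algebra_measurable.
by move=> _ [ab _ <-]; exact: measurable_obox.
Qed.

End box_sigma_algebra.

Section du_bois_reymond.
Context {R : realType} {n : nat}.
Local Notation mu := (@lebesgue_rV R n).
Variables (Om : set 'rV[R]_n) (oO : open Om) (w : 'rV[R]_n -> R).
Hypothesis lw : l2 mu Om w.
Hypothesis w0 : forall f, rtest Om f -> \int[mu]_(x in Om) (w x * f x) = 0.

Let mOm : measurable Om. Proof. exact: open_rV_measurable. Qed.

Let l2_indic_obox a b : l2 mu Om (\1_(obox a b)).
Proof.
split; first by apply: measurable_indic; exact: measurable_obox.
rewrite (eq_integral (fun x => (\1_(obox a b) x)%:E)); last first.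
  by move=> x _; rewrite indicE; case: (x \in _); rewrite ?expr1n ?expr0n.
rewrite integral_indic//; last exact: measurable_obox.
apply: le_lt_trans (obox_lty a b); apply: le_measure; rewrite ?inE//.
- by apply: measurableI => //; exact: measurable_obox.
- exact: measurable_obox.
Qed.

Let w_obox_integrable a b : obox a b `<=` Om -> mu.-integrable (obox a b) (EFin \o w).
Proof.
move=> abO; have := l2_mul_integrable mOm lw (l2_indic_obox a b).
move/(integrableS mOm (measurable_obox a b) abO); apply: eq_integrable => //.
  exact: measurable_obox.
by move=> x xab; rewrite /= indicE xab mulr1.
Qed.

(** Dominated convergence along bumps that tend to the indicator of the box. *)
Let w_obox a b : cbox a b `<=` Om -> (\int[mu]_(x in obox a b) (w x)%:E = 0)%E.
Proof.
move=> abO; have obO : obox a b `<=` Om by apply: subset_trans abO; exact: obox_cbox.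
have i1 := l2_mul_integrable mOm lw (l2_indic_obox a b).
have mb k : measurable_fun Om (fun x => (w x * bump a b k x)%:E).
  apply/measurable_EFinP; apply: measurable_funM; first exact: lw.1.
  apply: measurable_funTS; apply: continuous_rV_measurable.
  exact: smooth_alg_continuous (smooth_bump _ _ _).
have bd x k : (`|(w x * bump a b k x)%:E| <= `|(w x * \1_(obox a b) x)%:E|)%E.
  rewrite /= lee_fin !normrM ler_wpM2l// indicE.
  case: (boolP (x \in obox a b)) => [_|]; first by rewrite normr1 ger0_norm ?bump_ge0// bump_le1.
  by rewrite notin_setE => nx; rewrite bump_supp// normr0.
have cv x : Om x -> (w x * bump a b k x)%:E @[k --> \oo] --> (w x * \1_(obox a b) x)%:E.
  move=> Ox; apply: cvg_EFin; first by near=> k.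
  apply: cvgM; first exact: cvg_cst.
  rewrite indicE; case: (boolP (x \in obox a b)) => [|]; first by rewrite inE; exact: bump_cvg.
  rewrite notin_setE => nx.
  rewrite (_ : (fun k => _) = fun=> 0); first exact: cvg_cst.
  by apply/funext => k; rewrite /= bump_supp.
have [_ _] := @dominated_convergence _ _ _ mu Om mOm
  (fun k x => (w x * bump a b k x)%:E) (fun x => (w x * \1_(obox a b) x)%:E)
  (fun x => `|(w x * \1_(obox a b) x)%:E|%E) mb (measurable_int _ i1) (aeW _ cv)
  (integrable_abse i1) (aeW _ (fun x k _ => bd x k)).
rewrite (_ : [sequence _]_n = fun=> 0%E); last first.
  apply/funext => k /=; rewrite -[LHS]fineK.
    by rewrite -/(Rintegral mu Om _) w0//; exact: rtest_bump.
  apply: integrable_fin_num => //.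
  by apply: le_integrable i1 => // x _; exact: bd.
move=> /cvg_lim; rewrite lim_cst// => /(_ _)/esym H.
rewrite -[RHS]H// [RHS]integral_mkcond [LHS]integral_mkcond.
apply: eq_integral => x _; rewrite !patchE indicE.
have [xab|xab] := boolP (x \in obox a b).
  by rewrite mem_set ?mulr1//; apply: obO; rewrite inE in xab.
by rewrite mulr0; case: ifP.
Unshelve. all: by end_near. Qed.

(** Boxes generate the sigma-algebra and are stable under intersection, so w has
    integral 0 over every measurable part of the box, in particular over the
    part where it is nonnegative and over its complement. *)
Let w_ae_obox a b : cbox a b `<=` Om -> {ae mu, forall x, obox a b x -> w x = 0}.
Proof.
move=> abO; have obO : obox a b `<=` Om by apply: subset_trans abO; exact: obox_cbox.
set Q := obox a b; have mQ : measurable Q by exact: measurable_obox.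
have iw : mu.-integrable Q (EFin \o w) by exact: w_obox_integrable.
have iS A : measurable A -> mu.-integrable (Q `&` A) (EFin \o w).
  by move=> mA; apply: integrableS iw => //; exact: measurableI.
have key A : measurable A -> (\int[mu]_(x in Q `&` A) (w x)%:E = 0)%E.
  rewrite measurable_boxesE; move: A; apply: (dynkin_induction measurable_boxesE boxesI).
  - by rewrite setIT; exact: w_obox.
  - move=> _ [[c d] _ <-] /=; rewrite oboxI; apply: w_obox.
    by apply: subset_trans abO; exact: cboxI_sub.
  - move=> A mA IA; have := w_obox abO; rewrite -/Q -{1}(setIT Q) -(setUv A) setIUr.
    have mQA := measurableI _ _ mQ mA.
    have mQA' := measurableI _ _ mQ (measurableC mA).
    rewrite integral_setU//; first by rewrite IA add0e.
      by rewrite -setIUr setUv setIT; exact: measurable_int iw.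
    by apply/disj_setPS => x [[_ ?] [_ ?]].
  - move=> F mF tF IF; rewrite setI_bigcupr integral_bigcup//.
    + by rewrite eseries0// => k _ _; exact: IF.
    + exact: trivIset_setIl.
    + by move=> k; exact: measurableI.
    + by rewrite -setI_bigcupr; apply: iS; exact: bigcupT_measurable.
have mw : measurable_fun Q w by apply: measurable_funS mOm obO lw.1.
have : (\int[mu]_(x in Q) `|(w x)%:E| = 0)%E.
  pose P := Q `&` w @^-1` `[0, +oo[.
  have mP : measurable P by apply: mw => //; exact: measurable_itv.
  have mQP := measurableI _ _ mQ mP.
  have mQP' := measurableI _ _ mQ (measurableC mP).
  rewrite -(setIT Q) -(setUv P) setIUr ge0_integral_setU//; last 2 first.
  - rewrite -setIUr setUv setIT; apply: measurableT_comp => //.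
    exact: measurable_int iw.
  - by apply/disj_setPS => x [[_ ?] [_ ?]].
  rewrite [X in (X + _)%E](_ : _ = \int[mu]_(x in Q `&` P) (w x)%:E)%E; last first.
    apply: eq_integral => x; rewrite inE => -[_ [_ /=]]; rewrite in_itv/= andbT => ?.
    by rewrite ger0_norm.
  rewrite [X in (_ + X)%E](_ : _ = \int[mu]_(x in Q `&` ~` P) (- (w x)%:E))%E; last first.
    apply: eq_integral => x; rewrite inE => -[Qx nP]; rewrite /= ltr0_norm//.
    by rewrite ltNge; apply/negP => wx; apply: nP; split=> //=; rewrite in_itv/= wx.
  rewrite integralN/=; last first.
    rewrite fin_num_adde_defl// fin_numN; apply: integrable_neg_fin_num => //.
    by apply: iS; exact: measurableC.
  by rewrite (key _ mP) (key _ (measurableC mP)) oppe0 adde0.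
move/ae_eq_integral_abs => /(_ mQ)H.
have {}H := H (measurable_int _ iw).
by apply: filterS H => x /= H Qx; have [] := H Qx.
Qed.

(** The fundamental lemma of the calculus of variations; Om is a countable union
    of boxes. *)
Lemma du_bois_reymond : {ae mu, forall x, Om x -> w x = 0}.
Proof.
pose N := ~` [set x | Om x -> w x = 0].
pose F k : set 'rV[R]_n := if (unpickle k : option ('rV[rat]_n * 'rV[rat]_n)%type) is Some ab then
   if `[< cbox (map_mx ratr ab.1) (map_mx ratr ab.2) `<=` Om >]
   then ~` [set x : 'rV[R]_n | obox (map_mx ratr ab.1) (map_mx ratr ab.2) x -> w x = 0]
   else set0 else set0.
apply: (@negligibleS _ _ _ _ (\bigcup_k F k)); last first.
  apply: negligible_bigcup => k; rewrite /F; case: unpickle => [ab|]; last exact: negligible_set0.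
  by case: asboolP => abO; [exact: w_ae_obox|exact: negligible_set0].
move=> x /= /not_implyP[Ox wx]; have [ab [xab abO]] := open_box oO Ox.
exists (pickle ab) => //; rewrite /F pickleK; case: asboolP => // _ /=.
by apply/not_implyP.
Qed.

End du_bois_reymond.

(** * The closure of the test functions in the energy norm *)

Section test_function_calculus.
Context {R : realType} {n : nat}.
Local Notation mu := (@lebesgue_rV R n).
Implicit Types (f g : 'rV[R]_n -> R) (Om : set 'rV[R]_n).

Lemma smooth_partial f j : smooth f -> smooth (partial j f).
Proof. by move=> sf s; have := sf (rcons s j); rewrite foldr_rcons. Qed.

Lemma rtest_partial Om f j : rtest Om f -> rtest Om (partial j f).
Proof.
move=> [sf [K [cK KO fK]]]; split; first exact: smooth_partial.
exists K; split=> // x nKx.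
have oK : open (~` K) by apply: closed_openC; exact: compact_closed.
have : nbhs x (~` K) by exact: open_nbhs_nbhs.
move=> nb; rewrite /partial (@near_eq_derive _ _ _ f (cst 0)) ?derive_cst//.
by apply: filterS nb => y /fK.
Qed.

Lemma rtest_C0c Om f : rtest Om f -> C0c f.
Proof.
move=> [sf [K [/compact_bounded/bounded_setP[M M0 KM] _ fK]]].
split; first by have [] := sf [::].
by exists M => x Mx; apply: fK => /KM; rewrite ltNge Mx.
Qed.

Lemma rtest_C1c Om f : rtest Om f -> C1c f.
Proof.
move=> tf; split; first exact: rtest_C0c tf.
move=> j; split; first by move=> x; have [sf _] := tf; have [_] := sf [::]; apply.
exact: rtest_C0c (rtest_partial j tf).
Qed.

Lemma rtest_out Om f x : rtest Om f -> ~ Om x -> f x = 0.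
Proof. by move=> [_ [K [_ KO fK]]] nO; apply: fK => /KO. Qed.

Lemma smoothD f g : smooth f -> smooth g -> smooth (fun x => f x + g x).
Proof.
move=> sf sg s /=.
have -> : foldr partial (fun x => f x + g x) s = fun x => foldr partial f s x + foldr partial g s x.
  elim: s => //= j s ->; apply/funext => x; rewrite /partial.
  by rewrite (@deriveD _ _ _ (foldr partial f s) (foldr partial g s))//;
    [exact: (sf s).2|exact: (sg s).2].
split=> [x|j x].
  by apply: (@continuousD _ _ _ (foldr partial f s) (foldr partial g s));
    [exact: (sf s).1|exact: (sg s).1].
by apply: (@derivableD _ _ _ (foldr partial f s) (foldr partial g s));
    [exact: (sf s).2|exact: (sg s).2].
Qed.

Lemma smoothZ (c : R) f : smooth f -> smooth (fun x => c * f x).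
Proof.
move=> sf s /=.
have -> : foldr partial (fun x => c * f x) s = fun x => c * foldr partial f s x.
  elim: s => //= j s ->; apply/funext => x; rewrite /partial.
  by rewrite (@deriveZ _ _ _ (foldr partial f s) c)//; exact: (sf s).2.
split=> [x|j x].
  exact: (cvgM (cvg_cst c) ((sf s).1 x)).
by apply: (@derivableZ _ _ _ (foldr partial f s) c); exact: (sf s).2.
Qed.

Lemma rtestD Om f g : rtest Om f -> rtest Om g -> rtest Om (f + g).
Proof.
move=> [sf [K [cK KO fK]]] [sg [L [cL LO gL]]]; split; first exact: smoothD.
exists (K `|` L); split; [exact: compactU|by move=> x [/KO|/LO]|].
move=> x nKL; have fx : f x = 0 by apply: fK => Kx; apply: nKL; left.
have gx : g x = 0 by apply: gL => Kx; apply: nKL; right.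
by rewrite -[LHS]/(f x + g x) fx gx addr0.
Qed.

Lemma rtestZ Om (c : R) f : rtest Om f -> rtest Om (c *: f).
Proof.
move=> [sf [K [cK KO fK]]]; split; first exact: smoothZ.
by exists K; split=> // x nKx; rewrite -[LHS]/(c * f x) fK ?mulr0.
Qed.

Lemma partialD f g j x : smooth f -> smooth g ->
  partial j (f + g) x = partial j f x + partial j g x.
Proof. by move=> sf sg; rewrite /partial deriveD//; [exact: (sf [::]).2|exact: (sg [::]).2]. Qed.

Lemma partialZ (c : R) f j x : smooth f -> partial j (c *: f) x = c * partial j f x.
Proof. by move=> sf; rewrite /partial deriveZ//; exact: (sf [::]).2. Qed.

End test_function_calculus.

Section sobolev_space.
Context {R : realType} {n : nat}.
Local Notation mu := (@lebesgue_rV R n).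
Variables (Om : set 'rV[R]_n) (oO : open Om).
Let mOm : measurable Om. Proof. exact: open_rV_measurable. Qed.
Hint Resolve mOm : core.

(** A function, at None, and candidates for its partial derivatives, at Some j.
    No relation is imposed between them, so that limits of functions together
    with their gradients can be taken componentwise. *)
Definition jet := option 'I_n -> 'rV[R]_n -> R.
Implicit Types (U V : jet) (f : 'rV[R]_n -> R).

Definition jet_of f : jet := fun o => if o is Some j then partial j f else f.

Definition l2jet U := forall o, l2 mu Om (U o).

Definition jsqn U : R := \sum_o sqn mu Om (U o).

(** The elements of H^1_0, each with its gradient. *)
Definition sobolev : set jet := [set U | l2jet U /\
  forall e : R, 0 < e -> exists2 f, rtest Om f & jsqn (U - jet_of f) < e].

Lemma C0c_l2 f : C0c f -> l2 mu Om f.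
Proof.
move=> cf; split; first by apply: measurable_funTS; exact: C0c_measurable.
apply: integrable_lty => //; apply: (@integrableS _ _ _ mu setT) => //.
exact: C0c_integrable (C0c_sqr cf).
Qed.

Lemma jet_of_C0c f o : rtest Om f -> C0c (jet_of f o).
Proof. by case: o => [j|] tf; [exact: rtest_C0c (rtest_partial j tf)|exact: rtest_C0c tf]. Qed.

Lemma jet_of_l2 f : rtest Om f -> l2jet (jet_of f).
Proof. by move=> tf o; apply: C0c_l2; exact: jet_of_C0c. Qed.

Lemma jet_ofD f g : rtest Om f -> rtest Om g -> jet_of (f + g) = jet_of f + jet_of g.
Proof.
move=> [sf _] [sg _]; apply/funext => -[j|] //; apply/funext => x.
exact: partialD.
Qed.

Lemma jet_ofZ (c : R) f : rtest Om f -> jet_of (c *: f) = c *: jet_of f.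
Proof.
move=> [sf _]; apply/funext => -[j|] //; apply/funext => x.
exact: partialZ.
Qed.

Lemma jet_ofB f g : rtest Om f -> rtest Om g -> jet_of (f - g) = jet_of f - jet_of g.
Proof.
move=> tf tg; rewrite -scaleN1r jet_ofD//; last exact: rtestZ.
by rewrite jet_ofZ// scaleN1r.
Qed.

Lemma l2jetD U V : l2jet U -> l2jet V -> l2jet (U + V).
Proof. by move=> lU lV o; apply: l2D. Qed.

Lemma l2jetZ (c : R) U : l2jet U -> l2jet (c *: U).
Proof. by move=> lU o; apply: l2Z. Qed.

Lemma l2jetB U V : l2jet U -> l2jet V -> l2jet (U - V).
Proof. by move=> lU lV; rewrite -scaleN1r; apply: l2jetD => //; exact: l2jetZ. Qed.

Lemma jsqn_ge0 U : 0 <= jsqn U.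
Proof. by apply: sumr_ge0 => o _; exact: sqn_ge0. Qed.

Lemma sqn_le_jsqn U o : sqn mu Om (U o) <= jsqn U.
Proof. by rewrite /jsqn (bigD1 o)//= lerDl sumr_ge0// => i _; exact: sqn_ge0. Qed.

Lemma sobolev_jet_of f : rtest Om f -> sobolev (jet_of f).
Proof.
move=> tf; split; first exact: jet_of_l2.
move=> e e0; exists f => //; rewrite subrr /jsqn big1// => o _.
by rewrite /sqn Rintegral_eq0// => x _; rewrite /= expr0n.
Qed.

(** The bound may depend on Z: these forms are only used through limits in one of
    their arguments. *)
Record bform (F : jet -> jet -> R) : Prop := BForm {
  bformDl : forall U V Z, l2jet U -> l2jet V -> l2jet Z -> F (U + V) Z = F U Z + F V Z;
  bformZl : forall (c : R) U Z, l2jet U -> l2jet Z -> F (c *: U) Z = c * F U Z;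
  bformC : forall U V, F U V = F V U;
  bform_bound : forall Z, l2jet Z -> exists K : R, forall U, l2jet U -> F U Z ^+ 2 <= K * jsqn U
}.

Lemma bform_ip (w : 'rV[R]_n -> R) (C : R) o : measurable_fun Om w ->
  (forall x, Om x -> `|w x| <= C) -> bform (fun U V => ip mu Om w (U o) (V o)).
Proof.
move=> mw wC; split.
- by move=> U V Z lU lV lZ; apply: ipDl mw wC _ _ _ _ _ _.
- by move=> c U Z lU lZ; apply: ipZl mw wC _ _ _ _ _.
- by move=> U V; exact: ipC.
- move=> Z lZ; exists (C ^+ 2 * sqn mu Om (Z o)) => U lU.
  apply: le_trans (ip_bound mOm mw wC (lU o) (lZ o)) _.
  rewrite mulrAC ler_wpM2l ?sqn_le_jsqn//.
  by rewrite mulr_ge0 ?sqr_ge0// sqn_ge0.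
Qed.

Lemma bformD F G : bform F -> bform G -> bform (fun U V => F U V + G U V).
Proof.
move=> [FD FZ FC FB] [GD GZ GC GB]; split.
- by move=> U V Z lU lV lZ; rewrite FD// GD//; ring.
- by move=> c U Z lU lZ; rewrite FZ// GZ//; ring.
- by move=> U V; rewrite FC GC.
- move=> Z lZ; have [K HK] := FB Z lZ; have [L HL] := GB Z lZ.
  exists (2 * K + 2 * L) => U lU.
  have := HK U lU; have := HL U lU; have := sqr_ge0 (F U Z - G U Z).
  by rewrite sqrrB sqrrD; lra.
Qed.

Lemma bformZ (c : R) F : bform F -> bform (fun U V => c * F U V).
Proof.
move=> [FD FZ FC FB]; split.
- by move=> U V Z lU lV lZ; rewrite FD//; ring.
- by move=> d U Z lU lZ; rewrite FZ//; ring.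
- by move=> U V; rewrite FC.
- move=> Z lZ; have [K HK] := FB Z lZ; exists (c ^+ 2 * K) => U lU.
  by rewrite exprMn -mulrA ler_wpM2l ?sqr_ge0// HK.
Qed.

Lemma bform0 : bform (fun _ _ => 0).
Proof.
split=> //; first by rewrite addr0.
- by move=> *; rewrite mulr0.
- by move=> Z _; exists 0 => U _; rewrite expr0n mul0r.
Qed.

Lemma bform_sum (I : Type) (s : seq I) (F : I -> jet -> jet -> R) :
  (forall i, bform (F i)) -> bform (fun U V => \sum_(i <- s) F i U V).
Proof.
move=> bF; elim: s => [|i s IH].
  rewrite (_ : (fun U V => _) = fun _ _ => 0); first exact: bform0.
  by apply/funext => U; apply/funext => V; rewrite big_nil.
rewrite (_ : (fun U V => _) = fun U V => F i U V + \sum_(i <- s) F i U V); first exact: bformD.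
by apply/funext => U; apply/funext => V; rewrite big_cons.
Qed.

(** This is the shape of the penalty on the eigenfunctions already found. *)
Lemma bform_rank1 F Z : bform F -> l2jet Z -> bform (fun U V => F U Z * F V Z).
Proof.
move=> [FD FZ FC FB] lZ; split.
- by move=> U V Y lU lV lY; rewrite FD//; ring.
- by move=> d U Y lU lY; rewrite FZ//; ring.
- by move=> U V; rewrite mulrC.
- move=> Y lY; have [K HK] := FB Z lZ; exists (F Y Z ^+ 2 * K) => U lU.
  by rewrite exprMn mulrC -mulrA ler_wpM2l ?sqr_ge0// HK.
Qed.

Section bform_theory.
Variables (F : jet -> jet -> R) (bF : bform F).

Lemma bformDr U V Z : l2jet U -> l2jet V -> l2jet Z -> F Z (U + V) = F Z U + F Z V.
Proof. by move=> lU lV lZ; rewrite bformC// bformDl// !(bformC bF Z). Qed.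

Lemma bformZr (c : R) U Z : l2jet U -> l2jet Z -> F Z (c *: U) = c * F Z U.
Proof. by move=> lU lZ; rewrite bformC// bformZl// !(bformC bF Z). Qed.

Lemma bformBl U V Z : l2jet U -> l2jet V -> l2jet Z -> F (U - V) Z = F U Z - F V Z.
Proof.
move=> lU lV lZ; rewrite -scaleN1r bformDl//; last exact: l2jetZ.
by rewrite bformZl// mulN1r.
Qed.

Lemma bformBr U V Z : l2jet U -> l2jet V -> l2jet Z -> F Z (U - V) = F Z U - F Z V.
Proof. by move=> lU lV lZ; rewrite bformC// bformBl// !(bformC bF Z). Qed.

Lemma bform_parallelogram U V : l2jet U -> l2jet V ->
  F (U + V) (U + V) + F (U - V) (U - V) = 2 * F U U + 2 * F V V.
Proof.
move=> lU lV; have lD := l2jetD lU lV; have lB := l2jetB lU lV.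
rewrite bformDl// bformBl// !bformBr// !bformDr// (bformC bF V U); ring.
Qed.

Lemma bform_homogeneous (c : R) U : l2jet U -> F (c *: U) (c *: U) = c ^+ 2 * F U U.
Proof. by move=> lU; rewrite bformZl ?bformZr//; [ring|exact: l2jetZ]. Qed.

(** Positivity is asked on combinations of U and V only, since the shifted form of
    the minimisation is known to be nonnegative on test functions only. *)
Lemma bform_cauchy_schwarz U V : l2jet U -> l2jet V ->
  (forall c : R, 0 <= F (U - c *: V) (U - c *: V)) -> 0 <= F V V ->
  F U V ^+ 2 <= F V V * F U U.
Proof.
move=> lU lV F0 FV; apply: discriminant_le => // c.
have lc := l2jetZ c lV.
have := F0 c; have lB := l2jetB lU lc.
rewrite bformBl// !bformBr// !bformZl// !bformZr// (bformC bF V U); lra.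
Qed.

(** In F U Z = F (U - V) Z + F V Z both terms are small. *)
Lemma bform_approx0 U Z : l2jet U -> l2jet Z ->
  (forall e : R, 0 < e -> exists V, [/\ l2jet V, jsqn (U - V) < e & F V Z ^+ 2 < e]) ->
  F U Z = 0.
Proof.
move=> lU lZ H; have [K HK] := bform_bound bF lZ.
have K0 : 0 < `|K| + 1 by rewrite ltr_wpDl.
apply/eqP; rewrite -sqrf_eq0 eq_le sqr_ge0 andbT.
apply/ler_addgt0Pl => e e0; rewrite addr0.
pose e' := e / (2 * (`|K| + 1) + 2).
have D0 : 0 < 2 * (`|K| + 1) + 2 by lra.
have [V [lV UV FV]] := H _ (divr_gt0 e0 D0); rewrite -/e' in UV FV.
have h1 := HK _ (l2jetB lU lV); rewrite bformBl// in h1.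
have h2 : K * jsqn (U - V) <= (`|K| + 1) * e'.
  apply: (@le_trans _ _ ((`|K| + 1) * jsqn (U - V))).
    by rewrite ler_wpM2r ?jsqn_ge0// (le_trans (ler_norm _))// lerDl.
  by rewrite ler_wpM2l ?ltW.
have h4 : e = 2 * ((`|K| + 1) * e') + 2 * e' by rewrite /e'; field; lra.
have key (x y k A B : R) : x ^+ 2 <= k -> k <= A -> y ^+ 2 < B -> (x + y) ^+ 2 <= 2 * A + 2 * B.
  by move=> ? ? ?; have := sqr_ge0 (x - y); rewrite sqrrB sqrrD; lra.
by rewrite h4 -(subrK (F V Z) (F U Z)); exact: key h1 h2 FV.
Qed.

End bform_theory.

Lemma sobolev_complete (f : nat -> 'rV[R]_n -> R) : (forall k, rtest Om (f k)) ->
  (forall k l o, (k <= l)%N -> sqn mu Om (jet_of (f k - f l) o) <= 8 ^- k) ->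
  exists2 U, sobolev U & forall k, jsqn (U - jet_of (f k)) <= n.+1%:R * 8 ^- k.
Proof.
move=> tf cf.
have /choice[U HU] o : exists u, l2 mu Om u /\
    forall k, sqn mu Om (fun x => jet_of (f k) o x - u x) <= 8 ^- k.
  have [||u lu Hu] := @l2_complete _ _ _ mu Om mOm (fun k => jet_of (f k) o).
  - by move=> k; exact: jet_of_l2.
  - by move=> k l kl; have := cf k l o kl; rewrite jet_ofB.
  - by exists u.
have UB k : jsqn (U - jet_of (f k)) <= n.+1%:R * 8 ^- k.
  rewrite /jsqn; apply: (@le_trans _ _ (\sum_(o : option 'I_n) 8 ^- k)).
    by apply: ler_sum => o _; rewrite [leLHS]sqn_sym; exact: (HU o).2.
  by rewrite sumr_const card_option card_ord mulr_natl.
exists U => //; split; first by move=> o; exact: (HU o).1.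
move=> e e0; pose k := Num.truncn (n.+1%:R / e).
exists (f k) => //; apply: le_lt_trans (UB k) _.
rewrite ltr_pdivrMr ?exprn_gt0// mulrC -ltr_pdivrMr//.
apply: (@lt_le_trans _ _ (k.+1%:R)); first exact: truncnS_gt.
by rewrite -natrX ler_nat ltn_expl.
Qed.

(** The two sides differ by a continuous functional of U that vanishes on test
    functions, by [integration_by_parts_rV]. *)
Lemma sobolev_ibp U g j : sobolev U -> rtest Om g ->
  \int[mu]_(x in Om) (U None x * partial j g x) = - \int[mu]_(x in Om) (U (Some j) x * g x).
Proof.
move=> [lU aU] tg.
pose dg := partial j g.
have cg := rtest_C0c tg; have cdg : C0c dg by exact: rtest_C0c (rtest_partial j tg).
have lg := C0c_l2 cg; have ldg := C0c_l2 cdg.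
pose B V := \int[mu]_(x in Om) (V None x * dg x) + \int[mu]_(x in Om) (V (Some j) x * g x).
suff : B U = 0 by move=> /eqP; rewrite addr_eq0 => /eqP.
have B0 f : rtest Om f -> B (jet_of f) = 0.
  move=> tf; have := integration_by_parts_rV j (rtest_C1c tf) (rtest_C1c tg).
  move/eqP; rewrite -addr_eq0 => /eqP <-; rewrite /B; congr (_ + _).
    rewrite [LHS]Rintegral_mkcond; apply: eq_Rintegral => x _; rewrite patchE.
    by case: ifPn => //; rewrite notin_setE => nx; rewrite (rtest_out tf nx) mul0r.
  rewrite [LHS]Rintegral_mkcond; apply: eq_Rintegral => x _; rewrite patchE mulrC.
  by case: ifPn => //; rewrite notin_setE => nx; rewrite (rtest_out tg nx) mul0r.
have BB V W : l2jet V -> l2jet W -> B (V - W) = B V - B W.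
  move=> lV lW; rewrite /B; set a := LHS.
  have -> : a = (\int[mu]_(x in Om) (V None x * dg x) - \int[mu]_(x in Om) (W None x * dg x))
    + (\int[mu]_(x in Om) (V (Some j) x * g x) - \int[mu]_(x in Om) (W (Some j) x * g x)).
    rewrite -!RintegralB//; [|exact: l2_mul_integrable..].
    by congr (_ + _); apply: eq_Rintegral => x _; rewrite -mulrBl.
  by ring.
have Bb V : l2jet V -> B V ^+ 2 <= (2 * (sqn mu Om dg + sqn mu Om g)) * jsqn V.
  move=> lV; have h1 := cauchy_schwarz mOm (lV None) ldg.
  have h2 := cauchy_schwarz mOm (lV (Some j)) lg.
  have h3 : sqn mu Om (V None) * sqn mu Om dg <= jsqn V * sqn mu Om dg.
    by rewrite ler_wpM2r ?sqn_ge0// sqn_le_jsqn.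
  have h4 : sqn mu Om (V (Some j)) * sqn mu Om g <= jsqn V * sqn mu Om g.
    by rewrite ler_wpM2r ?sqn_ge0// sqn_le_jsqn.
  rewrite /B; move: h1 h2; set x := Rintegral _ _ _; set y := Rintegral _ _ _ => h1 h2.
  by have := sqr_ge0 (x - y); rewrite sqrrB sqrrD; lra.
apply/eqP; rewrite -sqrf_eq0 eq_le sqr_ge0 andbT.
apply/ler_addgt0Pl => e e0; rewrite addr0.
set K := 2 * (sqn mu Om dg + sqn mu Om g) in Bb.
have K0 : 0 <= K by rewrite mulr_ge0// addr_ge0// sqn_ge0.
have K1 : 0 < K + 1 by rewrite ltr_wpDl.
have [f tf Uf] := aU _ (divr_gt0 e0 K1).
have lf := jet_of_l2 tf.
have := Bb _ (l2jetB lU lf); rewrite BB// B0// subr0 => h; apply: (le_trans h).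
have h1 : jsqn (U - jet_of f) * (K + 1) <= e by rewrite -ler_pdivlMr// ltW.
have := jsqn_ge0 (U - jet_of f); lra.
Qed.

End sobolev_space.

(** * Real eigenfunctions below a given level *)

Section weighted_bounds.
Context d (T : measurableType d) (R : realType) (mu : {measure set T -> \bar R}).
Variables (D : set T) (mD : measurable D) (w : T -> R) (c C : R).
Hypotheses (mw : measurable_fun D w) (c0 : 0 < c).
Hypothesis wcC : forall x, D x -> c <= w x <= C.

Lemma weight_bounded x : D x -> `|w x| <= C.
Proof. by move=> Dx; have /andP[h1 h2] := wcC Dx; rewrite ger0_norm// (le_trans (ltW c0)). Qed.

Let i1 f : l2 mu D f -> mu.-integrable D (EFin \o (fun x => w x * (f x * f x))).
Proof. by move=> lf; exact: (ip_integrable mD mw weight_bounded lf lf). Qed.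

Lemma ip_ge f : l2 mu D f -> c * sqn mu D f <= ip mu D w f f.
Proof.
move=> lf; rewrite /sqn -RintegralZl//; last exact: l2_sqr_integrable.
apply: le_Rintegral => //.
- by have := integrableZl mD c (l2_sqr_integrable lf); apply: eq_integrable.
- exact: i1.
move=> x Dx; rewrite -expr2 ler_wpM2r ?sqr_ge0//.
by have /andP[] := wcC Dx.
Qed.

Lemma ip_le f : l2 mu D f -> ip mu D w f f <= C * sqn mu D f.
Proof.
move=> lf; rewrite /sqn /ip -RintegralZl//; last exact: l2_sqr_integrable.
apply: le_Rintegral => //; first exact: (i1 lf).
  by have := integrableZl mD C (l2_sqr_integrable lf); apply: eq_integrable.
move=> x Dx; rewrite -expr2 ler_wpM2r ?sqr_ge0//.
by have /andP[] := wcC Dx.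
Qed.

End weighted_bounds.

Lemma left_kernel_vector (F : fieldType) p m (A : 'M[F]_(p, m)) : (m < p)%N ->
  exists2 t : 'rV[F]_p, t != 0 & t *m A = 0.
Proof.
move=> mp; have : kermx A != 0.
  rewrite -mxrank_eq0 mxrank_ker subn_eq0 -ltnNge.
  exact: leq_ltn_trans (rank_leq_col A) mp.
by move=> /rowV0Pn[t /sub_kermxP tA t0]; exists t.
Qed.

Section eigenpairs.
Context {R : realType} {n : nat}.
Local Notation mu := (@lebesgue_rV R n).
Variables (Om : set 'rV[R]_n) (oO : open Om) (M : R).
Hypothesis OmM : forall x, Om x -> `|x| < M.
Hypothesis M0 : 0 < M.
Variables (a b : 'rV[R]_n -> R) (c C : R).
Hypotheses (ma : measurable_fun Om a) (mb : measurable_fun Om b).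
Hypotheses (c0 : 0 < c) (aC : forall x, Om x -> c <= a x <= C).
Hypothesis bC : forall x, Om x -> c <= b x <= C.
Let mOm : measurable Om. Proof. exact: open_rV_measurable. Qed.
Hint Resolve mOm : core.
Local Notation jet := (@jet R n).
Implicit Types (U V : jet) (f v : 'rV[R]_n -> R).

Definition mass U V : R := ip mu Om b (U None) (V None).
Definition stiff U V : R := \sum_(j <- index_enum 'I_n) ip mu Om a (U (Some j)) (V (Some j)).

Lemma bform_mass : bform Om mass.
Proof. exact: (bform_ip oO None mb (weight_bounded c0 bC)). Qed.

Lemma bform_stiff : bform Om stiff.
Proof. by apply: bform_sum => j; exact: (bform_ip oO (Some j) ma (weight_bounded c0 aC)). Qed.

Lemma mass_ge U : l2jet Om U -> c * sqn mu Om (U None) <= mass U U.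
Proof. by move=> lU; exact: (ip_ge mOm mb c0 bC (lU None)). Qed.

Lemma mass_ge0 U : l2jet Om U -> 0 <= mass U U.
Proof. by move=> /mass_ge; apply: le_trans; rewrite mulr_ge0 ?(ltW c0)// sqn_ge0. Qed.

Lemma stiff_ge U : l2jet Om U -> c * \sum_j sqn mu Om (U (Some j)) <= stiff U U.
Proof.
by move=> lU; rewrite mulr_sumr; apply: ler_sum => j _; exact: (ip_ge mOm ma c0 aC (lU (Some j))).
Qed.

Lemma stiff_ge0 U : l2jet Om U -> 0 <= stiff U U.
Proof.
move=> /stiff_ge; apply: le_trans; rewrite mulr_ge0 ?(ltW c0)// sumr_ge0// => j _.
exact: sqn_ge0.
Qed.

Let Rint_test f : rtest Om f -> \int[mu]_x (f x ^+ 2) = sqn mu Om f.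
Proof.
move=> tf; rewrite /sqn [RHS]Rintegral_mkcond; apply: eq_Rintegral => x _.
rewrite patchE; case: ifPn => //; rewrite notin_setE => nx.
by rewrite (rtest_out tf nx) expr0n.
Qed.

Section step.
Variables (p : nat) (E : nat -> jet) (lam : nat -> R) (nuM : R).
Hypothesis sE : forall i, (i < p)%N -> sobolev Om (E i).
Hypothesis oE : forall i j, (i < p)%N -> (j < p)%N -> mass (E i) (E j) = (i == j)%:R.
Hypothesis eE : forall i, (i < p)%N -> [/\ 0 <= lam i, lam i <= nuM &
  forall V, sobolev Om V -> stiff (E i) V = lam i * mass (E i) V].
Hypothesis nuM0 : 0 <= nuM.
Variable v : 'rV[R]_n -> R.
Hypothesis tv : rtest Om v.
Hypothesis vE : forall i, (i < p)%N -> mass (jet_of v) (E i) = 0.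
Hypothesis v0 : 0 < mass (jet_of v) (jet_of v).
Hypothesis vR : stiff (jet_of v) (jet_of v) <= nuM * mass (jet_of v) (jet_of v).

Let pen U V := stiff U V +
  (nuM + 1) * \sum_(i <- index_enum 'I_p) mass U (E i) * mass V (E i).

Let bpen : bform Om pen.
Proof.
apply: bformD; first exact: bform_stiff.
apply: bformZ; apply: bform_sum => i; apply: bform_rank1; first exact: bform_mass.
exact: (sE (ltn_ord i)).1.
Qed.

Let pen_ge U : stiff U U <= pen U U.
Proof.
rewrite lerDl mulr_ge0 ?addr_ge0// sumr_ge0// => i _.
by rewrite -expr2 sqr_ge0.
Qed.

(** U minimises stiff U U + (nuM + 1) * \sum_i mass U (E i) ^+ 2 among functions
    of unit mass. The penalty vanishes on v, so the minimum nu is at most nuM.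
    The Euler-Lagrange equation of U tested with E i reads
    (lam i + nuM + 1 - nu) * mass U (E i) = 0, whose first factor is positive.
    So U is orthogonal to the E i, and the penalty drops out of its equation. *)
Lemma next_eigenpair : exists U nu, [/\ sobolev Om U, 0 <= nu <= nuM,
  mass U U = 1, forall i, (i < p)%N -> mass U (E i) = 0 &
  forall V, sobolev Om V -> stiff U V = nu * mass U V].
Proof.
pose D := [set f | rtest Om f].
have Djet f : D f -> l2jet Om (jet_of f) by exact: jet_of_l2.
pose Qb f := mass (jet_of f) (jet_of f); pose QJ f := pen (jet_of f) (jet_of f).
have bm := bform_mass.
pose e k : R := c * 8 ^- k.
have e0 k : 0 < e k by rewrite mulr_gt0// invr_gt0 exprn_gt0.
have HDD f g : D f -> D g -> D (f + g) by exact: rtestD.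
have HDZ t f : D f -> D (t *: f) by exact: rtestZ.
have Qb0 f : D f -> 0 <= Qb f by move=> Df; apply: mass_ge0; exact: Djet.
have QJ0 f : D f -> 0 <= QJ f.
  by move=> Df; apply: le_trans (pen_ge _); apply: stiff_ge0; exact: Djet.
have QbZ t f : D f -> Qb (t *: f) = t ^+ 2 * Qb f.
  by move=> Df; rewrite /Qb (jet_ofZ t Df) (bform_homogeneous oO bm)//; exact: Djet.
have QJZ t f : D f -> QJ (t *: f) = t ^+ 2 * QJ f.
  by move=> Df; rewrite /QJ (jet_ofZ t Df) (bform_homogeneous oO bpen)//; exact: Djet.
have Qbpar f g : D f -> D g -> Qb (f + g) + Qb (f - g) = 2 * Qb f + 2 * Qb g.
  by move=> Df Dg; rewrite /Qb (jet_ofD Df Dg) (jet_ofB Df Dg) (bform_parallelogram oO bm)//; exact: Djet.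
have QJpar f g : D f -> D g -> QJ (f + g) + QJ (f - g) = 2 * QJ f + 2 * QJ g.
  by move=> Df Dg; rewrite /QJ (jet_ofD Df Dg) (jet_ofB Df Dg) (bform_parallelogram oO bpen)//; exact: Djet.
(* compactness, with the norm and the gradient replaced by mass and penalised energy *)
have rellich : forall delta : R, 0 < delta -> exists (I : finType) (l : I -> ('rV[R]_n -> R) -> R) (C : R),
  [/\ forall i u v, D u -> D v -> l i (u - v) = l i u - l i v,
      forall i u, D u -> l i u ^+ 2 <= C * Qb u &
      forall u, D u -> Qb u <= delta * QJ u + \sum_i l i u ^+ 2].
  move=> delta d0.
  have C0 : 0 < `|C| + 1 by rewrite ltr_wpDl.
  have [|I [Q [k [k0 mQ Qfin HQ]]]] := @finite_rank_inequality R n M (delta * c / (`|C| + 1)) M0.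
    by rewrite divr_gt0// mulr_gt0.
  have [K KE] : exists K, K = (`|C| + 1) * k by eexists.
  have K0 : 0 <= K by rewrite KE mulr_ge0 ?(ltW C0)//.
  pose L := \sum_i fine (mu (Q i)).
  exists I, (fun i f => Num.sqrt K * \int[mu]_(x in Q i) f x), (K * L / c).
  have iQ i f : D f -> mu.-integrable (Q i) (EFin \o f).
    by move=> /rtest_C0c/C0c_integrable; apply: integrableS.
  split.
  + move=> i f g Df Dg; rewrite -mulrBr -RintegralB//; exact: iQ.
  + move=> i f Df; rewrite exprMn sqr_sqrtr// -!mulrA ler_wpM2l//.
    have iQ2 : mu.-integrable (Q i) (EFin \o (fun x => f x ^+ 2)).
      by apply: (@integrableS _ _ _ mu setT) => //; exact: C0c_integrable (C0c_sqr (rtest_C0c Df)).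
    apply: le_trans (sqr_Rintegral_le (mQ i) (Qfin i) (iQ i f Df) iQ2) _.
    have h1 : \int[mu]_(x in Q i) f x ^+ 2 <= sqn mu Om f.
      rewrite -Rint_test// [leLHS]Rintegral_mkcond; apply: le_Rintegral => //.
      * by have := (integrable_mkcond _ (mQ i)).1 iQ2; rewrite restrict_EFin.
      * exact: C0c_integrable (C0c_sqr (rtest_C0c Df)).
      * by move=> x _; rewrite patchE; case: ifP => // _; exact: sqr_ge0.
    have h2 : fine (mu (Q i)) <= L.
      by rewrite /L (bigD1 i)//= lerDl sumr_ge0// => j _; exact: fine_ge0.
    have h3 := mass_ge (Djet f Df); rewrite -/(Qb f) in h3.
    have h4 : sqn mu Om f <= c^-1 * Qb f by rewrite ler_pdivlMl.
    apply: (@le_trans _ _ (L * sqn mu Om f)).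
      by apply: ler_pM => //; apply: Rintegral_ge0 => x _; exact: sqr_ge0.
    by rewrite ler_wpM2l// sumr_ge0// => j _; exact: fine_ge0.
  + move=> f Df.
    have h1 : Qb f <= (`|C| + 1) * sqn mu Om f.
      apply: le_trans (ip_le mOm mb c0 bC (Djet f Df None)) _.
      by rewrite ler_wpM2r ?sqn_ge0// (le_trans (ler_norm _))// lerDl.
    have fM x : M <= `|x| -> f x = 0.
      by move=> xM; apply: (rtest_out Df) => /OmM; rewrite ltNge xM.
    have h2 := HQ f (rtest_C1c Df) fM; rewrite Rint_test// in h2.
    have E1 : \sum_j \int[mu]_x (partial j f x ^+ 2) = \sum_j sqn mu Om (partial j f).
      by apply: eq_bigr => j _; rewrite Rint_test//; exact: rtest_partial.
    have h3 : c * \sum_j sqn mu Om (partial j f) <= QJ f.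
      by apply: le_trans (pen_ge _); exact: stiff_ge (Djet f Df).
    apply: (le_trans h1); rewrite E1 in h2.
    have E2 : \sum_i (Num.sqrt K * \int[mu]_(x in Q i) f x) ^+ 2 =
        (`|C| + 1) * \sum_i k * (\int[mu]_(x in Q i) f x) ^+ 2.
      by rewrite mulr_sumr; apply: eq_bigr => i _; rewrite exprMn sqr_sqrtr// KE -mulrA.
    rewrite E2; apply: (@le_trans _ _ ((`|C| + 1) * (delta * c / (`|C| + 1) *
       \sum_j sqn mu Om (partial j f) + \sum_i k * (\int[mu]_(x in Q i) f x) ^+ 2))).
      by rewrite ler_pM2l.
    rewrite mulrDr lerD2r [leLHS](_ : _ = delta * (c * \sum_j sqn mu Om (partial j f))).
      by rewrite ler_pM2l.
    by field; lra.
have [nu [nu0 nuD [s Hs]]] := minimizing_cauchy_sequence HDD HDZ Qb0 QJ0 QbZ QJZ Qbpar QJpar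
  rellich tv v0 e0.
have Ds k : rtest Om (s k) by have [] := Hs k.
have Js k := Djet _ (Ds k).
have nuv : nu <= nuM.
  have := nuD v tv; rewrite /QJ /pen big1 ?mulr0 ?addr0; last first.
    by move=> i _; rewrite vE ?mul0r.
  by move=> /le_trans/(_ vR); rewrite /Qb ler_pM2r.
(* mass and energy dominate c times the squared norms of a function and its gradient *)
have cs k l o : (k <= l)%N -> sqn mu Om (jet_of (s k - s l) o) <= 8 ^- k.
  move=> kl; have [_ _ _ /(_ l kl)[hb hJ]] := Hs k.
  have Dkl : D (s k - s l).
    by rewrite -scaleN1r; apply: HDD (Ds k) _; exact: HDZ (Ds l).
  rewrite -(ler_pM2l c0); case: o => [j|].
    apply: le_trans hJ; apply: le_trans (pen_ge _).
    apply: le_trans (stiff_ge (Djet _ Dkl)); rewrite ler_pM2l//.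
    by rewrite [leRHS](bigD1 j)//= lerDl sumr_ge0// => i _; exact: sqn_ge0.
  by apply: le_trans hb; exact: mass_ge (Djet _ Dkl).
have [U sU Us] := sobolev_complete oO Ds cs.
have lU := sU.1.
pose F A B := pen A B + - nu * mass A B.
have bF : bform Om F by apply: bformD => //; apply: bformZ.
have F0 f : D f -> 0 <= F (jet_of f) (jet_of f).
  by move=> Df; rewrite /F mulNr subr_ge0; exact: nuD.
have small (eps A : R) : 0 < eps -> 0 <= A -> exists k, jsqn Om (U - jet_of (s k)) < eps /\ A * e k < eps.
  move=> eps0 A0; pose B := n.+1%:R + A * c.
  have B0 : 0 < B by rewrite ltr_pwDl// mulr_ge0// ltW.
  pose k := Num.truncn (B / eps); exists k.
  have hk : B * 8 ^- k < eps.
    rewrite ltr_pdivrMr ?exprn_gt0// mulrC -ltr_pdivrMr//.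
    apply: (@lt_le_trans _ _ (k.+1%:R)); first exact: truncnS_gt.
    by rewrite -natrX ler_nat ltn_expl.
  have i0 : 0 <= 8 ^- k :> R by rewrite invr_ge0 exprn_ge0.
  have h1 : 0 <= A * c * 8 ^- k by rewrite !mulr_ge0// ltW.
  have h2 : 0 <= n.+1%:R * 8 ^- k :> R by rewrite mulr_ge0.
  split; first by apply: le_lt_trans (Us k) _; move: hk; rewrite mulrDl; lra.
  by move: hk; rewrite mulrDl /e mulrA; lra.
(* F is nonnegative on test functions and F (s k) (s k) <= e k: Cauchy-Schwarz *)
have Ftest f : rtest Om f -> F U (jet_of f) = 0.
  move=> tf; have lf := Djet f tf; apply: (bform_approx0 oO bF lU lf) => eps eps0.
  have [k [k1 k2]] := small eps (F (jet_of f) (jet_of f)) eps0 (F0 f tf).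
  exists (jet_of (s k)); split=> //.
  apply: le_lt_trans k2.
  apply: le_trans (bform_cauchy_schwarz oO bF (Js k) lf _ (F0 f tf)) _.
    move=> t; have Dt : D (s k - t *: f).
      by rewrite -scaleNr; apply: HDD; [exact: Ds|exact: HDZ].
    have := F0 _ Dt; rewrite (jet_ofB (Ds k) (rtestZ t tf)) (jet_ofZ t tf); exact.
  rewrite ler_wpM2l ?F0//.
  have [_ b1 J1 _] := Hs k; rewrite /F; rewrite /QJ in J1; rewrite /Qb in b1.
  by rewrite b1; lra.
have FV V : sobolev Om V -> F U V = 0.
  move=> [lV aV]; rewrite (bformC bF); apply: (bform_approx0 oO bF lV lU) => eps eps0.
  have [f tf Vf] := aV eps eps0; exists (jet_of f); split=> //; first exact: Djet.
  by rewrite (bformC bF) Ftest// expr0n.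
(* the functions s k have unit mass and tend to U *)
have massU : mass U U = 1.
  have [K HK] := bform_bound bm lU.
  have K1 : 0 < `|K| + 1 by rewrite ltr_wpDl.
  apply/eqP; rewrite -subr_eq0 -sqrf_eq0 eq_le sqr_ge0 andbT.
  apply/ler_addgt0Pl => t t0; rewrite addr0.
  pose A := 8 * (`|K| + 1) + 2 * `|C| ^+ 2.
  have A0 : 0 < A by rewrite ltr_pwDl ?mulr_gt0// mulr_ge0// sqr_ge0.
  have r0 : 0 < Num.min 1 (t / A) by rewrite lt_min ltr01 divr_gt0.
  have [k [+ _]] := small _ 0 r0 (lexx 0); set y := jsqn _ _ => yk.
  have y0 : 0 <= y by exact: jsqn_ge0.
  have [y1 yA] : y < 1 /\ y * A < t.
    by move: yk; rewrite lt_min ltr_pdivlMr// => /andP[].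
  have lk := Js k; have lB := l2jetB oO lU lk.
  have h1 := HK _ lB; rewrite -/y in h1.
  have h2 : mass (U - jet_of (s k)) (U - jet_of (s k)) <= `|C| * y.
    apply: le_trans (ip_le mOm mb c0 bC (lB None)) _.
    apply: (@le_trans _ _ (`|C| * sqn mu Om ((U - jet_of (s k)) None))).
      by rewrite ler_wpM2r ?sqn_ge0// ler_norm.
    by rewrite ler_wpM2l// sqn_le_jsqn.
  have h3 := mass_ge0 lB.
  have [_ b1 _ _] := Hs k; rewrite /Qb in b1.
  have E1 : mass U U - 1 = 2 * mass (U - jet_of (s k)) U - mass (U - jet_of (s k)) (U - jet_of (s k)).
    have e1 := bformBl oO bm lU lk lU; have e2 := bformBr oO bm lU lk lB.
    have e3 := bformBl oO bm lU lk lk; have e4 := bformC bm (jet_of (s k)) U.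
    by lra.
  rewrite E1; move: h1 h2 h3; set x := mass _ U; set z := mass _ _ => h1 h2 h3.
  have h4 : z ^+ 2 <= `|C| ^+ 2 * y.
    rewrite (@le_trans _ _ ((`|C| * y) ^+ 2))// ?lerXn2r ?nnegrE ?(le_trans h3)//.
    by rewrite exprMn ler_wpM2l ?sqr_ge0// expr2 ler_piMr// ltW.
  have h5 : K * y <= (`|K| + 1) * y.
    by rewrite ler_wpM2r// (le_trans (ler_norm _))// lerDl.
  have h6 := sqr_ge0 (2 * x + z).
  rewrite (le_trans _ (ltW yA))// /A.
  have -> : (2 * x - z) ^+ 2 = 8 * x ^+ 2 + 2 * z ^+ 2 - (2 * x + z) ^+ 2 by ring.
  by lra.
have UE i : (i < p)%N -> mass U (E i) = 0.
  move=> ip; have := FV _ (sE ip).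
  have [l0 l1 HE] := eE ip.
  rewrite /F /pen (bformC bform_stiff) HE// (bformC bm (E i) U).
  rewrite (bigD1 (Ordinal ip))//= big1 ?addr0; last first.
    by move=> j ji; rewrite oE// (_ : (i == j) = false) ?mulr0//; apply: contra_neqF ji => /eqP ij; apply/val_inj.
  rewrite oE// eqxx mulr1 => h.
  have : (lam i + (nuM + 1) - nu) * mass U (E i) = 0 by rewrite -h; ring.
  by move=> /eqP; rewrite mulf_eq0 => /orP[/eqP|/eqP//]; lra.
exists U, nu; split=> //; first by rewrite nu0.
move=> V sV; have := FV V sV; rewrite /F /pen big1 ?mulr0 ?addr0.
  by rewrite mulNr => /eqP; rewrite subr_eq0 => /eqP.
by move=> i _; rewrite UE// mul0r.
Qed.

End step.

Lemma bform_suml (F : jet -> jet -> R) k (t : 'I_k -> R) (V : 'I_k -> jet) Z : bform Om F ->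
  (forall i, l2jet Om (V i)) -> l2jet Om Z ->
  F (\sum_i t i *: V i) Z = \sum_i t i * F (V i) Z.
Proof.
move=> bF lV lZ.
have H (s : seq 'I_k) : l2jet Om (\sum_(i <- s) t i *: V i) /\
    F (\sum_(i <- s) t i *: V i) Z = \sum_(i <- s) t i * F (V i) Z.
  elim: s => [|i s [l E]].
    rewrite !big_nil; split; first by move=> o; exact: l2_0.
    by have := bformZl bF 0 lZ lZ; rewrite scale0r mul0r.
  rewrite !big_cons; split; first by apply: l2jetD => //; exact: l2jetZ.
  by rewrite (bformDl bF) ?(bformZl bF) ?E//; exact: l2jetZ.
exact: (H _).2.
Qed.

Lemma jet_of_sum k (t : 'I_k -> R) (f : 'I_k -> 'rV[R]_n -> R) :
  (forall i, rtest Om (f i)) ->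
  rtest Om (\sum_i t i *: f i) /\ jet_of (\sum_i t i *: f i) = \sum_i t i *: jet_of (f i).
Proof.
move=> tf; elim: (index_enum 'I_k) => [|i s [l E]].
  rewrite !big_nil; split.
    split; first by apply: smooth_algP; exact: smooth_alg_cst.
    by exists set0; split=> //; exact: compact0.
  apply/funext => -[j|] //; apply/funext => x.
  by rewrite /= /partial; exact: derive_cst.
rewrite !big_cons; split; first by apply: rtestD => //; exact: rtestZ.
have ti := rtestZ (t i) (tf i).
by rewrite (jet_ofD ti l) E (jet_ofZ _ (tf i)).
Qed.

Section minmax.
Variables (k : nat) (v : 'I_k.+1 -> 'rV[R]_n -> R) (nuM : R).
Hypothesis nuM0 : 0 <= nuM.
Hypothesis tv : forall i, rtest Om (v i).
Hypothesis v0 : forall i, 0 < mass (jet_of (v i)) (jet_of (v i)).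
Hypothesis vm : forall i j, i != j -> mass (jet_of (v i)) (jet_of (v j)) = 0.
Hypothesis vs : forall i j, i != j -> stiff (jet_of (v i)) (jet_of (v j)) = 0.
Hypothesis vR : forall i,
  stiff (jet_of (v i)) (jet_of (v i)) <= nuM * mass (jet_of (v i)) (jet_of (v i)).

(** Given p <= k eigenfunctions, a nontrivial combination of the k + 1 functions
    v i is orthogonal to all of them. Both forms are diagonal in the v i, so it
    still has energy at most nuM times its mass, and it starts the next
    minimisation. *)
Lemma eigenpairs_below : exists (E : nat -> jet) (lam : nat -> R),
  [/\ forall i, (i < k.+1)%N -> sobolev Om (E i),
      forall i j, (i < k.+1)%N -> (j < k.+1)%N -> mass (E i) (E j) = (i == j)%:R &
      forall i, (i < k.+1)%N -> [/\ 0 <= lam i, lam i <= nuM &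
        forall V, sobolev Om V -> stiff (E i) V = lam i * mass (E i) V]].
Proof.
suff : forall p, (p <= k.+1)%N -> exists (E : nat -> jet) (lam : nat -> R),
  [/\ forall i, (i < p)%N -> sobolev Om (E i),
      forall i j, (i < p)%N -> (j < p)%N -> mass (E i) (E j) = (i == j)%:R &
      forall i, (i < p)%N -> [/\ 0 <= lam i, lam i <= nuM &
        forall V, sobolev Om V -> stiff (E i) V = lam i * mass (E i) V]].
  by move=> /(_ k.+1 (leqnn _)).
elim=> [_|p IH pk]; first by exists (fun=> jet_of (v ord0)), (fun=> 0); split.
have [E [lam [sE oE eE]]] := IH (ltnW pk).
have bm := bform_mass; have bs := bform_stiff.
have lv i : l2jet Om (jet_of (v i)) by exact: jet_of_l2.
pose A : 'M[R]_(k.+1, p) := \matrix_(i, j) mass (jet_of (v i)) (E j).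
have [t t0 tA] := left_kernel_vector A pk.
pose f := \sum_i t 0 i *: v i.
have [tf Ef] := jet_of_sum (t 0) tv; rewrite -/f in tf Ef.
have quad F : bform Om F -> (forall i j, i != j -> F (jet_of (v i)) (jet_of (v j)) = 0) ->
    F (jet_of f) (jet_of f) = \sum_i t 0 i ^+ 2 * F (jet_of (v i)) (jet_of (v i)).
  move=> bF F0; have lf : l2jet Om (jet_of f) by exact: jet_of_l2.
  rewrite {1}Ef bform_suml//; apply: eq_bigr => i _.
  rewrite (bformC bF) Ef bform_suml// (bigD1 i)//= big1 ?addr0; last first.
    by move=> j ji; rewrite F0 ?mulr0.
  by rewrite mulrA.
have [i0 ti0] : exists i, t 0 i != 0.
  apply: contrapT => H; move/negP: t0; apply; apply/eqP/rowP => i; rewrite mxE.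
  by apply: contrapT => /eqP ti; apply: H; exists i.
have [|||U [nu [sU /andP[nu0 nu1] U1 UE Ueig]]] := @next_eigenpair p E lam nuM sE oE eE nuM0 f tf.
- move=> i ip; rewrite Ef bform_suml//; last exact: (sE i ip).1.
  have := congr1 (fun B : 'rV[R]_p => B 0 (Ordinal ip)) tA; rewrite !mxE => H; rewrite -[RHS]H.
  by apply: eq_bigr => j _; rewrite mxE.
- rewrite quad// (bigD1 i0)//= ltr_pwDl//; first by rewrite mulr_gt0// exprn_even_gt0.
  by rewrite sumr_ge0// => i _; rewrite mulr_ge0 ?sqr_ge0// ltW.
- rewrite !quad// mulr_sumr; apply: ler_sum => i _.
  by rewrite mulrCA ler_wpM2l// sqr_ge0.
exists (fun i => if i == p then U else E i), (fun i => if i == p then nu else lam i).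
have lt_p i : (i < p.+1)%N -> i != p -> (i < p)%N by rewrite ltnS leq_eqVlt => /orP[->|].
split.
- by move=> i ip; case: (eqVneq i p) => // ni; exact/sE/lt_p.
- move=> i j ip jp; case: (eqVneq i p) => [ie|ni]; case: (eqVneq j p) => [je|nj].
  + by rewrite U1 ie je eqxx.
  + by rewrite UE ?lt_p// ie eq_sym (negbTE nj).
  + by rewrite (bformC bm) UE ?lt_p// je (negbTE ni).
  + by rewrite oE// lt_p.
- by move=> i ip; case: (eqVneq i p) => [_|ni]; [split|exact/eE/lt_p].
Qed.

End minmax.
End eigenpairs.

(** * Real and imaginary parts *)

Section complex_arithmetic.
Context {R : realType}.
Local Notation Re := (@complex.Re R).
Local Notation Im := (@complex.Im R).
Implicit Types (z w : R[i]).

Lemma complex_eqP z w : Re z = Re w -> Im z = Im w -> z = w.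
Proof. by case: z => a b; case: w => c d /= -> ->. Qed.

Lemma Re_add z w : Re (z + w) = Re z + Re w.
Proof. by case: z => a b; case: w. Qed.
Lemma Im_add z w : Im (z + w) = Im z + Im w.
Proof. by case: z => a b; case: w. Qed.
Lemma Re_opp z : Re (- z) = - Re z.
Proof. by case: z. Qed.
Lemma Im_opp z : Im (- z) = - Im z.
Proof. by case: z. Qed.
Lemma Re_mul z w : Re (z * w) = Re z * Re w - Im z * Im w.
Proof. by case: z => a b; case: w. Qed.
Lemma Im_mul z w : Im (z * w) = Re z * Im w + Im z * Re w.
Proof. by case: z => a b; case: w. Qed.
Lemma Re_conj z : Re (z^*) = Re z.
Proof. by case: z. Qed.
Lemma Im_conj z : Im (z^*) = - Im z.
Proof. by case: z. Qed.
Lemma Re_real (x : R) : Re x%:C%C = x. Proof. by []. Qed.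
Lemma Im_real (x : R) : Im x%:C%C = 0. Proof. by []. Qed.

Lemma Re_sum (I : Type) (s : seq I) (F : I -> R[i]) :
  Re (\sum_(i <- s) F i) = \sum_(i <- s) Re (F i).
Proof. by apply: (big_morph Re); [exact: Re_add|]. Qed.

Lemma Im_sum (I : Type) (s : seq I) (F : I -> R[i]) :
  Im (\sum_(i <- s) F i) = \sum_(i <- s) Im (F i).
Proof. by apply: (big_morph Im); [exact: Im_add|]. Qed.

End complex_arithmetic.

Section real_weak_gradient.
Context {R : realType} {n : nat}.
Local Notation mu := (@lebesgue_rV R n).
Variables (Om : set 'rV[R]_n) (oO : open Om).
Let mOm : measurable Om. Proof. exact: open_rV_measurable. Qed.
Hint Resolve mOm : core.
Implicit Types (u : 'rV[R]_n -> R) (g : 'I_n -> 'rV[R]_n -> R).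

(** The real counterpart of [weak_gradient]. *)
Definition rweak u g := (forall j, l2 mu Om (g j)) /\
  forall j f, rtest Om f ->
    \int[mu]_(x in Om) (u x * partial j f x) = - \int[mu]_(x in Om) (g j x * f x).

Lemma rweak_unique u g h j : rweak u g -> rweak u h ->
  {ae mu, forall x, Om x -> g j x = h j x}.
Proof.
move=> [lg Hg] [lh Hh].
have : {ae mu, forall x, Om x -> g j x - h j x = 0}.
  apply: (@du_bois_reymond R n Om oO (fun x => g j x - h j x)); first exact: l2B.
  move=> f tf; have lf := C0c_l2 oO (rtest_C0c tf).
  transitivity (\int[mu]_(x in Om) (g j x * f x) - \int[mu]_(x in Om) (h j x * f x)).
    rewrite -RintegralB//; [|exact: l2_mul_integrable..].
    by apply: eq_Rintegral => x _; rewrite mulrBl.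
  by rewrite -[X in X - _]opprK -Hg// Hh// opprK subrr.
by apply: filterS => x H Ox; apply/eqP; rewrite -subr_eq0; apply/eqP; exact: H.
Qed.

Lemma Rintegral_ae_eq (f h : 'rV[R]_n -> R) :
  measurable_fun Om f -> measurable_fun Om h ->
  {ae mu, forall x, Om x -> f x = h x} ->
  \int[mu]_(x in Om) f x = \int[mu]_(x in Om) h x.
Proof.
move=> mf mh fh; congr fine; apply: ae_eq_integral => //.
- exact/measurable_EFinP.
- exact/measurable_EFinP.
- by apply: filterS fh => x H Ox; rewrite H.
Qed.

Lemma sqn_ae_eq (f h : 'rV[R]_n -> R) : l2 mu Om f -> l2 mu Om h ->
  {ae mu, forall x, Om x -> f x = h x} -> sqn mu Om f = sqn mu Om h.
Proof.
move=> lf lh fh; apply: Rintegral_ae_eq.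
- by apply: measurable_funX; exact: lf.1.
- by apply: measurable_funX; exact: lh.1.
- by apply: filterS fh => x H Ox; rewrite H.
Qed.

End real_weak_gradient.

Section complex_sobolev.
Context {R : realType} {n : nat}.
Local Notation mu := (@lebesgue_rV R n).
Local Notation Re := (@complex.Re R).
Local Notation Im := (@complex.Im R).
Local Notation fct := ('rV[R]_n -> R[i]).
Variables (Om : set 'rV[R]_n) (oO : open Om).
Let mOm : measurable Om. Proof. exact: open_rV_measurable. Qed.
Hint Resolve mOm : core.
Implicit Types (u v : fct) (f : 'rV[R]_n -> R).

Definition cx f : fct := fun x => Complex (f x) 0.

Lemma rtest0 : rtest Om (fun=> 0 : R).
Proof.
split; first by apply: smooth_algP; exact: smooth_alg_cst.
by exists set0; split=> //; exact: compact0.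
Qed.

Lemma test_functionP phi :
  test_function Om phi <-> rtest Om (Re \o phi) /\ rtest Om (Im \o phi).
Proof.
split=> [[sR sI [K [cK KO fK]]]|[[sR [K [cK KO fK]]] [sI [L [cL LO fL]]]]].
  by split; (split=> //; exists K; split=> // x /fK /= ->).
split=> //; exists (K `|` L); split.
- exact: compactU.
- by move=> x [/KO|/LO].
- move=> x nKL; apply: complex_eqP => /=.
    by apply: fK => Kx; apply: nKL; left.
  by apply: fL => Kx; apply: nKL; right.
Qed.

Lemma test_function_cx f : rtest Om f -> test_function Om (cx f).
Proof. by move=> tf; apply/test_functionP; split=> //; exact: rtest0. Qed.

Lemma L2P u : L2 Om u <-> l2 mu Om (Re \o u) /\ l2 mu Om (Im \o u).
Proof.
split=> [[mR mI foo]|[lR lI]].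
  have msq : measurable_fun Om (fun x => (sqmodulus (u x))%:E).
    by apply/measurable_EFinP; apply: measurable_funD; exact: measurable_funX.
  split; split=> //; apply: le_lt_trans foo; apply: ge0_le_integral => //.
  - by move=> x _; rewrite lee_fin sqr_ge0.
  - by apply/measurable_EFinP; exact: measurable_funX.
  - by move=> x _; rewrite lee_fin lerDl sqr_ge0.
  - by move=> x _; rewrite lee_fin sqr_ge0.
  - by apply/measurable_EFinP; exact: measurable_funX.
  - by move=> x _; rewrite lee_fin lerDr sqr_ge0.
split; [exact: lR.1|exact: lI.1|].
have i1 := integrableD mOm (l2_sqr_integrable lR) (l2_sqr_integrable lI).
by have := integrable_lty mOm i1.
Qed.

Lemma L2_sqmodulus u : L2 Om u ->
  (\int[mu]_(x in Om) (sqmodulus (u x))%:E)%E =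
  (sqn mu Om (Re \o u) + sqn mu Om (Im \o u))%:E.
Proof.
move=> /L2P[lR lI]; rewrite EFinD -!l2_sqnE// -ge0_integralD//.
- by move=> x _; rewrite lee_fin sqr_ge0.
- by apply/measurable_EFinP; apply: measurable_funX; exact: lR.1.
- by move=> x _; rewrite lee_fin sqr_ge0.
- by apply/measurable_EFinP; apply: measurable_funX; exact: lI.1.
Qed.

Lemma weak_gradientP u (g : 'I_n -> fct) : L2 Om u ->
  weak_gradient Om u g <-> rweak Om (Re \o u) (fun j => Re \o g j) /\
                           rweak Om (Im \o u) (fun j => Im \o g j).
Proof.
move=> /L2P[lR lI]; split.
  move=> [lg Hg]; have lgR j := ((L2P (g j)).1 (lg j)).1; have lgI j := ((L2P (g j)).1 (lg j)).2.
  have H j f : rtest Om f ->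
      cintegral Om (fun x => u x * cpartial j (cx f) x) =
      - cintegral Om (fun x => g j x * cx f x) by move=> tf; apply: Hg; exact: test_function_cx.
  have c0 j f x : cpartial j (cx f) x = Complex (partial j f x) 0.
    rewrite /cpartial; congr Complex; rewrite /partial /comp /=.
    exact: derive_cst.
  split; split=> // j f tf.
    have := congr1 Re (H j f tf); rewrite Re_opp /=.
    under eq_Rintegral do rewrite Re_mul c0 /= mulr0 subr0.
    by under [in X in _ = - X -> _]eq_Rintegral do rewrite Re_mul /= mulr0 subr0.
  have := congr1 Im (H j f tf); rewrite Im_opp /=.
  under eq_Rintegral do rewrite Im_mul c0 /= mulr0 add0r.
  by under [in X in _ = - X -> _]eq_Rintegral do rewrite Im_mul /= mulr0 add0r.
move=> [[lgR HR] [lgI HI]]; split; first by move=> j; apply/L2P.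
move=> j phi /test_functionP[tR tI].
have lpR := C0c_l2 oO (rtest_C0c tR); have lpI := C0c_l2 oO (rtest_C0c tI).
have ldR := C0c_l2 oO (rtest_C0c (rtest_partial j tR)).
have ldI := C0c_l2 oO (rtest_C0c (rtest_partial j tI)).
have ii f h : l2 mu Om f -> l2 mu Om h -> mu.-integrable Om (EFin \o (fun x => f x * h x)).
  by move=> lf lh; exact: l2_mul_integrable.
apply: complex_eqP; rewrite ?Re_opp ?Im_opp /=.
  transitivity (\int[mu]_(x in Om) ((Re \o u) x * partial j (Re \o phi) x) -
     \int[mu]_(x in Om) ((Im \o u) x * partial j (Im \o phi) x)).
    rewrite -RintegralB//; [|exact: ii..].
    by apply: eq_Rintegral => x _; rewrite Re_mul.
  have -> : \int[mu]_(x in Om) Re (g j x * phi x) =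
      \int[mu]_(x in Om) ((Re \o g j) x * (Re \o phi) x) -
      \int[mu]_(x in Om) ((Im \o g j) x * (Im \o phi) x).
    rewrite -RintegralB//; [|by apply: ii; [exact: lgR|]|by apply: ii; [exact: lgI|]].
    by apply: eq_Rintegral => x _; rewrite Re_mul.
  by rewrite HR// HI// opprB opprK addrC.
transitivity (\int[mu]_(x in Om) ((Re \o u) x * partial j (Im \o phi) x) +
   \int[mu]_(x in Om) ((Im \o u) x * partial j (Re \o phi) x)).
  rewrite -RintegralD//; [|exact: ii..].
  by apply: eq_Rintegral => x _; rewrite Im_mul.
have -> : \int[mu]_(x in Om) Im (g j x * phi x) =
    \int[mu]_(x in Om) ((Re \o g j) x * (Im \o phi) x) +
    \int[mu]_(x in Om) ((Im \o g j) x * (Re \o phi) x).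
  rewrite -RintegralD//; [|by apply: ii; [exact: lgR|]|by apply: ii; [exact: lgI|]].
  by apply: eq_Rintegral => x _; rewrite Im_mul.
by rewrite HR// HI// opprD.
Qed.

(** The gradients used here are the representatives chosen by [grad], which is
    what the energy of a complex function refers to. *)
Definition re_jet v : jet := fun o =>
  if o is Some j then Re \o grad Om v j else Re \o v.
Definition im_jet v : jet := fun o =>
  if o is Some j then Im \o grad Om v j else Im \o v.

Lemma grad_weak v : (exists g, weak_gradient Om v g) -> weak_gradient Om v (grad Om v).
Proof. by move=> H; rewrite /grad; exact: xgetPex. Qed.

Lemma rweakB f1 f2 g1 g2 : l2 mu Om f1 -> l2 mu Om f2 -> rweak Om f1 g1 -> rweak Om f2 g2 ->
  rweak Om (fun x => f1 x - f2 x) (fun j x => g1 j x - g2 j x).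
Proof.
move=> lf1 lf2 [lg1 H1] [lg2 H2]; split; first by move=> j; exact: l2B.
move=> j f tf; have lf := C0c_l2 oO (rtest_C0c tf).
have ldf := C0c_l2 oO (rtest_C0c (rtest_partial j tf)).
transitivity (\int[mu]_(x in Om) (f1 x * partial j f x) - \int[mu]_(x in Om) (f2 x * partial j f x)).
  rewrite -RintegralB//; [|exact: l2_mul_integrable..].
  by apply: eq_Rintegral => x _; rewrite mulrBl.
have -> : \int[mu]_(x in Om) ((g1 j x - g2 j x) * f x) =
    \int[mu]_(x in Om) (g1 j x * f x) - \int[mu]_(x in Om) (g2 j x * f x).
  rewrite -RintegralB//; [|exact: l2_mul_integrable..].
  by apply: eq_Rintegral => x _; rewrite mulrBl.
by rewrite H1// H2// opprB opprK addrC.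
Qed.

Lemma rweak_sobolev U : sobolev Om U -> rweak Om (U None) (fun j => U (Some j)).
Proof. by move=> sU; split=> [j|j f tf]; [exact: sU.1|exact: sobolev_ibp]. Qed.

Lemma rweak_test f : rtest Om f -> rweak Om f (fun j => partial j f).
Proof. by move=> tf; exact: (rweak_sobolev (sobolev_jet_of oO tf)). Qed.

(** The gradient chosen for u - phi agrees almost everywhere with the difference of
    any weak gradient of u and the classical gradient of phi. *)
Lemma H1_sqnormB u (g : 'I_n -> fct) phi : L2 Om u -> weak_gradient Om u g ->
  test_function Om phi ->
  H1_sqnorm Om (fun x => u x - phi x) =
  (sqn mu Om (fun x => Re (u x) - Re (phi x)) +
   sqn mu Om (fun x => Im (u x) - Im (phi x)) +
   \sum_j (sqn mu Om (fun x => Re (g j x) - partial j (Re \o phi) x) +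
           sqn mu Om (fun x => Im (g j x) - partial j (Im \o phi) x)))%:E.
Proof.
move=> Lu wu tphi; have [lR lI] := (L2P u).1 Lu; have [tR tI] := (test_functionP phi).1 tphi.
have lpR := C0c_l2 oO (rtest_C0c tR); have lpI := C0c_l2 oO (rtest_C0c tI).
have [wR wI] := (weak_gradientP g Lu).1 wu.
pose w x := u x - phi x.
have lwR : l2 mu Om (Re \o w).
  rewrite (_ : Re \o w = fun x => Re (u x) - Re (phi x)); first exact: l2B.
  by apply/funext => x; rewrite /w /= Re_add Re_opp.
have lwI : l2 mu Om (Im \o w).
  rewrite (_ : Im \o w = fun x => Im (u x) - Im (phi x)); first exact: l2B.
  by apply/funext => x; rewrite /w /= Im_add Im_opp.
have Lw : L2 Om w by apply/L2P.
have wR' := rweakB lR lpR wR (rweak_test tR).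
have wI' := rweakB lI lpI wI (rweak_test tI).
pose gw j x := Complex (Re (g j x) - partial j (Re \o phi) x) (Im (g j x) - partial j (Im \o phi) x).
have ew : weak_gradient Om w gw.
  apply: (weak_gradientP gw Lw).2; split.
    rewrite (_ : Re \o w = fun x => Re (u x) - Re (phi x)); first exact: wR'.
    by apply/funext => x; rewrite /w /= Re_add Re_opp.
  rewrite (_ : Im \o w = fun x => Im (u x) - Im (phi x)); first exact: wI'.
  by apply/funext => x; rewrite /w /= Im_add Im_opp.
have gW := grad_weak (ex_intro _ gw ew).
have [gwR gwI] := (weak_gradientP _ Lw).1 gW; have [hwR hwI] := (weak_gradientP _ Lw).1 ew.
rewrite /H1_sqnorm -/w (L2_sqmodulus Lw) [RHS]EFinD; congr (_ + _)%E.
  congr EFin; congr (_ + _); apply: eq_Rintegral => x _; rewrite /w /=.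
    by rewrite Re_add Re_opp.
  by rewrite Im_add Im_opp.
rewrite -sumEFin; apply: eq_bigr => j _; rewrite (L2_sqmodulus (gW.1 j)); congr EFin; congr (_ + _).
  exact: (sqn_ae_eq oO (gwR.1 j) (hwR.1 j) (rweak_unique oO j gwR hwR)).
exact: (sqn_ae_eq oO (gwI.1 j) (hwI.1 j) (rweak_unique oO j gwI hwI)).
Qed.

Lemma jsqn_option U : jsqn Om U = sqn mu Om (U None) + \sum_j sqn mu Om (U (Some j)).
Proof.
rewrite /jsqn (bigD1 None)//=; congr (_ + _).
rewrite (eq_bigl (fun o => o \in [set Some j | j in [set: 'I_n]]%SET)).
  by rewrite big_imset/=; [apply: eq_bigl => j; rewrite !inE|move=> i j _ _ []].
case=> [j|]; first by apply/esym/imsetP; exists j.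
by apply/esym/imsetP => -[].
Qed.

(** The norm of a real or imaginary part is at most that of the function, so its
    approximation by test functions can be taken part by part. *)
Lemma H10_sobolev v : H10 Om v -> sobolev Om (re_jet v) /\ sobolev Om (im_jet v).
Proof.
move=> [[Lv wv] appr]; have [lR lI] := (L2P v).1 Lv.
have gw := grad_weak wv.
have lg j := (L2P _).1 (gw.1 j).
have sum_le (F : 'I_n -> R) (G : 'I_n -> R) : (forall j, 0 <= G j) ->
    \sum_j F j <= \sum_j (F j + G j).
  by move=> G0; apply: ler_sum => j _; rewrite lerDl.
split; split.
- by case=> [j|]; [exact: (lg j).1|exact: lR].
- move=> e /appr[phi tphi]; rewrite (H1_sqnormB Lv gw tphi) lte_fin => h.
  exists (Re \o phi); first exact: ((test_functionP phi).1 tphi).1.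
  apply: le_lt_trans h; rewrite jsqn_option lerD//; first by rewrite lerDl sqn_ge0.
  by apply: sum_le => j; exact: sqn_ge0.
- by case=> [j|]; [exact: (lg j).2|exact: lI].
- move=> e /appr[phi tphi]; rewrite (H1_sqnormB Lv gw tphi) lte_fin => h.
  exists (Im \o phi); first exact: ((test_functionP phi).1 tphi).2.
  apply: le_lt_trans h; rewrite jsqn_option lerD//; first by rewrite lerDr sqn_ge0.
  by apply: ler_sum => j _; rewrite lerDr sqn_ge0.
Qed.

Lemma cx_weak_gradient U : sobolev Om U ->
  L2 Om (cx (U None)) /\ weak_gradient Om (cx (U None)) (fun j => cx (U (Some j))).
Proof.
move=> sU; have L : L2 Om (cx (U None)) by apply/L2P; split; [exact: sU.1|exact: l2_0].
split=> //; apply/weak_gradientP => //; split; first exact: rweak_sobolev.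
split=> [j|j f tf]; first exact: l2_0.
by rewrite !Rintegral_eq0 ?oppr0// => x _; rewrite /= mul0r.
Qed.

Lemma sobolev_H10 U : sobolev Om U -> H10 Om (cx (U None)).
Proof.
move=> sU; have [L wg] := cx_weak_gradient sU.
split; first by split=> //; eexists; exact: wg.
move=> e e0; have [f tf h] := sU.2 e e0; exists (cx f); first exact: test_function_cx.
rewrite (H1_sqnormB L wg (test_function_cx tf)) lte_fin; apply: le_lt_trans h.
have z (h : 'rV[R]_n -> R) : (forall x, h x = 0) -> sqn mu Om h = 0.
  by move=> h0; rewrite /sqn Rintegral_eq0// => x _; rewrite h0 expr0n.
rewrite jsqn_option; apply: lerD.
  by rewrite (z (fun x => Im _ - _)) ?addr0// => x; rewrite /= subr0.
apply: ler_sum => j _.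
rewrite (z (fun x => Im _ - _)) ?addr0// => x; rewrite /= /partial /comp /=.
by rewrite (derive_cst (0 : R)) subr0.
Qed.

Section eigen.
Variables (a b : 'rV[R]_n -> R) (c C : R).
Hypotheses (ma : measurable_fun Om a) (mb : measurable_fun Om b) (c0 : 0 < c).
Hypothesis aC : forall x, Om x -> c <= a x <= C.
Hypothesis bC : forall x, Om x -> c <= b x <= C.

(** The energy and the scalar product of a real U with a complex v split into those
    with the real and imaginary parts of v, and the gradient chosen for U may be
    replaced by the one that U carries. *)
Lemma cx_eigenfunction U nu : sobolev Om U ->
  (forall V, sobolev Om V -> stiff Om a U V = nu * mass Om b U V) ->
  eigenfunctions (form_operator (H10 Om)
    (fun u v => cintegral Om (fun x => (a x)%:C%C * \sum_j grad Om u j x * (grad Om v j x)^*))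
    (L2 Om) (fun u v => cintegral Om (fun x => u x * (v x)^* * (b x)%:C%C))) nu (cx (U None)).
Proof.
move=> sU eU; have [L wg] := cx_weak_gradient sU; have lU := sU.1.
have gw := grad_weak (ex_intro _ _ wg).
have [gR gI] := (weak_gradientP _ L).1 gw; have [hR hI] := (weak_gradientP _ L).1 wg.
split; first exact: sobolev_H10.
  apply/L2P; split.
    rewrite (_ : Re \o _ = fun x => nu * U None x); first by apply: l2Z => //; exact: lU.
    by apply/funext => x; rewrite /= mul0r subr0.
  rewrite (_ : Im \o _ = fun=> 0); first exact: l2_0.
  by apply/funext => x; rewrite /= mulr0 mul0r addr0.
move=> v Hv; have [sR sI] := H10_sobolev Hv.
have [[Lv wv] _] := Hv; have gv := grad_weak wv.
have lv j := (L2P _).1 (gv.1 j); have lu j := (L2P _).1 (gw.1 j).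
have aeR j : {ae mu, forall x, Om x -> (Re \o grad Om (cx (U None)) j) x = U (Some j) x}.
  by have := rweak_unique oO j gR hR.
have aeI j : {ae mu, forall x, Om x -> (Im \o grad Om (cx (U None)) j) x = 0}.
  by have := rweak_unique oO j gI hI.
have aeip f f' g : l2 mu Om f -> l2 mu Om f' -> l2 mu Om g ->
    {ae mu, forall x, Om x -> f x = f' x} -> ip mu Om a f g = ip mu Om a f' g.
  move=> lf lf' lg ff'; apply: Rintegral_ae_eq => //.
  - by apply: measurable_funM => //; apply: measurable_funM; [exact: lf.1|exact: lg.1].
  - by apply: measurable_funM => //; apply: measurable_funM; [exact: lf'.1|exact: lg.1].
  - by apply: filterS ff' => x H Ox; rewrite H.
have ii f g : l2 mu Om f -> l2 mu Om g -> mu.-integrable Om (EFin \o (fun x => a x * (f x * g x))).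
  by move=> lf lg; exact: (ip_integrable mOm ma (weight_bounded c0 aC)).
have sumE (f g f' g' : 'I_n -> 'rV[R]_n -> R) : (forall j, l2 mu Om (f j)) -> (forall j, l2 mu Om (g j)) ->
    (forall j, l2 mu Om (f' j)) -> (forall j, l2 mu Om (g' j)) ->
    \int[mu]_(x in Om) (a x * \sum_j (f j x * g j x + f' j x * g' j x)) =
    \sum_j (ip mu Om a (f j) (g j) + ip mu Om a (f' j) (g' j)).
  move=> lf lg lf' lg'.
  have [_ E] := Rintegral_sum mOm (index_enum 'I_n) (fun j => ii _ _ (lf j) (lg j)).
  have [_ E'] := Rintegral_sum mOm (index_enum 'I_n) (fun j => ii _ _ (lf' j) (lg' j)).
  rewrite big_split/= -E -E' -RintegralD//.
  - by apply: eq_Rintegral => x _; rewrite -big_split mulr_sumr; apply: eq_bigr => j _; rewrite mulrDr.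
  - exact: (Rintegral_sum mOm (index_enum 'I_n) (fun j => ii _ _ (lf j) (lg j))).1.
  - exact: (Rintegral_sum mOm (index_enum 'I_n) (fun j => ii _ _ (lf' j) (lg' j))).1.
have lN f : l2 mu Om f -> l2 mu Om (fun x => - f x).
  by move=> lf; have := l2Z mOm (-1) lf; under eq_fun do rewrite mulN1r.
have ipN f g : l2 mu Om f -> l2 mu Om g -> ip mu Om a f (fun x => - g x) = - ip mu Om a f g.
  move=> lf lg; rewrite (ipC mu Om a f) -[RHS]mulN1r (ipC mu Om a f g).
  rewrite -(ipZl mOm ma (weight_bounded c0 aC) (-1) lg lf).
  by apply: eq_Rintegral => x _; rewrite mulN1r.
have ip0 f : ip mu Om a (fun=> 0) f = 0.
  by rewrite /ip Rintegral_eq0// => x _; rewrite mul0r mulr0.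
have l0 : l2 mu Om (fun=> 0 : R) by exact: l2_0.
apply: complex_eqP => /=.
  transitivity (nu * mass Om b U (re_jet v)).
    rewrite -eU//.
    rewrite (@eq_Rintegral _ _ _ mu Om (fun x => a x * \sum_j
       (Re (grad Om (cx (U None)) j x) * Re (grad Om v j x) +
        Im (grad Om (cx (U None)) j x) * Im (grad Om v j x)))); last first.
      move=> x _; rewrite Re_mul Re_real Im_real mul0r subr0 Re_sum; congr (_ * _); apply: eq_bigr => j _.
      by rewrite Re_mul Re_conj Im_conj mulrN opprK.
    rewrite (sumE (fun j => Re \o grad Om (cx (U None)) j) (fun j => Re \o grad Om v j)
      (fun j => Im \o grad Om (cx (U None)) j) (fun j => Im \o grad Om v j));
      [|by move=> j; case: (lu j)|by move=> j; case: (lv j)|by move=> j; case: (lu j)|by move=> j; case: (lv j)].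
    apply: eq_bigr => j _.
    rewrite (aeip _ _ _ (lu j).1 (lU (Some j)) (lv j).1 (aeR j)).
    by rewrite (aeip _ _ _ (lu j).2 l0 (lv j).2 (aeI j)) ip0 addr0.
  rewrite /mass /ip -RintegralZl//; last first.
    by apply: (ip_integrable mOm mb (weight_bounded c0 bC)) => //; exact: sR.1.
  by apply: eq_Rintegral => x _; rewrite /re_jet /=; case: (v x) => vr vi /=; ring.
transitivity (- (nu * mass Om b U (im_jet v))).
  rewrite -eU//.
  rewrite (@eq_Rintegral _ _ _ mu Om (fun x => a x * \sum_j
     (Re (grad Om (cx (U None)) j x) * - Im (grad Om v j x) +
      Im (grad Om (cx (U None)) j x) * Re (grad Om v j x)))); last first.
    move=> x _; rewrite Im_mul Re_real Im_real mul0r addr0 Im_sum; congr (_ * _); apply: eq_bigr => j _.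
    by rewrite Im_mul Re_conj Im_conj.
  have lvI j := lN _ (lv j).2.
  rewrite (sumE (fun j => Re \o grad Om (cx (U None)) j) (fun j x => - Im (grad Om v j x))
    (fun j => Im \o grad Om (cx (U None)) j) (fun j => Re \o grad Om v j));
    [|by move=> j; case: (lu j)|by []|by move=> j; case: (lu j)|by move=> j; case: (lv j)].
  rewrite /stiff -sumrN; apply: eq_bigr => j _.
  rewrite (aeip _ _ _ (lu j).1 (lU (Some j)) (lvI j) (aeR j)).
  by rewrite (aeip _ _ _ (lu j).2 l0 (lv j).1 (aeI j)) ip0 addr0 ipN//; exact: (lv j).2.
rewrite /mass /ip -RintegralZl//; last first.
  by apply: (ip_integrable mOm mb (weight_bounded c0 bC)) => //; exact: sI.1.
have ib : mu.-integrable Om (EFin \o (fun x => nu * (b x * (U None x * im_jet v None x)))).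
  have := ip_integrable mOm mb (weight_bounded c0 bC) (lU None) (sI.1 None).
  by move=> /(integrableZl mOm nu); apply: eq_integrable.
rewrite -mulN1r -RintegralZl//.
by apply: eq_Rintegral => x _; rewrite /im_jet /=; case: (v x) => vr vi /=; ring.
Qed.

End eigen.
End complex_sobolev.

(** * Counting eigenvalues *)

Section counting.
Context {R : realType} {n : nat}.
Local Notation mu := (@lebesgue_rV R n).
Local Notation fct := ('rV[R]_n -> R[i]).
Variables (Om : set 'rV[R]_n) (oO : open Om).
Let mOm : measurable Om. Proof. exact: open_rV_measurable. Qed.
Hint Resolve mOm : core.
Variables (b : 'rV[R]_n -> R) (C : R).
Hypotheses (mb : measurable_fun Om b) (bC : forall x, Om x -> `|b x| <= C).

Lemma mass_ae_eq0 U Z : l2jet Om U -> l2jet Om Z ->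
  {ae mu, forall x, Om x -> U None x = 0} -> mass Om b U Z = 0.
Proof.
move=> lU lZ U0; rewrite /mass /ip (@Rintegral_ae_eq _ _ _ oO _ (fun=> 0))//.
- by rewrite Rintegral_cst ?mul0r.
- apply: measurable_funM => //; apply: measurable_funM; [exact: (lU None).1|exact: (lZ None).1].
- by apply: filterS U0 => x H Ox; rewrite H// mul0r mulr0.
Qed.

(** If m < p, the coordinates of the F i satisfy a nontrivial linear relation over
    the complex numbers; its real and imaginary parts are relations between the
    F i, which orthonormality excludes. *)
Lemma orthonormal_le_dimension p (F : 'I_p -> jet) (S : set fct) m :
  (forall i, l2jet Om (F i)) ->
  (forall i j, mass Om b (F i) (F j) = (i == j)%:R) ->
  (forall i, S (cx (F i None))) -> has_dimension Om S m -> (p <= m)%N.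
Proof.
move=> lF oF SF [e [_ _ He]]; rewrite leqNgt; apply/negP => mp.
have bm : bform Om (fun U V => mass Om b U V) by exact: (bform_ip oO None mb bC).
have [c Hc] := choice (fun i => He _ (SF i)).
pose A : 'M[R[i]]_(p, m) := \matrix_(i, l) c i l.
have [t t0 tA] := left_kernel_vector A mp.
have ae0 : {ae mu, forall x, Om x -> \sum_i t 0 i * cx (F i None) x = 0}.
  have : {ae mu, forall x, forall i, Om x -> cx (F i None) x = \sum_l c i l * e l x}.
    by apply: filter_forall => i; exact: Hc.
  apply: filterS => x H Ox.
  transitivity (\sum_i t 0 i * \sum_l c i l * e l x).
    by apply: eq_bigr => i _; rewrite H.
  under eq_bigr do rewrite mulr_sumr.
  rewrite exchange_big big1// => l _.
  have := congr1 (fun B : 'rV[R[i]]_m => B 0 l) tA; rewrite !mxE => H0.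
  under eq_bigr do rewrite mulrA.
  rewrite -mulr_suml (_ : \sum_i _ = 0) ?mul0r// -[RHS]H0.
  by apply: eq_bigr => i _; rewrite mxE.
have key (s : 'I_p -> R) : {ae mu, forall x, Om x -> \sum_i s i * F i None x = 0} ->
    forall j, s j = 0.
  move=> s0 j; pose U : jet := \sum_i s i *: F i.
  have UE x : U None x = \sum_i s i * F i None x.
    by rewrite /U; elim/big_ind2 : _ => // f g h k <- <-.
  have lU : l2jet Om U.
    move=> o; rewrite (_ : U o = fun x => \sum_i s i * F i o x).
      by apply: l2_sum => // i; apply: l2Z => //; exact: lF.
    by apply/funext => x; rewrite /U; elim/big_ind2 : _ => // f g h k <- <-.
  have : mass Om b U (F j) = 0.
    apply: mass_ae_eq0 => //; apply: filterS s0 => x H Ox; rewrite UE; exact: H.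
  rewrite /U (bform_suml oO _ bm lF (lF j)) (bigD1 j)//= big1 ?oF ?eqxx ?mulr1 ?addr0//.
  by move=> i ij; rewrite oF (negbTE ij) mulr0.
move/negP: t0; apply; apply/eqP/rowP => j; rewrite mxE; apply: complex_eqP => /=.
  apply: key (fun j => complex.Re (t 0 j)) _ j; apply: filterS ae0 => x H Ox.
  have := congr1 (@complex.Re R) (H Ox); rewrite Re_sum => H0; rewrite -[RHS]H0.
  by apply: eq_bigr => i _; rewrite Re_mul /= mulr0 subr0.
apply: key (fun j => complex.Im (t 0 j)) _ j; apply: filterS ae0 => x H Ox.
have := congr1 (@complex.Im R) (H Ox); rewrite Im_sum => H0; rewrite -[RHS]H0.
by apply: eq_bigr => i _; rewrite Im_mul /= mulr0 add0r.
Qed.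

(** Every value w <= M occurs in lam at least as often as among nu 0, ..., nu k. If
    lam k were larger than M, all these occurrences would have index below k, but
    there are k + 1 of them. *)
Lemma eigenvalue_le (A : fct -> fct -> Prop) (lam : nat -> R) k (E : nat -> jet)
    (nu : nat -> R) M : eigenvalue_sequence Om A lam ->
  (forall i, (i < k.+1)%N -> l2jet Om (E i)) ->
  (forall i j, (i < k.+1)%N -> (j < k.+1)%N -> mass Om b (E i) (E j) = (i == j)%:R) ->
  (forall i, (i < k.+1)%N -> nu i <= M) ->
  (forall i, (i < k.+1)%N -> eigenfunctions A (nu i) (cx (E i None))) ->
  lam k <= M.
Proof.
move=> [lamnd Hlam] lE oE nuM eE; rewrite leNgt; apply/negP => Mk.
have small j w : lam j = w -> w <= M -> (j < k)%N.
  move=> <- jM; rewrite ltnNge; apply/negP => kj.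
  by have := lt_le_trans Mk (le_trans (lamnd _ _ kj) jM); rewrite ltxx.
have mult w : w <= M ->
    (#|[set i : 'I_k.+1 | nu i == w]%SET| <= #|[set j : 'I_k | lam j == w]%SET|)%N.
  move=> wM; have [m [dim /card_esym]] := Hlam w.
  move=> /card_set_bijP[f [fw finj _]].
  apply: (@leq_trans m).
    pose S := [set i : 'I_k.+1 | nu i == w]%SET.
    pose F (i : 'I_#|S|) : jet := E (enum_val i).
    apply: (@orthonormal_le_dimension _ F _ m _ _ _ dim).
    - by move=> i; exact: lE.
    - move=> i j; rewrite oE//; congr (_%:R).
      by rewrite (inj_eq val_inj) (inj_eq enum_val_inj).
    - by move=> i; have := enum_valP i; rewrite inE => /eqP <-; exact: eE.
  have fk (i : 'I_m) : (f i < k)%N.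
    by apply: (small _ w) => //; exact: (fw i (ltn_ord i)).
  pose g (i : 'I_m) : 'I_k := Ordinal (fk i).
  have ginj : injective g.
    move=> i j /(congr1 val)/= fij; apply: val_inj.
    by apply: finj => //; rewrite inE/=; exact: ltn_ord.
  rewrite -[X in (X <= _)%N]card_ord -(card_imset _ ginj); apply: subset_leq_card.
  apply/fintype.subsetP => _ /imsetP[i _ ->]; rewrite inE; apply/eqP.
  exact: (fw i (ltn_ord i)).
pose s := undup [seq nu (val i) | i <- enum 'I_k.+1].
have sM w : w \in s -> w <= M.
  by rewrite mem_undup => /mapP[i _ ->]; apply: nuM; exact: ltn_ord.
have cardE (N : nat) (h : nat -> R) w : #|[set i : 'I_N | h i == w]%SET| = (\sum_(i < N) (h i == w))%N.
  by rewrite -sum1dep_card big_mkcond; apply: eq_bigr => i _; case: eqP.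
have tot (N : nat) (h : nat -> R) : (\sum_(w <- s) #|[set i : 'I_N | h i == w]%SET| =
    \sum_(i < N) (h i \in s))%N.
  under eq_bigr do rewrite cardE.
  rewrite exchange_big; apply: eq_bigr => i _.
  rewrite -count_uniq_mem ?undup_uniq// -sum1_count [RHS]big_mkcond/=.
  by apply: eq_bigr => w _; rewrite eq_sym; case: eqP.
have : (k.+1 <= k)%N; last by rewrite ltnn.
apply: (@leq_trans (\sum_(w <- s) #|[set i : 'I_k.+1 | nu i == w]%SET|)).
  rewrite tot (eq_bigr (fun=> 1%N)) ?sum1_card ?card_ord// => i _.
  by rewrite mem_undup (_ : nu i \in _)//; apply/mapP; exists i; rewrite ?mem_enum.
apply: (@leq_trans (\sum_(w <- s) #|[set i : 'I_k | lam i == w]%SET|)).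
  by rewrite big_seq [leqRHS]big_seq; apply: leq_sum => w /sM; exact: mult.
by rewrite tot -[leqRHS]card_ord -sum1_card; apply: leq_sum => i _; exact: leq_b1.
Qed.

End counting.

(** * Radial trial functions *)

Section cutoff.
Context {R : realType}.
Local Notation leb := (@lebesgue_measure R).

Lemma theta_homo : {homo (@theta R) : x y / x <= y}.
Proof.
move=> x y xy; have [x0|x0] := leP x 0; first by rewrite theta_eq0// theta_ge0.
have y0 := lt_le_trans x0 xy.
by rewrite /theta /flat x0 y0 !hornerC !mul1r ler_expR lerN2 lef_pV2.
Qed.

Lemma primitive (f : R -> R) (s0 s1 : R) : continuous f ->
  (forall x, ~~ (s0 < x < s1) -> f x = 0) ->
  exists F : R -> R, forall x : R, is_derive x 1 F (f x).
Proof.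
move=> cf f0; have intf (A : set R) : measurable A -> leb.-integrable A (EFin \o f).
  move=> mA; suff: leb.-integrable setT (EFin \o f).
    by apply: integrableS.
  have fE : f \_ `[s0, s1] = f.
    apply/funext => x; rewrite patchE; case: ifPn => //; rewrite notin_setE/= in_itv/= => nx.
    by rewrite f0//; apply/negP => /andP[h1 h2]; apply: nx; rewrite !ltW.
  rewrite -fE -restrict_EFin; apply/integrable_restrict => //=; rewrite setTI.
  apply: continuous_compact_integrable; first exact: segment_compact.
  exact: continuous_subspaceT.
exists (fun x => \int[leb]_(t in [set` `]-oo, x]]) f t)%R => x.
have [||||d1 d2] := @continuous_FTC1 R f -oo%O x (x + 1).
- by rewrite ltrDl.
- exact: intf.
- by rewrite ltNyr.
- exact: cf.
by apply: DeriveDef => //; rewrite -derive1E.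
Qed.

(** The slope is a product of two steep copies of theta divided by its integral.
    As they get steeper the integral tends to s1 - s0, so that any bound L above
    the inverse of s1 - s0 can be met. *)
Lemma smooth_cutoff (s0 s1 L : R) : s0 < s1 -> (s1 - s0)^-1 < L ->
  exists (phi phi' : R -> R),
  [/\ smooth1 phi', forall s : R, is_derive s 1 phi (phi' s),
      forall s, s <= s0 -> phi s = 1, forall s, s1 <= s -> phi s = 0 &
      forall s, `|phi' s| <= if s0 < s < s1 then L else 0].
Proof.
move=> s01 HL; have s10 : 0 < s1 - s0 by rewrite subr_gt0.
have L0 : 0 < L by rewrite (lt_trans _ HL)// invr_gt0.
have LV : L^-1 < s1 - s0 by rewrite -[ltRHS]invrK ltf_pV2// posrE// invr_gt0.
(* the length given up at both ends, where the steep copies of theta are not yet close to 1 *)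
pose del := (s1 - s0 - L^-1) / 4.
have del0 : 0 < del by rewrite divr_gt0// subr_gt0.
have ww : L^-1 < s1 - s0 - 2 * del.
  rewrite /del; lra.
have [k Hk] : exists k, L^-1 <= (s1 - s0 - 2 * del) * (theta (k.+1%:R * del) * theta (k.+1%:R * del)).
  have c1 := theta_cvg1 del0.
  have : (s1 - s0 - 2 * del) * (theta (k.+1%:R * del) * theta (k.+1%:R * del)) @[k --> \oo]
     --> (s1 - s0 - 2 * del) * (1 * 1) by apply: cvgMr; exact: (cvgM c1 c1).
  rewrite !mulr1 => /cvgr_ge/(_ _ ww)[N _ HN]; exists N; by apply: HN => /=.
pose g s := theta (k.+1%:R * (s - s0)) * theta (k.+1%:R * (s1 - s)).
have g_ge0 s : 0 <= g s by rewrite mulr_ge0// theta_ge0.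
have g_le1 s : g s <= 1.
  by rewrite /g -[leRHS]mulr1; apply: ler_pM; rewrite ?theta_ge0 ?theta_le1.
have g0 s : ~~ (s0 < s < s1) -> g s = 0.
  rewrite negb_and -!leNgt /g => /orP[H|H].
    by rewrite theta_eq0 ?mul0r// pmulr_rle0// subr_le0.
  by rewrite [theta (_ * (s1 - s))]theta_eq0 ?mulr0// pmulr_rle0// subr_le0.
have sg : smooth1 g.
  apply: smooth1_mul.
    rewrite (_ : (fun t => _) = (fun t => flat 1 (k.+1%:R * t + - (k.+1%:R * s0)))).
      exact: smooth1_flat.
    by apply/funext => t; rewrite mulrBr.
  rewrite (_ : (fun t => _) = (fun t => flat 1 (- k.+1%:R * t + k.+1%:R * s1))).
    exact: smooth1_flat.
  by apply/funext => t; rewrite mulrBr mulNr addrC.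
have [G dG] := primitive (smooth1_continuous sg) g0.
have cG : continuous G by exact: (is_derive1_continuous dG).
have mvt x y : x < y -> exists2 z, x < z < y & G y - G x = g z * (y - x).
  move=> xy; have [z] := MVT xy (fun z _ => dG z) (continuous_subspaceT cG).
  by rewrite in_itv => zxy E; exists z.
have Gl s : s <= s0 -> G s = G s0.
  rewrite le_eqVlt => /predU1P[->//|ss]; have [z /andP[z1 z2]] := mvt _ _ ss.
  have -> : g z = 0 by apply: g0; rewrite (le_gtF (ltW z2)).
  by rewrite mul0r => /eqP; rewrite subr_eq0 => /eqP.
have Gr s : s1 <= s -> G s = G s1.
  rewrite le_eqVlt => /predU1P[<-//|ss]; have [z /andP[z1 z2]] := mvt _ _ ss.
  have -> : g z = 0 by apply: g0; rewrite (le_gtF (ltW z1)) andbF.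
  by rewrite mul0r => /eqP; rewrite subr_eq0 => /eqP.
have Gh x y : x <= y -> G x <= G y.
  rewrite le_eqVlt => /predU1P[->//|xy]; have [z _ E] := mvt _ _ xy.
  by rewrite -subr_ge0 E mulr_ge0// subr_ge0 ltW.
pose I := G s1 - G s0.
have IL : L^-1 <= I.
  have dd : s0 + del < s1 - del by rewrite -subr_gt0; have := invr_gt0 L; rewrite L0; lra.
  have [z /andP[z1 z2] E] := mvt _ _ dd.
  have h1 : G s0 <= G (s0 + del) by apply: Gh; rewrite lerDl ltW.
  have h2 : G (s1 - del) <= G s1 by apply: Gh; rewrite gerBl ltW.
  have : L^-1 <= G (s1 - del) - G (s0 + del).
    rewrite E (le_trans Hk)// mulrC.
    rewrite (_ : s1 - del - (s0 + del) = s1 - s0 - 2 * del); last by ring.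
    have w0 : 0 <= s1 - s0 - 2 * del by rewrite (le_trans _ (ltW ww))// invr_ge0 ltW.
    apply: ler_wpM2r => //.
    by rewrite /g; apply: ler_pM; rewrite ?theta_ge0 ?theta_homo// ler_wpM2l//; lra.
  rewrite /I; lra.
have I0 : 0 < I by rewrite (lt_le_trans _ IL)// invr_gt0.
have IV : I^-1 <= L by rewrite -[leRHS]invrK lef_pV2// posrE// invr_gt0.
exists (fun s => 1 + - I^-1 * (G s - G s0)), (fun s => - I^-1 * g s); split.
- by apply: smooth1_mul => //; exact: smooth1_cst.
- move=> s; refine (is_derive_eq (is_deriveD (is_derive_cst (1 : R) s (1 : R))
    (is_deriveZ (- I^-1) (is_deriveB (dG s) (is_derive_cst (G s0) s (1 : R)))) :
     is_derive s (1 : R) (fun s => 1 + - I^-1 * (G s - G s0)) _) _).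
  by rewrite add0r subr0.
- by move=> s /Gl ->; rewrite subrr mulr0 addr0.
- by move=> s /Gr ->; rewrite -/I mulNr mulVf ?gt_eqF// subrr.
- move=> s; case: ifPn => [_|/g0 ->]; last by rewrite mulr0 normr0.
  rewrite normrM normrN !ger0_norm ?invr_ge0 ?(ltW I0)//.
  by rewrite -[leRHS]mulr1 ler_pM// invr_ge0 ltW.
Qed.

End cutoff.

Section euclidean_ball.
Context {R : realType} {n : nat}.
Local Notation mu := (@lebesgue_rV R n).
Implicit Types (x z : 'rV[R]_n) (rho : R).

Lemma enorm_ge0 x : 0 <= enorm x. Proof. exact: sqrtr_ge0. Qed.

Lemma enorm_sqr x : enorm x ^+ 2 = \sum_i x 0 i ^+ 2.
Proof. by rewrite sqr_sqrtr// sumr_ge0// => i _; exact: sqr_ge0. Qed.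

Lemma coord_le_enorm x i : `|x 0 i| <= enorm x.
Proof.
rewrite -(@ler_pXn2r _ 2) ?nnegrE ?enorm_ge0// enorm_sqr real_normK ?num_real//.
by rewrite (bigD1 i)//= lerDl sumr_ge0// => j _; exact: sqr_ge0.
Qed.

Lemma norm_le_enorm x : `|x| <= enorm x.
Proof.
apply/ler_addgt0Pl => e e0; apply: ltW.
have he : 0 < e + enorm x by rewrite ltr_pwDl// enorm_ge0.
by apply/rV_norm_ltP => // i; rewrite (le_lt_trans (coord_le_enorm x i))// ltrDr.
Qed.

Lemma enormZ (c : R) x : 0 <= c -> enorm (c *: x) = c * enorm x.
Proof.
move=> c0; apply/eqP; rewrite -(@eqrXn2 _ 2) ?mulr_ge0 ?enorm_ge0//.
rewrite exprMn !enorm_sqr mulr_sumr; apply/eqP; apply: eq_bigr => i _.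
by rewrite mxE exprMn.
Qed.

Lemma enorm_continuous : continuous (@enorm R n).
Proof.
move=> x; apply: (@continuous_comp _ _ _ (fun x => \sum_i x 0 i ^+ 2) (@Num.sqrt R)); last exact: sqrt_continuous.
apply: (smooth_alg_continuous (smooth_alg_sum _)) => i.
by apply: smooth_alg_mul; exact: smooth_alg_coord.
Qed.

Lemma open_eball z rho : open [set x | enorm (x - z) < rho].
Proof.
apply: (@open_comp _ _ (fun x : 'rV[R]_n => enorm (x - z)) [set y | y < rho]); last exact: open_lt.
move=> x _; apply: (@continuous_comp _ _ _ (fun x : 'rV[R]_n => x - z)); last exact: enorm_continuous.
by apply: continuousD; [exact: cvg_id|exact: cst_continuous].
Qed.

Lemma open_eshell z (r1 r2 : R) : open [set x | r1 < enorm (x - z) < r2].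
Proof.
rewrite (_ : mkset _ = [set x | r1 < enorm (x - z)] `&` [set x | enorm (x - z) < r2]).
  apply: openI; last exact: open_eball.
  apply: (@open_comp _ _ (fun x : 'rV[R]_n => enorm (x - z)) [set y | r1 < y]); last exact: open_gt.
  move=> x _; apply: (@continuous_comp _ _ _ (fun x : 'rV[R]_n => x - z)); last exact: enorm_continuous.
  by apply: continuousD; [exact: cvg_id|exact: cst_continuous].
by apply/seteqP; split => x /=; [move=> /andP[]|move=> []->].
Qed.

Lemma eball_fin z rho : (mu [set x | (enorm (x - z) < rho)%R] < +oo)%E.
Proof.
apply: lebesgue_bounded_lty; first by apply: open_rV_measurable; exact: open_eball.
exists (rho + `|z|); split; first exact: num_real.
move=> y hy x /= xr; apply: le_trans (ltW hy).
rewrite -[x](subrK z) (le_trans (ler_normD _ _))// lerD2r.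
by rewrite (le_trans (norm_le_enorm _))// ltW.
Qed.

Lemma lebesgue_eball z rho : 0 < rho ->
  mu [set x | enorm (x - z) < rho] = (rho ^+ n * (@unit_ball_volume R n))%:E.
Proof.
move=> r0; rewrite -(@lebesgue_rV_affine R n rho z)//; last first.
  by apply: open_rV_measurable; exact: open_eball.
have -> : affine rho z @^-1` [set x | enorm (x - z) < rho] = [set x : 'rV[R]_n | enorm x < 1].
  apply/seteqP; split => x /=; rewrite /affine addrK enormZ ?(ltW r0)//.
    by rewrite -[ltRHS]mulr1 ltr_pM2l.
  by move=> h; rewrite -[ltRHS]mulr1 ltr_pM2l.
rewrite EFinM; congr (_ * _)%E; rewrite /unit_ball_volume fineK//.
have := eball_fin 0 1; rewrite ge0_fin_numE//.
by under [X in mu X]eq_set do rewrite subr0.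
Qed.

(** The ball contains a cube of side (n + 1)^-1. *)
Lemma unit_ball_volume_gt0 : 0 < (@unit_ball_volume R n).
Proof.
have h0 : 0 < (n.+1%:R)^-1 :> R by rewrite invr_gt0.
rewrite -lte_fin -[X in (_ < X%:E)%E]mul1r -(expr1n _ n) -(lebesgue_eball 0 ltr01).
apply: (@lt_le_trans _ _ (mu (cube 0 (n.+1%:R)^-1))).
  by rewrite lebesgue_cube// lte_fin exprn_gt0.
apply: le_measure; rewrite ?inE.
- exact: measurable_cube.
- by apply: open_rV_measurable; exact: open_eball.
- move=> x /= cx; rewrite subr0 -(@ltr_pXn2r _ 2) ?nnegrE ?enorm_ge0// expr1n enorm_sqr.
  apply: (@le_lt_trans _ _ (\sum_(i < n) (n.+1%:R)^-1)).
    apply: ler_sum => i _; have /andP[] := cx i; rewrite !mxE add0r => h1 h2.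
    rewrite expr2 -[leRHS]mulr1 ler_pM// ltW// (lt_le_trans h2)// invf_le1 ?ler1n//.
  by rewrite sumr_const card_ord -[_ *+ n]mulr_natr ltr_pdivrMl// mulr1 ltr_nat.
Qed.

End euclidean_ball.

Section radial.
Context {R : realType} {n : nat}.
Local Notation mu := (@lebesgue_rV R n).
Implicit Types (x z : 'rV[R]_n).

(** The profile is a function of the squared distance, which is smooth at z. *)
Definition radial (phi : R -> R) z : 'rV[R]_n -> R := fun x => phi (enorm (x - z) ^+ 2).

Variables (phi phi' : R -> R) (z : 'rV[R]_n).
Hypotheses (sphi : smooth1 phi') (dphi : forall s : R, is_derive s 1 phi (phi' s)).

Let sq_coord i : smooth_alg (fun x : 'rV[R]_n => (x 0 i - z 0 i) * (x 0 i - z 0 i)).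
Proof.
have h : smooth_alg (fun x : 'rV[R]_n => x 0 i - z 0 i).
  by apply: smooth_alg_add; [exact: smooth_alg_coord|exact: smooth_alg_cst].
exact: smooth_alg_mul.
Qed.

Let sqE x : enorm (x - z) ^+ 2 = \sum_i (x 0 i - z 0 i) * (x 0 i - z 0 i).
Proof. by rewrite enorm_sqr; apply: eq_bigr => i _; rewrite !mxE expr2. Qed.

Lemma smooth_alg_radial : smooth_alg (radial phi z).
Proof.
apply: smooth_alg_comp sphi dphi _.
under eq_fun do rewrite sqE.
exact: (smooth_alg_sum sq_coord).
Qed.

Lemma partial_radial j x :
  partial j (radial phi z) x = phi' (enorm (x - z) ^+ 2) * (2 * (x 0 j - z 0 j)).
Proof.
have dsq : is_derive x (delta_mx 0 j) (fun y : 'rV[R]_n => enorm (y - z) ^+ 2) (2 * (x 0 j - z 0 j)).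
  under eq_fun do rewrite sqE.
  have dc i : is_derive x (delta_mx 0 j) (fun y : 'rV[R]_n => y 0 i - z 0 i) ((i == j)%:R : R).
    refine (is_derive_eq (is_deriveB (is_derive_coord x (delta_mx 0 j) i)
      (is_derive_cst (z 0 i) x (delta_mx 0 j)) :
      is_derive x (delta_mx 0 j) (fun y : 'rV[R]_n => y 0 i - z 0 i) _) _).
    by rewrite subr0 mxE eqxx.
  rewrite (_ : (fun y : 'rV[R]_n => _) =
     \sum_(i < n) (fun y : 'rV[R]_n => (y 0 i - z 0 i) * (y 0 i - z 0 i))); last first.
    by apply/funext => y; rewrite fct_sumE.
  refine (is_derive_eq (is_derive_sum (fun i => is_deriveM (dc i) (dc i))) _).
  rewrite (bigD1 j)//= big1 => [|i ij]; last by rewrite (negbTE ij) scaler0 addr0.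
  by rewrite eqxx addr0 -mulr2n [_ *: _]mulr1 mulr_natl.
exact: (@derive_val _ _ _ _ _ _ _ (is_derive_compn (dphi _) dsq)).
Qed.

Lemma radial_grad_sqr x : \sum_j partial j (radial phi z) x ^+ 2 =
  4 * phi' (enorm (x - z) ^+ 2) ^+ 2 * enorm (x - z) ^+ 2.
Proof.
rewrite [X in _ = _ * X]enorm_sqr mulr_sumr; apply: eq_bigr => j _.
by rewrite partial_radial !mxE; ring.
Qed.

End radial.

Lemma bernoulli_ge (R : realFieldType) (t : R) n : 0 <= t <= 1 -> 1 - n%:R * t <= (1 - t) ^+ n.
Proof.
move=> /andP[t0 t1]; elim: n => [|n IH]; first by rewrite mul0r subr0 expr0.
rewrite exprS; have h : 0 <= 1 - t by rewrite subr_ge0.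
apply: le_trans (ler_wpM2l h IH).
rewrite -subr_ge0 (_ : _ - _ = n%:R * (t * t)); first by rewrite !mulr_ge0.
by rewrite -natr1; ring.
Qed.

Section trial.
Context {R : realType} {n : nat}.
Local Notation mu := (@lebesgue_rV R n).
Variables (Om : set 'rV[R]_n) (oO : open Om).
Let mOm : measurable Om. Proof. exact: open_rV_measurable. Qed.
Hint Resolve mOm : core.
Variables (a b : 'rV[R]_n -> R) (c C : R).
Hypotheses (ma : measurable_fun Om a) (mb : measurable_fun Om b) (c0 : 0 < c).
Hypothesis aC : forall x, Om x -> c <= a x <= C.
Hypothesis bC : forall x, Om x -> c <= b x <= C.
Variables (z : 'rV[R]_n) (rho d alpha beta : R).
Hypotheses (d0 : 0 < d) (dr : d < rho) (alpha0 : 0 < alpha) (beta0 : 0 < beta).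
Hypothesis zO : forall x, `|x - z| <= rho -> Om x.
Hypothesis ashell : forall x, rho - d < enorm (x - z) < rho -> a x = alpha.
Hypothesis bcore : forall x, enorm (x - z) < rho - d -> b x = beta.

(** The profile drops from 1 to 0 while the squared distance s goes from
    (rho - d)^2 to rho^2. The bound L on its slope exceeds the inverse of the
    length d * (2 * rho - d) of this interval, by a factor that tends to 1 with
    d / rho. On the shell the squared gradient 4 * s * phi'(s)^2 is then at most
    K = (d^2 * (1 - d / rho)^4)^-1. As for the volumes, the core has a fraction
    (1 - d / rho)^n of the ball, and the shell at most the fraction n * d / rho
    by Bernoulli's inequality. *)
Lemma trial_function : exists v, [/\ rtest Om v,
  forall o x, rho <= enorm (x - z) -> jet_of v o x = 0,
  0 < mass Om b (jet_of v) (jet_of v) &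
  stiff Om a (jet_of v) (jet_of v) <=
  alpha * n%:R / (d * rho * beta * (1 - d / rho) ^+ (n + 4)) *
    mass Om b (jet_of v) (jet_of v)].
Proof.
have r0 : 0 < rho := lt_trans d0 dr.
have rd0 : 0 < rho - d by rewrite subr_gt0.
have t1 : 0 < 1 - d / rho by rewrite subr_gt0 ltr_pdivrMr// mul1r.
pose s0 := (rho - d) ^+ 2; pose s1 := rho ^+ 2.
pose L := (2 * rho * d * (1 - d / rho) ^+ 2)^-1.
have s01 : s0 < s1 by rewrite ltr_pXn2r ?nnegrE ?(ltW r0) ?(ltW rd0)// ltrBlDr ltrDl.
have HL : (s1 - s0)^-1 < L.
  rewrite ltf_pV2 ?posrE ?subr_gt0//; last by rewrite !mulr_gt0// exprn_gt0.
  rewrite (_ : 2 * rho * d * (1 - d / rho) ^+ 2 = 2 * d * (rho - d) ^+ 2 / rho); last first.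
    by field; rewrite gt_eqF.
  rewrite ltr_pdivrMr// -subr_gt0.
  rewrite (_ : _ - _ = d * d * (3 * (rho - d) + d)); last by rewrite /s1 /s0; ring.
  by rewrite !mulr_gt0// addr_gt0// mulr_gt0.
have [phi [phi' [sphi dphi phi1 phi0 phi'L]]] := smooth_cutoff s01 HL.
pose v := radial phi z.
have sv : smooth v by exact: (smooth_algP (smooth_alg_radial _ sphi dphi)).
have sq_lt x r : 0 < r -> (enorm (x - z) ^+ 2 < r ^+ 2) = (enorm (x - z) < r).
  by move=> r0'; rewrite ltr_pXn2r ?nnegrE ?enorm_ge0// ltW.
have sq_gt x r : 0 < r -> (r ^+ 2 < enorm (x - z) ^+ 2) = (r < enorm (x - z)).
  by move=> r0'; rewrite ltr_pXn2r ?nnegrE ?enorm_ge0// ltW.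
have vout x : rho <= enorm (x - z) -> v x = 0.
  by move=> xr; rewrite /v /radial phi0// leNgt sq_lt// -leNgt.
have tv : rtest Om v.
  split=> //; exists (cbox (\row_i (z 0 i - rho)) (\row_i (z 0 i + rho))); split.
  - exact: compact_cbox.
  - move=> x xb; apply: zO; rewrite leNgt; apply/negP => rx.
    have : `|x - z| < `|x - z|; last by rewrite ltxx.
    apply/rV_norm_ltP; first exact: lt_trans rx.
    move=> i; apply: le_lt_trans rx; have := xb i; rewrite !mxE => /andP[h1 h2].
    by rewrite ler_norml; apply/andP; split; lra.
  - move=> x nb; apply: vout; rewrite leNgt; apply/negP => xr; apply: nb => i.
    have := le_lt_trans (coord_le_enorm (x - z) i) xr; rewrite !mxE.
    by rewrite ltr_norml => /andP[h1 h2]; apply/andP; split; lra.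
have pv j x : partial j v x = phi' (enorm (x - z) ^+ 2) * (2 * (x 0 j - z 0 j)).
  exact: partial_radial.
pose S := [set x | rho - d < enorm (x - z) < rho].
pose B := [set x | enorm (x - z) < rho - d].
pose B1 := [set x | enorm (x - z) < rho].
have phi'0 x : ~ S x -> phi' (enorm (x - z) ^+ 2) = 0.
  move=> nS; have := phi'L (enorm (x - z) ^+ 2); rewrite sq_lt// sq_gt//.
  by case: ifPn => [/nS//|_]; rewrite normr_le0 => /eqP.
have mS : measurable S by apply: open_rV_measurable; exact: open_eshell.
have mB : measurable B by apply: open_rV_measurable; exact: open_eball.
have mB1 : measurable B1 by apply: open_rV_measurable; exact: open_eball.
have B1O : B1 `<=` Om.
  by move=> x /= xr; apply: zO; rewrite (le_trans (norm_le_enorm _))// ltW.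
have SB1 : S `<=` B1 by move=> x /= /andP[].
have BB1 : B `<=` B1 by move=> x /= /lt_le_trans; apply; rewrite gerBl ltW.
have B1oo := eball_fin z rho.
have Soo : (mu S < +oo)%E.
  by apply: le_lt_trans B1oo; apply: le_measure; rewrite ?inE.
have Boo : (mu B < +oo)%E.
  by apply: le_lt_trans B1oo; apply: le_measure; rewrite ?inE.
pose kap := @unit_ball_volume R n; have kap0 : 0 < kap := unit_ball_volume_gt0.
have muB : fine (mu B) = (rho - d) ^+ n * kap by rewrite lebesgue_eball.
have muS : fine (mu S) <= rho ^+ n * kap - (rho - d) ^+ n * kap.
  rewrite lerBrDr -muB -fineD ?ge0_fin_numE//.
  have -> : rho ^+ n * kap = fine (mu B1) by rewrite lebesgue_eball.
  rewrite -measureU//.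
    apply: fine_le; rewrite ?ge0_fin_numE//.
      by rewrite measureU ?lte_add_pinfty//; apply/seteqP; split => x //= [/andP[h1 _] /lt_trans/(_ h1)]; rewrite ltxx.
    by apply: le_measure; rewrite ?inE//; [exact: measurableU|move=> x []; [exact: SB1|exact: BB1]].
  by apply/seteqP; split => x //= [/andP[h1 _] /lt_trans/(_ h1)]; rewrite ltxx.
have lv := jet_of_l2 oO tv.
have mass_ge : beta * ((rho - d) ^+ n * kap) <= mass Om b (jet_of v) (jet_of v).
  rewrite -muB; have [i1 <-] := Rintegral_indic mOm beta mB (subset_trans BB1 B1O) Boo.
  have i2 := ip_integrable mOm mb (weight_bounded c0 bC) (lv None) (lv None).
  apply: le_Rintegral i1 i2 _ => // x Ox.
  rewrite indicE; case: (boolP (x \in B)) => [/set_mem Bx|_]; last first.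
    rewrite mulr0 mulr_ge0//; last by rewrite -expr2 sqr_ge0.
    by have /andP[h _] := bC Ox; rewrite (le_trans (ltW c0)).
  by rewrite bcore//= /v /radial phi1 ?mulr1// /s0 ltW// sq_lt.
have mass0 : 0 < mass Om b (jet_of v) (jet_of v).
  by rewrite (lt_le_trans _ mass_ge)// !mulr_gt0// exprn_gt0.
pose K := (d ^+ 2 * (1 - d / rho) ^+ 4)^-1.
have K0 : 0 < K by rewrite invr_gt0 mulr_gt0// exprn_gt0.
have stiff_le : stiff Om a (jet_of v) (jet_of v) <= alpha * K * fine (mu S).
  have [i1 <-] := Rintegral_indic mOm (alpha * K) mS (subset_trans SB1 B1O) Soo.
  have [i2 e2] := Rintegral_sum mOm (index_enum 'I_n) (fun j =>
    ip_integrable mOm ma (weight_bounded c0 aC) (lv (Some j)) (lv (Some j))).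
  rewrite /stiff /ip -e2; apply: le_Rintegral i2 i1 _ => // x Ox.
  have -> : \sum_(j <- index_enum 'I_n) a x * (jet_of v (Some j) x * jet_of v (Some j) x) =
      a x * (4 * phi' (enorm (x - z) ^+ 2) ^+ 2 * enorm (x - z) ^+ 2).
    rewrite -(radial_grad_sqr z dphi) mulr_sumr.
    by apply: eq_bigr => j _; rewrite /= expr2.
  rewrite indicE; case: (boolP (x \in S)) => [/set_mem Sx|/negP nS]; last first.
    by rewrite phi'0 ?expr0n ?mulr0 ?mul0r ?mulr0// => Sx; apply: nS; exact: mem_set.
  rewrite ashell//= mulr1 ler_wpM2l ?(ltW alpha0)//.
  have /andP[h1 h2] := Sx.
  apply: (@le_trans _ _ (4 * L ^+ 2 * rho ^+ 2)).
    apply: ler_pM; [by rewrite mulr_ge0 ?sqr_ge0|exact: sqr_ge0| |by rewrite ltW// sq_lt].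
    rewrite ler_wpM2l//; have := phi'L (enorm (x - z) ^+ 2).
    rewrite sq_lt// sq_gt// h1 h2 => h; rewrite -[X in X <= _]real_normK ?num_real//.
    by rewrite ler_pXn2r ?nnegrE// (le_trans _ h).
  rewrite le_eqVlt; apply/orP; left; apply/eqP; rewrite /L /K.
  by field; rewrite !gt_eqF// subr_gt0.
have rdE : (rho - d) ^+ n = rho ^+ n * (1 - d / rho) ^+ n.
  by rewrite -exprMn mulrBr mulr1 mulrCA divff ?mulr1// gt_eqF.
exists v; split=> //.
- move=> [j|] x xr /=; last exact: vout.
  rewrite pv phi'0 ?mul0r//= => /andP[_].
  by rewrite ltNge xr.
- apply: le_trans stiff_le _; apply: (@le_trans _ _ (alpha * K * (rho ^+ n * kap * (n%:R * (d / rho))))).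
    rewrite ler_pM2l ?mulr_gt0//; apply: le_trans muS _.
    rewrite rdE -subr_ge0.
    rewrite (_ : _ - _ = rho ^+ n * kap * ((1 - d / rho) ^+ n - (1 - n%:R * (d / rho)))); last by ring.
    have t01 : 0 <= d / rho <= 1.
      by rewrite divr_ge0 ?(ltW d0) ?(ltW r0)//= ler_pdivrMr// mul1r ltW.
    rewrite mulr_ge0 ?subr_ge0 ?bernoulli_ge//.
    by rewrite mulr_ge0 ?exprn_ge0 ?(ltW r0) ?(ltW kap0).
  apply: le_trans (_ : _ <= alpha * n%:R / (d * rho * beta * (1 - d / rho) ^+ (n + 4)) *
     (beta * ((rho - d) ^+ n * kap))) _; last first.
    rewrite ler_wpM2l// divr_ge0 ?mulr_ge0 ?exprn_ge0 ?(ltW t1) ?(ltW d0) ?(ltW r0) ?(ltW alpha0) ?(ltW beta0)//.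
  rewrite le_eqVlt; apply/orP; left; apply/eqP; rewrite rdE /K exprD.
  have := exprn_gt0 n t1; move: ((1 - d / rho) ^+ n) => X X0.
  move: (rho ^+ n) => Y; move: t1; move: (1 - d / rho) => T T0.
  by field; rewrite !gt_eqF.
Qed.

End trial.

(** * Lattice points near the origin *)

Section domain.
Context {R : realType} {m : nat}.
Local Notation vec := 'rV[R]_m.+1.
Variables (Om : set vec) (oO : open Om) (Om0 : Om 0).

(** Otherwise Om would be open and closed, and contain every line through 0. The
    distance to an empty boundary would be the infimum of the empty set, that is
    0, and no lattice point would be admissible. *)
Lemma boundary_nonempty M : (forall x, Om x -> `|x| < M) -> boundary Om !=set0.
Proof.
move=> OmM; apply: contrapT => bO.
have clO : closed Om.
  move=> x cx; apply: contrapT => nx; apply: bO; exists x; split=> // /interior_subset.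
  exact: nx.
pose v : vec := const_mx 1.
have cv : continuous (fun t : R => t *: v).
  by move=> t; apply: cvgZr_tmp; exact: cvg_id.
have : [set t : R | Om (t *: v)] = setT.
  have /connected_intervalP : is_interval [set: R] by [].
  apply.
  - by exists 0; rewrite /= scale0r.
  - exists [set t : R | Om (t *: v)]; last by rewrite setTI.
    by apply: open_comp => // t _; exact: cv.
  - exists [set t : R | Om (t *: v)]; last by rewrite setTI.
    by apply: closed_comp => // t _; exact: cv.
move=> /seteqP[_ /(_ M I)] /= /OmM.
rewrite ltNge => /negP; apply; apply: le_trans (coord_le_norm _ ord0).
by rewrite !mxE mulr1 ler_norm.
Qed.

Lemma edist_boundary_ge z del : (forall x, `|x| < del -> Om x) -> `|z| <= del / 2 ->
  boundary Om !=set0 -> del / 2 <= Defs.edist z (boundary Om).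
Proof.
move=> delO zdel [y0 by0]; apply: lb_le_inf; first by exists (enorm (z - y0)), y0.
move=> _ [y [_ ny] <-]; apply: le_trans (norm_le_enorm _).
have dy : del <= `|y|.
  by rewrite leNgt; apply/negP => /delO Oy; apply: ny; exact: (open_nbhs_nbhs (conj oO Oy)).
have := ler_normD (y - z) z; rewrite subrK distrC; lra.
Qed.

Hypothesis m0 : (0 < m)%N.
Let k0 : 'I_m := Ordinal m0.

(** Only k + 1 lattice points are needed, and those on one axis suffice. *)
Definition axis_cell (l : nat) : 'rV[int]_m := \row_k (if k == k0 then l%:Z else 0).

Lemma lattice_axis_coord eps l : lattice_point eps (axis_cell l) 0 (lift ord_max k0) = eps * l%:R :> R.
Proof. by rewrite mxE liftK mxE eqxx. Qed.

Lemma lattice_axis_norm eps l : 0 <= eps -> `|lattice_point eps (axis_cell l) : vec| <= eps * l%:R.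
Proof.
move=> eps0; have h0 : 0 <= eps * l%:R by rewrite mulr_ge0.
apply/ler_addgt0Pr => e e0; apply: ltW; apply/rV_norm_ltP; first by rewrite ltr_wpDl.
move=> i; apply: le_lt_trans (_ : _ <= eps * l%:R) _; last by rewrite ltrDl.
rewrite mxE; case: unliftP => [k _|_]; last by rewrite normr0.
rewrite mxE; case: eqP => _; last by rewrite mulr0 normr0.
by rewrite ger0_norm.
Qed.

Lemma axis_cellP eps del l : 0 < eps -> (forall x, `|x| < del -> Om x) -> 0 < del ->
  boundary Om !=set0 -> eps * l%:R <= del / 2 -> eps * Num.sqrt m.+1%:R <= del ->
  cells Om eps (axis_cell l).
Proof.
move=> eps0 delO del0 bO h1 h2; have hn := lattice_axis_norm l (ltW eps0).
split; first split.
- by apply: delO; rewrite (le_lt_trans hn)// (le_lt_trans h1)// ltr_pdivrMr// ltr_pMr// ltr1n.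
- by rewrite mxE unlift_none.
- apply: le_trans (edist_boundary_ge delO (le_trans hn h1) bO).
  by rewrite ler_pM2r.
Qed.

(** The lattice points differ by at least eps in one coordinate, more than the sum
    of the radii. *)
Lemma axis_cells_disjoint eps rho l l' x : 0 < eps -> 2 * rho < eps -> l != l' ->
  enorm (x - lattice_point eps (axis_cell l)) < rho ->
  rho <= enorm (x - lattice_point eps (axis_cell l')) :> R.
Proof.
move=> eps0 re ll' h; rewrite leNgt; apply/negP => h'.
have E i : (x - lattice_point eps (axis_cell i)) 0 (lift ord_max k0) =
    x 0 (lift ord_max k0) - eps * i%:R.
  by rewrite -lattice_axis_coord [LHS]mxE; congr (_ + _); rewrite [LHS]mxE.
have := le_lt_trans (coord_le_enorm _ (lift ord_max k0)) h.
have := le_lt_trans (coord_le_enorm _ (lift ord_max k0)) h'.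
rewrite !E !ltr_norml => /andP[a1 a2] /andP[b1 b2].
move: ll'; rewrite neq_ltn => /orP[] lt.
  have : eps * l%:R + eps <= eps * l'%:R by rewrite -[X in _ + X]mulr1 -mulrDr ler_pM2l// natr1 ler_nat.
  lra.
have : eps * l'%:R + eps <= eps * l%:R by rewrite -[X in _ + X]mulr1 -mulrDr ler_pM2l// natr1 ler_nat.
lra.
Qed.

End domain.

(** * The bound for a fixed period *)

Section weights.
Context {R : realType} {n : nat}.
Implicit Types (U : set 'rV[R]_n).

Lemma measurable_two_valued U (s : R) : open U ->
  measurable_fun setT (fun x => if x \in U then s else 1).
Proof.
move=> oU; rewrite (_ : (fun x => _) = (fun x => (s - 1) * \1_U x + 1)).
  apply: measurable_funD => //; apply: measurable_funM => //.
  by apply: measurable_indic; exact: open_rV_measurable.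
by apply/funext => x; rewrite indicE; case: ifP => _; rewrite ?mulr1 ?subrK ?mulr0 ?add0r.
Qed.

End weights.

Section bound.
Context {R : realType} {m : nat}.
Variables (Om : set 'rV[R]_m.+1) (M : R).
Hypotheses (oO : open Om) (Om0 : Om 0) (OmM : forall x, Om x -> `|x| < M) (M0 : 0 < M).
Hypothesis m0 : (0 < m)%N.

(** The min-max principle with the trial functions of the lattice points number
    0, ..., k on the axis. *)
Lemma eigenvalue_le_q (eps rad d alpha beta del : R) (lam : nat -> R) k :
  0 < eps -> 0 < rad < 1 / 2 -> 0 < d < rad * eps -> 0 < alpha -> 0 < beta ->
  (forall x, `|x| < del -> Om x) -> 0 < del ->
  eps * k%:R <= del / 2 -> eps * Num.sqrt m.+1%:R <= del -> rad * eps < del / 2 ->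
  eigenvalue_sequence Om (A_operator Om eps rad d alpha beta) lam ->
  lam k <= q_coef m eps rad d alpha beta / (1 - d / (rad * eps)) ^+ (m.+1 + 4).
Proof.
move=> eps0 /andP[rad0 rad1] /andP[d0 dr] alpha0 beta0 delO del0 e1 e2 e3 Hlam.
have bO := boundary_nonempty oO Om0 OmM.
have r0 : 0 < rad * eps by rewrite mulr_gt0.
have t1 : 0 < 1 - d / (rad * eps) by rewrite subr_gt0 ltr_pdivrMr// mul1r.
set a := a_coef Om eps rad d alpha; set b := b_coef Om eps rad d beta.
pose c := Num.min 1 (Num.min alpha beta); pose C := Num.max 1 (Num.max alpha beta).
have c0 : 0 < c by rewrite !lt_min ltr01 alpha0 beta0.
have ma : measurable_fun Om a.
  apply: measurable_funTS; apply: measurable_two_valued; apply: bigcup_open => i _.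
  exact: open_eshell.
have mb : measurable_fun Om b.
  apply: measurable_funTS; apply: measurable_two_valued; apply: bigcup_open => i _.
  exact: open_eball.
have aC x : Om x -> c <= a x <= C.
  by move=> _; rewrite /a /a_coef; case: ifP => _; rewrite !ge_min !le_max !lexx ?orbT.
have bC x : Om x -> c <= b x <= C.
  by move=> _; rewrite /b /b_coef; case: ifP => _; rewrite !ge_min !le_max !lexx ?orbT.
pose z (l : 'I_k.+1) := lattice_point eps (axis_cell m0 l) : 'rV[R]_m.+1.
have el (l : 'I_k.+1) : eps * l%:R <= del / 2.
  by rewrite (le_trans _ e1)// ler_pM2l// ler_nat -ltnS.
have cl (l : 'I_k.+1) : cells Om eps (axis_cell m0 l) by exact: (axis_cellP oO m0 eps0 delO del0 bO (el l) e2).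
have zO l x : `|x - z l| <= rad * eps -> Om x.
  move=> xz; apply: delO; have := ler_normD (x - z l) (z l); rewrite subrK.
  have := le_trans (lattice_axis_norm m0 l (ltW eps0)) (el l); rewrite -/(z l); lra.
have ash l x : rad * eps - d < enorm (x - z l) < rad * eps -> a x = alpha.
  by move=> xz; rewrite /a /a_coef mem_set//; exists (axis_cell m0 l).
have bco l x : enorm (x - z l) < rad * eps - d -> b x = beta.
  by move=> xz; rewrite /b /b_coef mem_set//; exists (axis_cell m0 l).
have [v Hv] := choice (fun l : 'I_k.+1 => trial_function oO ma mb c0 aC bC d0 dr alpha0 beta0
  (zO l) (ash l) (bco l)).
set Q := q_coef m eps rad d alpha beta / _.
have QE : Q = alpha * m.+1%:R / (d * (rad * eps) * beta * (1 - d / (rad * eps)) ^+ (m.+1 + 4)).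
  rewrite /Q /q_coef; move: (1 - _) t1 => T T0; have := exprn_gt0 (m.+1 + 4) T0.
  by move: (T ^+ _) => X X0; field; rewrite !gt_eqF.
have Q0 : 0 <= Q.
  by rewrite QE divr_ge0 ?mulr_ge0 ?exprn_ge0 ?ltW//.
have vv (i j : 'I_k.+1) o x : i != j -> jet_of (v i) o x * jet_of (v j) o x = 0.
  move=> ij; have [_ zi _ _] := Hv i; have [_ zj _ _] := Hv j.
  have [xi|xi] := leP (rad * eps) (enorm (x - z i)); first by rewrite zi ?mul0r.
  rewrite (zj o) ?mulr0//; apply: (axis_cells_disjoint eps0 _ _ xi); last by [].
  by rewrite -[ltRHS]mul1r mulrA ltr_pM2r//; lra.
have ip0 (w : 'rV[R]_m.+1 -> R) i j o : i != j -> ip (lebesgue_rV m.+1) Om w (jet_of (v i) o) (jet_of (v j) o) = 0.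
  move=> ij; rewrite /ip Rintegral_eq0//; first exact: open_rV_measurable.
  by move=> x _; rewrite vv// mulr0.
have tv i : rtest Om (v i) by case: (Hv i).
have v0 i : 0 < mass Om b (jet_of (v i)) (jet_of (v i)) by case: (Hv i).
have vR i : stiff Om a (jet_of (v i)) (jet_of (v i)) <= Q * mass Om b (jet_of (v i)) (jet_of (v i)).
  by rewrite QE; case: (Hv i).
have vs i j : i != j -> stiff Om a (jet_of (v i)) (jet_of (v j)) = 0.
  by move=> ij; rewrite /stiff big1// => l _; exact: ip0.
have [E [nu [sE oE eE]]] := eigenpairs_below oO OmM M0 ma mb c0 aC bC Q0 tv v0
  (fun i j ij => ip0 b i j None ij) vs vR.
apply: (eigenvalue_le oO mb (weight_bounded c0 bC) Hlam (E := E) (nu := nu)).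
- by move=> i ik; exact: (sE i ik).1.
- exact: oE.
- by move=> i /eE[].
- move=> i ik; have [_ _ H] := eE i ik.
  exact: (cx_eigenfunction oO ma mb c0 aC bC (sE i ik) H).
Qed.

End bound.

(** * The limit *)

(* The space dimension is n = m.+1, and x_n is the coordinate ord_max. *)
Theorem theorem2p2 (R : realType) (m : nat) (Om : set 'rV[R]_m.+1)
    (rad eps0 : R) (d alpha beta : R -> R) (q : \bar R) (r : R)
    (lam : R -> nat -> R) :
  (2 <= m.+1)%N ->
  bounded_lipschitz_domain Om ->
  Om 0 ->
  0 < rad < 1 / 2 ->
  0 < eps0 ->
  (forall eps, 0 < eps < eps0 -> 0 < d eps < rad * eps) ->
  d eps / eps @[eps --> 0^'+] --> 0 ->
  (forall eps, 0 < eps < eps0 -> 0 < alpha eps) ->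
  (forall eps, 0 < eps < eps0 -> 0 < beta eps) ->
  d eps ^+ 2 / alpha eps @[eps --> 0^'+] --> 0 ->
  (0 <= q)%E ->
  (q_coef m eps rad (d eps) (alpha eps) (beta eps))%:E @[eps --> 0^'+] --> q ->
  0 <= r ->
  r_coef m eps rad (beta eps) @[eps --> 0^'+] --> r ->
  (forall eps, 0 < eps < eps0 ->
    eigenvalue_sequence Om
      (A_operator Om eps rad (d eps) (alpha eps) (beta eps)) (lam eps)) ->
  (ereal_sup [set limf_esup (fun eps => (lam eps k)%:E) 0^'+ | k in setT]
    <= q)%E.
Proof.
move=> m1 [oO _ bO _] Om0 radb eps00 dlim dcv alpha0 beta0 _ q0 qcv _ _ Hlam.
have m0 : (0 < m)%N by [].
have [M M0 OmM] := bounded_setP bO.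
have [del del0 delO] : exists2 del : R, 0 < del & forall x : 'rV[R]_m.+1, `|x| < del -> Om x.
  have : nbhs (0 : 'rV[R]_m.+1) Om by exact: open_nbhs_nbhs (conj oO Om0).
  move=> /nbhs_ballP[e /= e0 He]; exists e => // x xe; apply: He.
  by rewrite -ball_normE /= sub0r normrN.
have /andP[rad0 _] := radb.
apply: ge_ereal_sup => _ [k _ <-].
case: q q0 qcv => [q q0 /fine_cvgP[_ qcv]|_ _|//]; last exact: leey.
apply/lee_addgt0Pr => e e0.
have near_le : \forall eps \near (0 : R)^'+, lam eps k <= q + e.
  (* the denominator tends to 1 *)
  have tcv : q_coef m eps rad (d eps) (alpha eps) (beta eps) /
      (1 - d eps / eps / rad) ^+ (m.+1 + 4) @[eps --> 0^'+] --> q / (1 - 0 / rad) ^+ (m.+1 + 4).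
    apply: cvgM; first exact: qcv.
    apply: cvgV; first by rewrite mul0r subr0 expr1n oner_neq0.
    have c1 : 1 - d eps / eps / rad @[eps --> 0^'+] --> 1 - 0 / rad.
      by apply: cvgB; [exact: cvg_cst|apply: cvgMl].
    exact: (continuous_cvg _ (@exprn_continuous R (m.+1 + 4) _) c1).
  rewrite mul0r subr0 expr1n divr1 in tcv.
  have qe : q < q + e by rewrite ltrDl.
  move: tcv => /cvgr_le/(_ _ qe) near1.
  (* the smallness conditions on eps are all of this form *)
  have lin (c b : R) : 0 <= c -> 0 < b -> \forall eps \near (0 : R)^'+, eps * c <= b.
    move=> c0 b0; near=> t.
    have t0 : 0 < t by near: t; exact: nbhs_right_gt.
    apply: (@le_trans _ _ (t * (c + 1))); first by rewrite ler_pM2l// lerDl.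
    by rewrite -ler_pdivlMr ?ltr_wpDl//; near: t; apply: nbhs_right_ltW; rewrite divr_gt0// ltr_wpDl.
  near=> eps.
  have epos : 0 < eps by near: eps; exact: nbhs_right_gt.
  have epsb : 0 < eps < eps0.
    by rewrite epos /=; near: eps; exact: nbhs_right_lt.
  apply: le_trans (_ : _ <= q_coef m eps rad (d eps) (alpha eps) (beta eps) /
      (1 - d eps / eps / rad) ^+ (m.+1 + 4)) _; last by near: eps; exact: near1.
  rewrite (_ : d eps / eps / rad = d eps / (rad * eps)); last first.
    by rewrite invfM mulrA mulrAC.
  apply: (eigenvalue_le_q oO Om0 OmM M0 m0 epos radb (dlim _ epsb) (alpha0 _ epsb)
    (beta0 _ epsb) delO del0 _ _ _ (Hlam _ epsb)).
  - by near: eps; apply: lin => //; rewrite divr_gt0.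
  - by near: eps; apply: lin.
  - apply: (@le_lt_trans _ _ (del / 4)); last by lra.
    by rewrite mulrC; near: eps; apply: lin; rewrite ?(ltW rad0)// divr_gt0.
apply: (@le_trans _ _ (ereal_sup ((fun eps => (lam eps k)%:E) @` [set eps | lam eps k <= q + e]))).
  by apply: ereal_inf_lbound; eexists; [exact: near_le|].
by apply: ge_ereal_sup => _ [eps /= h <-]; rewrite lee_fin.
Unshelve. all: by end_near. Qed.
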